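(* Let $p$ be a prime, let $F$ be a global function field of characteristic $p$, let $f\in F(x)$ be a rational function of degree $d$ with $p\nmid d$, and let $\alpha\in F$. Put $F_\infty^{\mathrm{ab}}(f,\alpha)=F\bigl(f^{-\infty}(\alpha)\cap F^{\mathrm{ab}}\bigr)$. Then the extension $F_\infty^{\mathrm{ab}}(f,\alpha)/F$ ramifies only at a finite number of primes of $F$.
   Context: A global function field of characteristic $p$ is a finite extension of $\mathbb{F}_p(t)$. $F^{\mathrm{ab}}$ is the maximal abelian extension of $F$ inside a fixed separable closure. $f^{-\infty}(\alpha)=\bigcup_{n\ge 0}f^{-n}(\alpha)$ is the set of all iterated preimages of $\alpha$ under $f$, where $f^n$ is the $n$-th iterate. *)

(* Defs.v *)
From HB Require Import structures.
From mathcomp Require Import all_boot all_order all_fingroup all_algebra all_field.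
From mathcomp Require Import boolp classical_sets functions cardinality.

Set Implicit Arguments.
Unset Strict Implicit.
Unset Printing Implicit Defensive.

Import GRing.Theory.
Local Open Scope classical_set_scope.
Local Open Scope ring_scope.

Definition is_separable_closure (F L : fieldType) (iota : {rmorphism F -> L}) :
    Prop :=
  (forall x : L, exists2 P : {poly F},
      separable_poly P & root (map_poly iota P) x) /\
  (forall P : {poly L}, separable_poly P -> (1 < size P)%N ->
      exists x : L, root P x).

(* The representative of a class in {fraction _} need not be in lowest terms,
   hence the divisions by the gcd. *)
Definition ratnum (F : fieldType) (f : {fraction {poly F}}) : {poly F} :=
  let r := generic_quotient.repr f in (\n_r) %/ gcdp (\n_r) (\d_r).

Definition ratden (F : fieldType) (f : {fraction {poly F}}) : {poly F} :=
  let r := generic_quotient.repr f in (\d_r) %/ gcdp (\n_r) (\d_r).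

Definition ratdeg (F : fieldType) (f : {fraction {poly F}}) : nat :=
  (maxn (size (ratnum f)) (size (ratden f))).-1.

(* The self-map of P^1(L) induced by f, where P^1(L) is option L and None is
   the point at infinity. *)
Definition ratmap (F L : fieldType) (iota : {rmorphism F -> L})
    (f : {fraction {poly F}}) (x : option L) : option L :=
  let P := map_poly iota (ratnum f) in
  let Q := map_poly iota (ratden f) in
  let quot (a b : L) := if b == 0 then None else Some (a / b) in
  if x is Some c then quot P.[c] Q.[c] else quot P`_(ratdeg f) Q`_(ratdeg f).

(* An orbit may pass through infinity before it reaches alpha. *)
Definition backward_orbit (F L : fieldType) (iota : {rmorphism F -> L})
    (f : {fraction {poly F}}) (alpha : F) : set L :=
  [set x | exists n : nat,
     iter n (ratmap iota f) (Some x) = Some (iota alpha)].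

(* F^ab inside L: the union of all finite abelian extensions of F inside L. *)
Definition max_abelian (F L : fieldType) (iota : {rmorphism F -> L}) : set L :=
  [set x | exists (E : splittingFieldType F) (k : {rmorphism E -> L}),
     [/\ forall a : F, k a%:A = iota a,
         galois 1 {:E},
         abelian 'Gal({:E} / 1)
       & range k x]].

(* The subfield F(S) of L. *)
Definition adjoin (F L : fieldType) (iota : {rmorphism F -> L}) (S : set L) :
    set L :=
  [set x | forall M : set L, divring_closed (mem M) ->
     range iota `<=` M -> S `<=` M -> M x].

Definition abelian_orbit_field (F L : fieldType) (iota : {rmorphism F -> L})
    (f : {fraction {poly F}}) (alpha : F) : set L :=
  adjoin iota (backward_orbit iota f alpha `&` max_abelian iota).

(* O is a valuation ring of the subfield M of K; M itself is allowed. *)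
Definition valuation_ring (K : fieldType) (M O : set K) : Prop :=
  [/\ subring_closed (mem O), O `<=` M
    & forall x : K, M x -> O x \/ O x^-1].

(* The primes of F are its valuation rings other than F. For a global function
   field these are discrete and contain the constants. *)
Definition is_prime (F : fieldType) (O : set F) : Prop :=
  valuation_ring setT O /\ O <> setT.

Definition lies_over (F L : fieldType) (iota : {rmorphism F -> L})
    (M : set L) (O : set F) (W : set L) : Prop :=
  valuation_ring M W /\ iota @^-1` W = O.

(* x and y have the same value for the valuation with ring W, whose value group
   is the group of nonzero elements modulo the units of W. *)
Definition same_value (L : fieldType) (W : set L) (x y : L) : Prop :=
  W (x / y) /\ W (y / x).

(* M / F, possibly infinite, is ramified at O when e(W | O), the index of the
   value group of O in that of W, is not 1 for some W over O. Over a global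
   function field the residue fields are algebraic over F_p, hence perfect, so
   inseparable residue extensions do not occur. *)
Definition ramified_at (F L : fieldType) (iota : {rmorphism F -> L})
    (M : set L) (O : set F) : Prop :=
  exists2 W : set L, lies_over iota M O W &
    exists x : L, [/\ M x, x != 0 &
      forall y : F, y != 0 -> ~ same_value W x (iota y)].

(* Main.v *)
Require Import Defs.
From HB Require Import structures.
From mathcomp Require Import all_boot all_order all_fingroup all_algebra all_field.
From mathcomp Require Import boolp classical_sets functions cardinality.
From mathcomp Require Import ring lra zify.

Set Implicit Arguments.
Unset Strict Implicit.
Unset Printing Implicit Defensive.

Import Order.TTheory GRing.Theory Num.Theory.
Local Open Scope classical_set_scope.
Local Open Scope ring_scope.

(** Write f = P / Q in lowest terms, of degree d, and let M be the field
    generated over F by the abelian points of the backward orbit of alpha.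
    Fix a prime O of F, a valuation w of L above O, and a subfield T of L that
    is maximal among those containing F and having the same values as F
    under w ([max_unramified]).  The claim is that T contains all the abelian
    orbit points as soon as the degree of O exceeds a constant C that depends
    only on f and alpha.  Then M is contained in T, so that M / F is unramified
    at O, and only finitely many primes have degree at most C.

    Suppose that y is an abelian orbit point outside T whose image b = f(y)
    lies in T. Every subextension of an abelian extension is normal, so that
    F(sigma y) = F(y) and F(sigma b) = F(b) for all automorphisms sigma; hence
    all the conjugates of y are outside T and their images are in T
    ([abelian_conj], [adjoin_mem]). This is where commutativity enters: what
    happens at one conjugate happens at all of them. A root y of P - bQ that
    is simple modulo w would generate an unramified extension of T
    ([etale_mem]), hence y is a multiple root modulo w. As y has degree at
    most d over T, the derivative at y even has value at least w(pi) / d,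
    where pi is a uniformizer of O ([value_gap]). Up to a w-integral factor
    this derivative is the Wronskian P'Q - PQ' at y, so the Wronskian has
    value at least w(pi) / d, relative to the height of the point, at every
    conjugate of y ([wronskian_gain]).

    The product formula for the norm of the Wronskian at y now bounds the
    degree of O.  Away from O the Wronskian is bounded below by the local
    heights of y ([wronskian_lower]), and the heights of the points of the
    backward orbit are bounded independently of the point, because f
    multiplies heights by d up to a bounded error ([height_step],
    [orbit_height_bound]).  Normalizing by the number of conjugates gives
    deg O <= C ([ramified_degree_bound]).

    The Wronskian is nonzero because p does not divide d ([wronskian_neq0]).
    Finitely many points y remain, those where Q or the Wronskian vanishes;
    each is separable over F, so its own equation shows that it lies in T for
    almost all O ([separable_unramified]).

    The primes of F are reached from the places of F_p(t), where the product
    formula is unique factorization ([rplace_product]).  A normal extension E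
    of F_p(t) containing F is chosen ([normal_envelope]), one valuation of E
    above each place of F_p(t), and all its conjugates under the automorphisms
    of E ([global_places]).  Valuations are extended from a field to a larger
    one by Chevalley's theorem ([chevalley]), and they take rational values, so
    that an extension of a valuation restricts to it without rescaling. *)

(** * Subrings and valuation rings as sets *)

Section RingSets.
Variable K : fieldType.
Implicit Types (A M W : set K).

Lemma subring_closedE A : subring_closed (mem A) <->
  [/\ A 1, forall x y, A x -> A y -> A (x - y) & forall x y, A x -> A y -> A (x * y)].
Proof.
split=> -[h1 h2 h3]; split.
- by move: h1; rewrite inE.
- by move=> x y Ax Ay; move: (h2 x y); rewrite !inE; apply.
- by move=> x y Ax Ay; move: (h3 x y); rewrite !inE; apply.
- by rewrite inE.
- by move=> x y; rewrite !inE; apply: h2.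
- by move=> x y; rewrite !inE; apply: h3.
Qed.

Lemma divring_closedE A : divring_closed (mem A) <->
  [/\ A 1, forall x y, A x -> A y -> A (x - y) & forall x y, A x -> A y -> A (x / y)].
Proof.
split=> -[h1 h2 h3]; split.
- by move: h1; rewrite inE.
- by move=> x y Ax Ay; move: (h2 x y); rewrite !inE; apply.
- by move=> x y Ax Ay; move: (h3 x y); rewrite !inE; apply.
- by rewrite inE.
- by move=> x y; rewrite !inE; apply: h2.
- by move=> x y; rewrite !inE; apply: h3.
Qed.

Section SubringTheory.
Variables (A : set K) (hA : subring_closed (mem A)).

Lemma sring1 : A 1. Proof. by case/subring_closedE: hA. Qed.
Lemma sringB x y : A x -> A y -> A (x - y).
Proof. by case/subring_closedE: hA => _ h _; apply: h. Qed.
Lemma sringM x y : A x -> A y -> A (x * y).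
Proof. by case/subring_closedE: hA => _ _ h; apply: h. Qed.
Lemma sring0 : A 0.
Proof. by rewrite -(subrr 1); apply: sringB; apply: sring1. Qed.
Lemma sringN x : A x -> A (- x).
Proof. by move=> Ax; rewrite -sub0r; apply: sringB => //; apply: sring0. Qed.
Lemma sringD x y : A x -> A y -> A (x + y).
Proof. by move=> Ax Ay; rewrite -[y]opprK; apply/sringB/sringN. Qed.
Lemma sringX x n : A x -> A (x ^+ n).
Proof.
move=> Ax; elim: n => [|n IH]; first by rewrite expr0; apply: sring1.
by rewrite exprS; apply: sringM.
Qed.
Lemma sringMn x n : A x -> A (x *+ n).
Proof.
move=> Ax; elim: n => [|n IH]; first by rewrite mulr0n; apply: sring0.
by rewrite mulrSr; apply: sringD.
Qed.
Lemma sring_sum (I : Type) (r : seq I) (P : pred I) (f : I -> K) :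
  (forall i, P i -> A (f i)) -> A (\sum_(i <- r | P i) f i).
Proof.
move=> h; apply: big_ind => //; first exact: sring0.
by move=> x y; apply: sringD.
Qed.
Lemma sring_horner (p : {poly K}) x : (forall i, A p`_i) -> A x -> A p.[x].
Proof.
move=> hp Ax; rewrite horner_coef; apply: sring_sum => i _.
by apply: sringM => //; apply: sringX.
Qed.
End SubringTheory.

Lemma divring_subring A : divring_closed (mem A) -> subring_closed (mem A).
Proof.
move=> /divring_closedE[h1 hB hV]; apply/subring_closedE; split=> // x y Ax Ay.
have Vy : A y^-1 by rewrite -[y^-1]mul1r; apply: hV.
by rewrite -[y]invrK; apply: hV.
Qed.

(** Otherwise one of the nonzero terms would strictly dominate all the others
    and could not be cancelled. *)
Lemma vring_tie M W (n : nat) (x : 'I_n -> K) :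
  divring_closed (mem M) -> valuation_ring M W ->
  (forall i, M (x i)) -> \sum_i x i = 0 -> (exists i, x i != 0) ->
  exists i j, [/\ i != j, x i != 0, x j != 0 & same_value W (x i) (x j)].
Proof.
move=> /divring_closedE[_ _ hMV] [Wring WM Wtot] hx sum0 [i0 xi0].
pose le (i j : 'I_n) := `[< W (x i / x j) >].
(* x m is a nonzero term of least value *)
have [m xm hm] : exists2 m, x m != 0 & forall i, W (x i / x m).
  have: exists2 m, x m != 0 & forall i, i \in enum 'I_n -> W (x i / x m).
    elim: (enum 'I_n) => [|a s [m xm IH]]; first by exists i0.
    have [Wam|nWam] := pselect (W (x a / x m)).
      by exists m => // i; rewrite inE => /predU1P[->//|/IH].
    have xa : x a != 0.
      by apply/eqP => xa0; apply: nWam; rewrite xa0 mul0r; apply: sring0.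
    have Wma : W (x m / x a).
      by have [//|] := Wtot (x a / x m) (hMV _ _ (hx a) (hx m)); rewrite invf_div.
    exists a => // i; rewrite inE => /predU1P[->|/IH h].
      by rewrite divff //; apply: sring1.
    have -> : x i / x a = (x i / x m) * (x m / x a) by rewrite mulrA divfK.
    exact: sringM.
  by case=> m xm h; exists m => // i; apply: h; rewrite mem_enum.
apply: contrapT => hno.
have nonu i : i != m -> x i != 0 -> ~ W (x m / x i).
  move=> im xi Wmi; apply: hno; exists i, m; split=> //.
have nuD y z : W y -> W z -> y != 0 -> z != 0 -> ~ W y^-1 -> ~ W z^-1 ->
     y + z != 0 -> ~ W (y + z)^-1.
  move=> Wy Wz y0 z0 ny nz yz0 Wyz.
  have Myz : M (y / z) by apply: hMV; apply: WM.
  have [h|h] := Wtot _ Myz.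
    apply: nz; have -> : z^-1 = (y / z + 1) * (y + z)^-1.
      by field; rewrite yz0.
    by apply: sringM => //; apply: sringD => //; apply: sring1.
  apply: ny; have -> : y^-1 = (1 + z / y) * (y + z)^-1.
    by field; rewrite yz0.
  apply: sringM => //; apply: sringD => //; first exact: sring1.
  by rewrite -invf_div.
have W1 := sring1 Wring.
pose P y := W y /\ (y != 0 -> ~ W y^-1).
have PS (s : seq 'I_n) : P (\sum_(i <- s | i != m) x i / x m).
  apply: big_ind.
  - by split; [apply: sring0 | rewrite eqxx].
  - move=> y z [Wy hy] [Wz hz]; split; first exact: sringD.
    have [->|y0] := eqVneq y 0; first by rewrite add0r.
    have [->|z0] := eqVneq z 0; first by rewrite addr0.
    by move=> yz0; apply: nuD => //; [apply: hy | apply: hz].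
  - move=> i im; split=> // h; rewrite invf_div; apply: nonu => //.
    by apply: contraNneq h => ->; rewrite mul0r.
have := PS (index_enum 'I_n); rewrite -mulr_suml.
have -> : \sum_(i | i != m) x i = - x m.
  by move: sum0; rewrite (bigD1 m) //= => /eqP; rewrite addrC addr_eq0 => /eqP.
rewrite mulNr divff // => -[_]; rewrite oppr_eq0 oner_eq0 invrN invr1.
by move=> /(_ isT); apply; apply: sringN.
Qed.

(** Chevalley's extension theorem.  A subring W that is maximal among those
    containing A and not 1/p is a valuation ring: if z and 1/z were both
    outside W, then W[z] and W[1/z] would both contain 1/p, and two such
    relations of minimal degrees can be combined into a shorter one. *)
Lemma chevalley A (p : K) : subring_closed (mem A) -> A p -> ~ A p^-1 ->
  exists W, [/\ valuation_ring setT W, A `<=` W & ~ W p^-1].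
Proof.
move=> Aring Ap nAp.
have p0 : p != 0 by apply: contra_notN nAp => /eqP->; rewrite invr0; apply: sring0.
pose good B := [/\ subring_closed (mem B), A `<=` B & ~ B p^-1].
pose P B := B = set0 \/ good B.
have chainP : forall C : set (set K), C `<=` P -> total_on C subset ->
    P (\bigcup_(X in C) X).
  move=> C CP Ctot.
  have [[X CX gX]|hno] := pselect (exists2 X, C X & good X); last first.
    left; rewrite -subset0 => x [X CX Xx]; have [X0|gX] := CP X CX.
      by rewrite X0 in Xx.
    by case: hno; exists X.
  have common x y : (\bigcup_(X in C) X) x -> (\bigcup_(X in C) X) y ->
      exists X, [/\ C X, good X, X x & X y].
    move=> [X1 C1 x1] [X2 C2 x2].
    have g X' z : C X' -> X' z -> good X'.
      by move=> C' z'; case: (CP _ C') => // X0; rewrite X0 in z'.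
    have [s|s] := Ctot _ _ C1 C2.
      by exists X2; split=> //; [apply: g C2 x2 | apply: s].
    by exists X1; split=> //; [apply: g C1 x1 | apply: s].
  right; split.
  - apply/subring_closedE; split.
    + by exists X => //; apply: sring1; case: gX.
    + move=> x y hx hy; have [Y [CY [Yr _ _] Yx Yy]] := common x y hx hy.
      by exists Y => //; apply: sringB.
    + move=> x y hx hy; have [Y [CY [Yr _ _] Yx Yy]] := common x y hx hy.
      by exists Y => //; apply: sringM.
  - by move=> x Ax; exists X => //; case: gX => _ + _; apply.
  - move=> hp; have [Y [CY [_ _ nY] Yp _]] := common _ _ hp hp.
    exact: nY.
have [W [PW maxW]] := Zorn_bigcup chainP.
have gW : good W.
  case: PW => // W0; exfalso; apply: (maxW A); last by right; split.
  rewrite W0 properEneq; split; last exact: sub0set.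
  by apply/eqP => A0; move: Ap; rewrite -A0.
have {}maxW B : good B -> W `<=` B -> B = W.
  move=> gB WB; apply: contrapT => BW; apply: (maxW B); last by right.
  by rewrite properEneq; split=> //; apply/eqP => h; apply: BW.
case: (gW) => Wring AW nWp.
have Wp := AW _ Ap.
(* by maximality, 1/p is a polynomial in any element outside W *)
pose adj (z : K) := [set y | exists2 q : {poly K}, forall i, W q`_i & y = q.[z]].
have adj_ring z : subring_closed (mem (adj z)).
  apply/subring_closedE; split.
  - exists 1; last by rewrite hornerC.
    by move=> i; rewrite coef1; case: (i == _); [apply: sring1 | apply: sring0].
  - move=> _ _ [q hq ->] [r hr ->]; exists (q - r); last by rewrite hornerD hornerN.
    by move=> i; rewrite coefB; apply: sringB.
  - move=> _ _ [q hq ->] [r hr ->]; exists (q * r); last by rewrite hornerM.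
    by move=> i; rewrite coefM; apply: sring_sum => // j _; apply: sringM.
have adjW z : W `<=` adj z.
  move=> y Wy; exists y%:P; last by rewrite hornerC.
  by move=> i; rewrite coefC; case: (i == _) => //; apply: sring0.
have adjz z : adj z z.
  exists 'X; last by rewrite hornerX.
  by move=> i; rewrite coefX; case: (i == _); [apply: sring1 | apply: sring0].
have adjP z : ~ W z -> exists2 q : {poly K}, forall i, W q`_i & 1 = p * q.[z].
  move=> nz; apply: contrapT => hno.
  have adjWE : adj z = W.
    apply: maxW; last exact: adjW.
    split=> //; first by move=> x /AW /adjW.
    by move=> [q hq e]; apply: hno; exists q => //; rewrite -e divff.
  by apply: nz; rewrite -adjWE; apply: adjz.
(* p lies in the Jacobson radical of W, for inverting 1 - pb cannot make p
   invertible *)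
have jac b : W b -> W (1 - p * b)^-1.
  move=> Wb; set u := 1 - p * b.
  have Wu : W u by apply: sringB; [|apply: sring1|apply: sringM].
  pose B := [set y | exists n, W (y * u ^+ n)].
  have [u0|u0] := eqVneq u 0.
    by exfalso; apply: nWp; move/eqP: u0; rewrite subr_eq0 => /eqP e;
       rewrite -[p^-1]mulr1 e mulKf.
  suff -> : W = B by exists 1; rewrite expr1 mulVf //; apply: sring1.
  symmetry; apply: maxW; last by move=> y Wy; exists 0%N; rewrite expr0 mulr1.
  split.
  - apply/subring_closedE; split.
    + by exists 0%N; rewrite mulr1; apply: sring1.
    + move=> x y [n hn] [m hm]; exists (n + m)%N.
      have -> : (x - y) * u ^+ (n + m) = (x * u ^+ n) * u ^+ m - (y * u ^+ m) * u ^+ n.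
        by rewrite exprD; ring.
      by apply: sringB => //; apply: sringM => //; apply: sringX.
    + move=> x y [n hn] [m hm]; exists (n + m)%N.
      have -> : (x * y) * u ^+ (n + m) = (x * u ^+ n) * (y * u ^+ m).
        by rewrite exprD; ring.
      exact: sringM.
  - by move=> x Ax; exists 0%N; rewrite mulr1; apply: AW.
  - move=> [n hn].
    have [c Wc e] : exists2 c, W c & u ^+ n = 1 - p * c.
      elim: n {hn} => [|n [c Wc e]]; first by exists 0; [apply: sring0 | rewrite mulr0 subr0].
      exists (c + b - p * c * b); last by rewrite exprS e /u; ring.
      by apply: sringB => //; [apply: sringD|apply: sringM => //; apply: sringM].
    apply: nWp; have -> : p^-1 = p^-1 * u ^+ n + c by rewrite e mulrBr mulr1 mulKf // subrK.
    exact: sringD.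
exists W; split=> //; split=> // z _.
apply: contrapT => /not_orP[nz nz1].
pose S (n : nat) := `[< exists (z : K) (q r : {poly K}), [/\ ~ W z /\ ~ W z^-1, forall i, W q`_i, forall i, W r`_i,
    (size q + size r = n)%N & 1 = p * q.[z] /\ 1 = p * r.[z^-1]] >].
have exS : exists n, S n.
  have [q hq eq_] := adjP _ nz; have [r hr er] := adjP _ nz1.
  by exists (size q + size r)%N; apply/asboolP; exists z, q, r.
have [n /asboolP[z0 [q0 [r0 h0]]] minn] := ex_minnP exS.
have [{exS}q [r [z1 [[[{}nz {}nz1] hq hr sqr [e1 e2]] srq]]]] : exists (q r : {poly K}) (z : K),
  [/\ ~ W z /\ ~ W z^-1, forall i, W q`_i, forall i, W r`_i,
    (size q + size r = n)%N & 1 = p * q.[z] /\ 1 = p * r.[z^-1]] /\ (size r <= size q)%N.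
  case: h0 => -[{}nz {}nz1] hq hr sqr [e1 e2].
  have [h|h] := leqP (size r0) (size q0); first by exists q0, r0, z0.
  exists r0, q0, z0^-1; rewrite invrK; split; last exact: ltnW.
  by split=> //; rewrite addnC.
move: z1 nz nz1 e1 e2 {h0 z z0} => z nz nz1 e1 e2.
(* r' is r without its constant term, rescaled so that 1 = p r'(1/z) *)
have z0 : z != 0 by apply: contra_notN nz => /eqP->; apply: sring0.
have sq0 : (0 < size q)%N.
  rewrite lt0n size_poly_eq0; apply: contra_eqN e1 => /eqP->.
  by rewrite horner0 mulr0 oner_eq0.
pose r' := \poly_(i < size r) ((if i == 0%N then 0 else (1 - p * r`_0)^-1) * r`_i).
have Wr' i : W r'`_i.
  rewrite coef_poly; case: ifP => _; last exact: sring0.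
  apply: sringM => //; case: eqP => _; [exact: sring0|exact: jac].
have r'0 : r'`_0 = 0 by rewrite coef_poly eqxx mul0r if_same.
have u0 : 1 - p * r`_0 != 0.
  apply/eqP => e; apply: nWp; move/eqP: e; rewrite subr_eq0 => /eqP e.
  by rewrite -[p^-1]mulr1 e mulKf.
have e3 : 1 = p * r'.[z^-1].
  have rz : r.[z^-1] = r`_0 + (1 - p * r`_0) * r'.[z^-1].
    rewrite horner_coef horner_poly.
    case E: (size r) => [|m].
      by rewrite !big_ord0 mulr0 addr0 nth_default ?E.
    rewrite !big_ord_recl /= !expr0 !mulr1 mul0r add0r; congr (_ + _).
    rewrite mulr_sumr; apply: eq_bigr => i _ /=.
    by rewrite /bump /= !mulrA mulfV // mul1r.
  move: e2; rewrite rz => e2.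
  apply: (mulfI u0); rewrite mulr1 mulrCA [in RHS]mulrC.
  by rewrite {1}e2; ring.
have sr' : (size r' <= size q)%N by apply: leq_trans (size_poly _ _) srq.
(* multiplying the top term c z^n of q(z) by 1 = p r'(1/z) lowers its degree *)
pose c := q`_(size q).-1.
pose q1 := \poly_(i < (size q).-1) q`_i + \poly_(i < (size q).-1) (p * c * r'`_((size q).-1 - i)).
have Wc : W c by apply: hq.
have Wq1 i : W q1`_i.
  rewrite coefD coef_poly coef_poly; case: ifP => _; last by rewrite addr0; apply: sring0.
  by apply: (sringD Wring) => //; apply: (sringM Wring) => //; apply: (sringM Wring).
have e4 : q.[z] = q1.[z].
  have wide (g : {poly K}) x : (size g <= size q)%N ->
      g.[x] = \sum_(i < (size q).-1.+1) g`_i * x ^+ i.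
    by move=> sg; apply: horner_coef_wide; rewrite prednK.
  rewrite hornerD !horner_poly (wide q) // big_ord_recr /=.
  congr (_ + _); rewrite -/c.
  rewrite -[c * _]mulr1 {1}e3.
  rewrite (wide r') // big_ord_recl /= r'0 mul0r add0r.
  rewrite (reindex_inj rev_ord_inj) /= !mulr_sumr; apply: eq_bigr => i _.
  rewrite /bump /= add1n -subSn // subSS.
  have -> : z ^+ (size q).-1 = z ^+ i * z ^+ ((size q).-1 - i) by rewrite -exprD subnKC // ltnW.
  rewrite exprVn.
  have zi : z ^+ ((size q).-1 - i) != 0 by rewrite expf_neq0.
  rewrite [z ^+ i * _]mulrC; field.
  by rewrite zi.
have sq1 : (size q1 <= (size q).-1)%N.
  by apply: leq_trans (size_polyD _ _) _; rewrite geq_max !size_poly.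
have lt1 : (size q1 < size q)%N by apply: leq_ltn_trans sq1 _; rewrite prednK.
have : (size q1 + size r < n)%N by rewrite -sqr ltn_add2r.
rewrite ltnNge => /negP; apply; apply: minn; apply/asboolP; exists z, q1, r.
by rewrite -e4.
Qed.
End RingSets.

(** * Valuations with rational values *)

(** The value at 0 is left arbitrary: 0 is treated apart, by vge below. *)
Record valuation (K : fieldType) := Valuation {
  vfun :> K -> rat;
  valuationM : forall x y, x != 0 -> y != 0 -> vfun (x * y) = vfun x + vfun y;
  valuationD : forall x y, x != 0 -> y != 0 -> x + y != 0 ->
    Num.min (vfun x) (vfun y) <= vfun (x + y) }.

Section ValuationTheory.
Variables (K : fieldType) (v : valuation K).
Implicit Types (x y : K) (a b : rat).

Lemma valuation1 : v 1 = 0.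
Proof.
have := valuationM v (oner_neq0 K) (oner_neq0 K); rewrite mulr1 => h.
by lra.
Qed.

Lemma valuationX x n : x != 0 -> v (x ^+ n) = n%:R * v x.
Proof.
move=> x0; elim: n => [|n IH]; first by rewrite expr0 valuation1 mul0r.
by rewrite exprS valuationM ?expf_neq0 // IH -addn1 natrD; ring.
Qed.

Lemma valuationN x : v (- x) = v x.
Proof.
have [->|x0] := eqVneq x 0; first by rewrite oppr0.
have N0 : (-1 : K) != 0 by rewrite oppr_eq0 oner_eq0.
have h : v (-1) = 0 by have := valuationX 2 N0; rewrite sqrrN expr1n valuation1; lra.
by rewrite -mulN1r valuationM // h add0r.
Qed.

Lemma valuationV x : x != 0 -> v x^-1 = - v x.
Proof.
move=> x0; have Vx : x^-1 != 0 by rewrite invr_eq0.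
by have := valuationM v x0 Vx; rewrite divff // valuation1; lra.
Qed.

Lemma valuation_div x y : x != 0 -> y != 0 -> v (x / y) = v x - v y.
Proof. by move=> x0 y0; rewrite valuationM ?invr_eq0 // valuationV. Qed.

Lemma valuation_prod (I : Type) (r : seq I) (P : pred I) (f : I -> K) :
  (forall i, P i -> f i != 0) ->
  v (\prod_(i <- r | P i) f i) = \sum_(i <- r | P i) v (f i).
Proof.
move=> h; suff [] : \prod_(i <- r | P i) f i != 0 /\
  v (\prod_(i <- r | P i) f i) = \sum_(i <- r | P i) v (f i) by [].
apply: (big_rec2 (fun x s => x != 0 /\ v x = s)); first by rewrite oner_neq0 valuation1.
by move=> i s x /h fi [x0 <-]; rewrite mulf_neq0 // valuationM.
Qed.

(** The relation v x >= a, where 0 has infinite value. *)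
Definition vge a x := (x == 0) || (a <= v x).

Lemma vge0 a : vge a 0. Proof. by rewrite /vge eqxx. Qed.
Lemma vge_val x : vge (v x) x. Proof. by rewrite /vge lexx orbT. Qed.
Lemma vgeE a x : x != 0 -> vge a x = (a <= v x).
Proof. by rewrite /vge => /negbTE->. Qed.
Lemma vgeW a b x : a <= b -> vge b x -> vge a x.
Proof. by rewrite /vge => ab /orP[->//|/(le_trans ab)->]; rewrite orbT. Qed.
Lemma vgeN a x : vge a x -> vge a (- x).
Proof. by rewrite /vge oppr_eq0 valuationN. Qed.
Lemma vgeD a x y : vge a x -> vge a y -> vge a (x + y).
Proof.
rewrite /vge; have [->|x0] := eqVneq x 0; first by rewrite add0r.
have [->|y0] /= := eqVneq y 0; first by rewrite addr0 (negbTE x0) /=.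
have [//|s0 /= hx hy] := eqVneq (x + y) 0.
by apply: le_trans (valuationD v x0 y0 s0); rewrite le_min hx hy.
Qed.
Lemma vgeB a x y : vge a x -> vge a y -> vge a (x - y).
Proof. by move=> hx hy; apply/vgeD/vgeN. Qed.
Lemma vgeM a b x y : vge a x -> vge b y -> vge (a + b) (x * y).
Proof.
rewrite /vge mulf_eq0; have [//|x0] := eqVneq x 0.
by have [//|y0 /= hx hy] := eqVneq y 0; rewrite valuationM //; lra.
Qed.
Lemma vgeM0 a x y : vge a x -> vge 0 y -> vge a (x * y).
Proof. by move=> hx hy; rewrite -[a]addr0; apply: vgeM. Qed.
Lemma vgeMl0 a x y : vge 0 x -> vge a y -> vge a (x * y).
Proof. by move=> hx hy; rewrite -[a]add0r; apply: vgeM. Qed.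
Lemma vgeX x n : vge 0 x -> vge 0 (x ^+ n).
Proof.
move=> hx; elim: n => [|n IH]; first by rewrite expr0 vgeE ?oner_neq0 // valuation1.
by rewrite exprS; apply: vgeM0.
Qed.
Lemma vge_sum (I : Type) (r : seq I) (P : pred I) (f : I -> K) a :
  (forall i, P i -> vge a (f i)) -> vge a (\sum_(i <- r | P i) f i).
Proof. by move=> h; elim/big_ind: _ => // [|x y]; [apply: vge0 | apply: vgeD]. Qed.
Lemma vge_horner (p : {poly K}) x a :
  (forall i, vge a p`_i) -> vge 0 x -> vge a p.[x].
Proof.
move=> hp hx; rewrite horner_coef; apply: vge_sum => i _.
by apply: vgeM0 => //; apply: vgeX.
Qed.
Lemma vge_nat n : vge 0 n%:R.
Proof.
elim: n => [|n IH]; first exact: vge0.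
by rewrite -addn1 natrD; apply: vgeD => //; rewrite vgeE ?oner_neq0 // valuation1.
Qed.

Lemma valuationD_lt x y : x != 0 -> (y == 0) || (v x < v y) -> x + y != 0 /\ v (x + y) = v x.
Proof.
move=> x0; have [->|y0] /= := eqVneq y 0; first by rewrite addr0.
move=> xy; have s0 : x + y != 0.
  by apply/eqP => e; move: xy; rewrite -(valuationN x) -[y](addKr x) e addr0 ltxx.
have Ny : - y != 0 by rewrite oppr_eq0.
have h1 := valuationD v x0 y0 s0; have := valuationD v s0 Ny; rewrite addrK valuationN => /(_ x0).
move: h1; rewrite !ge_min => /orP h1 /orP h2; split=> //; case: h1; case: h2; lra.
Qed.

Definition val_ring : set K := [set x | vge 0 x].

Lemma val_ringP : valuation_ring setT val_ring.
Proof.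
split=> // [|x _].
  apply/subring_closedE; split; rewrite /val_ring /=.
  - by rewrite vgeE ?oner_neq0 // valuation1.
  - by move=> x y hx hy; apply: (vgeB hx hy).
  - by move=> x y hx hy; apply: (vgeM0 hx hy).
have [->|x0] := eqVneq x 0; first by left; apply: vge0.
rewrite /val_ring /= !vgeE ?invr_eq0 // valuationV //.
by case: (leP 0 (v x)) => h; [left|right; lra].
Qed.

Lemma valuation_tie (n : nat) (x : 'I_n -> K) :
  \sum_i x i = 0 -> (exists i, x i != 0) ->
  exists i j, [/\ i != j, x i != 0, x j != 0 & v (x i) = v (x j)].
Proof.
move=> h1 h2.
have MT : divring_closed (mem (setT : set K)) by apply/divring_closedE.
have [i [j [ij xi xj]]] := vring_tie MT val_ringP (fun i => I) h1 h2.
rewrite /same_value /val_ring /= !vgeE ?mulf_neq0 ?invr_eq0 //.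
rewrite !valuation_div // => -[h3 h4]; exists i, j; split=> //; lra.
Qed.

End ValuationTheory.

Section Pullback.
Variables (K L : fieldType) (f : {rmorphism K -> L}) (w : valuation L).
Fact pull_valM x y : x != 0 -> y != 0 -> w (f (x * y)) = w (f x) + w (f y).
Proof. by move=> x0 y0; rewrite rmorphM valuationM ?fmorph_eq0. Qed.
Fact pull_valD x y : x != 0 -> y != 0 -> x + y != 0 ->
  Num.min (w (f x)) (w (f y)) <= w (f (x + y)).
Proof. by move=> x0 y0 s0; rewrite rmorphD valuationD -?rmorphD ?fmorph_eq0. Qed.
Definition pull := @Valuation K (fun x => w (f x)) pull_valM pull_valD.
End Pullback.

Fact trivial_valuationM (K : fieldType) (x y : K) : x != 0 -> y != 0 -> (0 : rat) = 0 + 0.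
Proof. by rewrite addr0. Qed.
Fact trivial_valuationD (K : fieldType) (x y : K) : x != 0 -> y != 0 -> x + y != 0 ->
  Num.min 0 0 <= (0 : rat).
Proof. by rewrite minxx. Qed.
Definition trivial_valuation (K : fieldType) : valuation K :=
  Valuation (@trivial_valuationM K) (@trivial_valuationD K).

Section SameValue.
Variables (L : fieldType) (W : set L) (hW : subring_closed (mem W)).
Lemma same_value_sym x y : same_value W x y -> same_value W y x.
Proof. by case. Qed.
Lemma same_value_trans y x z : y != 0 ->
  same_value W x y -> same_value W y z -> same_value W x z.
Proof.
move=> y0 [h1 h2] [h3 h4]; split.
  have -> : x / z = (x / y) * (y / z) by rewrite mulrA divfK.
  exact: sringM.
have -> : z / x = (z / y) * (y / x) by rewrite mulrA divfK.
exact: sringM.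
Qed.
Lemma same_valueM x y x' y' :
  same_value W x y -> same_value W x' y' -> same_value W (x * x') (y * y').
Proof.
move=> [h1 h2] [h3 h4]; by split; rewrite invfM mulrACA; apply: (sringM hW).
Qed.
Lemma same_valueX n x y : same_value W x y -> same_value W (x ^+ n) (y ^+ n).
Proof.
by move=> [h1 h2]; split; rewrite -exprVn -exprMn; apply: (sringX hW).
Qed.
End SameValue.

Definition algebraic_over (F L : fieldType) (iota : {rmorphism F -> L}) :=
  forall x : L, exists2 P : {poly F}, P != 0 & root (map_poly iota P) x.

(** Two terms of an algebraic equation of x have the same value, and their
    quotient is a power of x times an element of F. *)
Lemma algebraic_tie (F L : fieldType) (iota : {rmorphism F -> L}) (M W : set L)
    (P : {poly F}) (x : L) :
  divring_closed (mem M) -> valuation_ring M W -> range iota `<=` M -> M x ->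
  P != 0 -> root (map_poly iota P) x -> x != 0 ->
  exists s c, [/\ (0 < s < size P)%N, c != 0 & same_value W (x ^+ s) (iota c)].
Proof.
move=> hM hW FM Mx P0 /eqP Px x0.
have [Wr _ _] := hW.
have hMr := divring_subring hM.
pose t (i : 'I_(size P)) := iota P`_i * x ^+ i.
have h1 : \sum_i t i = 0.
  by rewrite -[RHS]Px horner_coef size_map_poly; apply: eq_bigr => i _; rewrite coef_map.
have xX n : x ^+ n != 0 by rewrite expf_neq0.
have h2 : exists i, t i != 0.
  have sP : (0 < size P)%N by rewrite size_poly_gt0.
  have lt : ((size P).-1 < size P)%N by rewrite prednK.
  by exists (Ordinal lt); rewrite mulf_neq0 //= fmorph_eq0 -lead_coefE lead_coef_eq0.
have h3 i : M (t i) by apply: sringM => //; [apply: FM; exists P`_i | apply: sringX].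
have [i [j []]] := vring_tie hM hW h3 h1 h2.
wlog lt : i j / (i < j)%N.
  move=> H ij ti tj s; case: (ltngtP i j) => [lt|lt|/val_inj e].
  - exact: (H i j).
  - by apply: (H j i) => //; [rewrite eq_sym | apply: same_value_sym].
  - by rewrite e eqxx in ij.
move=> _; rewrite /t !mulf_eq0 !fmorph_eq0 !negb_or => /andP[ci xi] /andP[cj xj] s.
exists (j - i)%N, (P`_i / P`_j); split.
- by rewrite subn_gt0 lt /= (leq_ltn_trans (leq_subr _ _)).
- by rewrite mulf_neq0 ?invr_eq0.
have [s1 s2] := s.
have e : x ^+ j = x ^+ i * x ^+ (j - i) by rewrite -exprD subnKC // ltnW.
have cj' : iota P`_j != 0 by rewrite fmorph_eq0.
have ci' : iota P`_i != 0 by rewrite fmorph_eq0.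
split; rewrite fmorph_div.
  suff <- : iota P`_j * x ^+ j / (iota P`_i * x ^+ i) = x ^+ (j - i) / (iota P`_i / iota P`_j) by [].
  by rewrite e; field; rewrite ci' cj' xi.
suff <- : iota P`_i * x ^+ i / (iota P`_j * x ^+ j) = iota P`_i / iota P`_j / x ^+ (j - i) by [].
by rewrite e; field; rewrite cj' xi xX.
Qed.

(** When x^s has the value of an element c of F, the value of x has to be
    v(c) / s; rational values make room for it. *)
Lemma extend_valuation_ring (F L : fieldType) (iota : {rmorphism F -> L})
    (v : valuation F) (W : set L) :
  algebraic_over iota -> valuation_ring setT W ->
  (forall c, c != 0 -> W (iota c) <-> 0 <= v c) ->
  exists w : valuation L, (forall c, c != 0 -> w (iota c) = v c) /\
    (forall x, x != 0 -> W x <-> 0 <= w x).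
Proof.
move=> alg hW Wv.
have MT : divring_closed (mem (setT : set L)) by apply/divring_closedE.
have [Wr _ Wtot] := hW.
have W1 := sring1 Wr.
pose R x q := exists s c, [/\ (0 < s)%N, c != 0, same_value W (x ^+ s) (iota c) & q = v c / s%:R].
have Wv2 c c' : c != 0 -> c' != 0 -> same_value W (iota c) (iota c') -> v c = v c'.
  move=> c0 c0'; rewrite /same_value -!fmorph_div.
  rewrite !Wv ?mulf_neq0 ?invr_eq0 // !valuation_div // => -[]; lra.
have s0 n : (0 < n)%N -> (n%:R : rat) != 0 by rewrite pnatr_eq0 lt0n.
have Runiq x q q' : x != 0 -> R x q -> R x q' -> q = q'.
  move=> x0 [s [c [sp c0 h ->]]] [s' [c' [sp' c0' h' ->]]].
  have e : v (c ^+ s') = v (c' ^+ s).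
    apply: Wv2; rewrite ?expf_neq0 //.
    apply: (@same_value_trans _ _ Wr (x ^+ (s * s'))); first by rewrite expf_neq0.
      by rewrite exprM rmorphXn /=; exact: (same_value_sym (same_valueX Wr s' h)).
    by rewrite mulnC exprM rmorphXn /=; exact: (same_valueX Wr).
  move: e; rewrite !valuationX // => e.
  apply: (mulfI (s0 _ sp)); apply: (mulfI (s0 _ sp')).
  transitivity (s'%:R * v c); first by field; rewrite s0.
  by rewrite e; field; rewrite s0.
have Rtot x : x != 0 -> exists q, R x q.
  move=> x0; have [P P0 Px] := alg x.
  have [s [c [/andP[sp _] c0 h]]] := algebraic_tie MT hW (@subsetT _ _) I P0 Px x0.
  by exists (v c / s%:R), s, c.
have [w hw] : exists w : L -> rat, forall x, x != 0 -> R x (w x).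
  suff /boolp.choice[w hw] : forall x, exists q, x != 0 -> R x q by exists w.
  move=> x; have [->|x0] := eqVneq x 0; first by exists 0.
  by have [q hq] := Rtot _ x0; exists q.
have wF c : c != 0 -> w (iota c) = v c.
  move=> c0; have c0' : iota c != 0 by rewrite fmorph_eq0.
  apply: Runiq (hw _ c0') _ => //; exists 1%N, c; split=> //; last by rewrite divr1.
  by rewrite expr1; split; rewrite divff.
have wM x y : x != 0 -> y != 0 -> w (x * y) = w x + w y.
  move=> x0 y0; have xy0 : x * y != 0 by rewrite mulf_neq0.
  apply: Runiq xy0 (hw _ xy0) _.
  have [s [c [sp c0 h ->]]] := hw _ x0; have [t [d [tp d0 k ->]]] := hw _ y0.
  exists (s * t)%N, (c ^+ t * d ^+ s); split.
  - by rewrite muln_gt0 sp tp.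
  - by rewrite mulf_neq0 ?expf_neq0.
  - rewrite exprMn rmorphM !rmorphXn; apply: same_valueM => //.
      by rewrite exprM; apply: same_valueX.
    by rewrite mulnC exprM; apply: same_valueX.
  - by rewrite valuationM ?expf_neq0 // !valuationX // natrM; field; rewrite !s0.
have wW x : x != 0 -> W x <-> 0 <= w x.
  move=> x0; have [s [c [sp c0 [h1 h2] ->]]] := hw _ x0.
  have -> : (0 <= v c / s%:R) = (0 <= v c) by rewrite pmulr_lge0 // invr_gt0 ltr0n.
  have c0' : iota c != 0 by rewrite fmorph_eq0.
  rewrite -Wv //; split=> [Wx|Wc].
    by rewrite -(divfK (expf_neq0 s x0) (iota c)); apply: sringM => //; apply: sringX.
  have Wxs : W (x ^+ s) by rewrite -(divfK c0' (x ^+ s)); apply: sringM.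
  have [//|WVx] := Wtot x I.
  have -> : x = x ^+ s * x^-1 ^+ s.-1.
    rewrite -{1}(prednK sp) exprS exprVn mulfK // expf_neq0 //.
  by apply: sringM => //; apply: sringX.
have wV x : x != 0 -> w (x^-1) = - w x.
  move=> x0; have x0' : x^-1 != 0 by rewrite invr_eq0.
  have := wM _ _ x0 x0'; rewrite divff // -(rmorph1 iota) wF ?oner_neq0 // valuation1; lra.
have wD x y : x != 0 -> y != 0 -> x + y != 0 -> Num.min (w x) (w y) <= w (x + y).
  wlog xy : x y / w x <= w y => [H x0 y0 xy0|x0 y0 xy0].
    case/orP: (le_total (w x) (w y)) => h; first exact: (H x y).
    by rewrite addrC minC; apply: (H y x) => //; rewrite addrC.
  rewrite min_l //; have yx0 : y / x != 0 by rewrite mulf_neq0 ?invr_eq0.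
  have : W (y / x) by apply/(wW _ yx0); rewrite wM ?invr_eq0 // wV //; lra.
  move=> h; have h1 : W ((x + y) / x).
    by rewrite mulrDl divff //; apply: sringD.
  have : (x + y) / x != 0 by rewrite mulf_neq0 ?invr_eq0.
  move/wW => h2; move/h2: h1; rewrite wM ?invr_eq0 // wV //; lra.
by exists (Valuation wM wD).
Qed.

Definition nontrivial (K : fieldType) (v : valuation K) :=
  exists2 x, x != 0 & 0 < v x.

Lemma archi_rat (a b : rat) : 0 < a -> exists n : nat, b <= n%:R * a.
Proof.
move=> a0; exists (Num.truncn `|b / a|).+1.
have := truncnS_gt `|b / a|; set n := _.+1 => h.
have hb : b / a < n%:R by apply: le_lt_trans h; exact: ler_norm.
by move: hb; rewrite ltr_pdivrMr // => /ltW.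
Qed.

(** The valuation ring W given by [chevalley] meets F exactly in the valuation
    ring of v: if c in W had negative value, then 1/p would be a multiple of a
    power of c, because the values are archimedean. *)
Lemma extend_valuation (F L : fieldType) (iota : {rmorphism F -> L})
    (v : valuation F) (A : set L) :
  algebraic_over iota -> nontrivial v ->
  subring_closed (mem A) -> (forall c, c != 0 -> A (iota c) <-> 0 <= v c) ->
  exists w : valuation L, (forall c, c != 0 -> w (iota c) = v c) /\
    A `<=` val_ring w.
Proof.
move=> alg [p p0 vp] Ar Av.
have [||W [hW AW nW]] := @chevalley _ A (iota p) Ar.
- by apply/Av => //; lra.
- by rewrite -fmorphV Av ?invr_eq0 // valuationV //; lra.
have [Wr _ _] := hW.
have Wv c : c != 0 -> W (iota c) <-> 0 <= v c.
  move=> c0; split; last by move/Av => h; apply/AW/h.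
  move=> Wc; rewrite leNgt; apply/negP => vc; apply: nW.
  have vc' : 0 < - v c by lra.
  have [n hn] := archi_rat (v p) vc'.
  have cn : c ^+ n != 0 by rewrite expf_neq0.
  have -> : (iota p)^-1 = iota c ^+ n * iota ((c ^+ n * p)^-1).
    rewrite -rmorphXn -rmorphM -fmorphV; congr (iota _); field.
    by rewrite p0 cn.
  apply: sringM => //; first exact: sringX.
  apply: AW; apply/Av; first by rewrite invr_eq0 mulf_neq0.
  by rewrite valuationV ?mulf_neq0 // valuationM // valuationX //; lra.
have [w [wF wW]] := extend_valuation_ring alg hW Wv.
exists w; split=> // x Ax; rewrite /val_ring /=.
have [->|x0] := eqVneq x 0; first exact: vge0.
by rewrite vgeE //; apply/wW => //; apply: AW.
Qed.

Lemma extend_valuation_field (F L : fieldType) (iota : {rmorphism F -> L})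
    (v : valuation F) : algebraic_over iota -> nontrivial v ->
  exists w : valuation L, forall c, c != 0 -> w (iota c) = v c.
Proof.
move=> alg nt; pose A := [set iota c | c in val_ring v].
have [vr _ _] := val_ringP v.
have Ar : subring_closed (mem A).
  apply/subring_closedE; split.
  - by exists 1; [apply: sring1 | rewrite rmorph1].
  - move=> _ _ [x hx <-] [y hy <-]; exists (x - y); last by rewrite rmorphB.
    exact: sringB.
  - move=> _ _ [x hx <-] [y hy <-]; exists (x * y); last by rewrite rmorphM.
    exact: sringM.
have [|w [h _]] := extend_valuation alg nt Ar; last by exists w.
move=> c c0; rewrite /A /val_ring /=; split; last by move=> h; exists c; rewrite //= vgeE.
by move=> [d /= + /fmorph_inj e]; rewrite e vgeE.
Qed.

(** * Unramified extensions inside L *)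

Section CoefIn.
Variable (L : fieldType).
Definition coef_in (A : set L) (p : {poly L}) := forall i, A p`_i.

Variables (A : set L) (Ar : subring_closed (mem A)).
Lemma coef_in0 : coef_in A 0. Proof. by move=> i; rewrite coef0; apply: sring0. Qed.
Lemma coef_inC c : A c -> coef_in A c%:P.
Proof. by move=> Ac i; rewrite coefC; case: eqP => // _; apply: sring0. Qed.
Lemma coef_inD p q : coef_in A p -> coef_in A q -> coef_in A (p + q).
Proof. by move=> hp hq i; rewrite coefD; apply: sringD. Qed.
Lemma coef_inB p q : coef_in A p -> coef_in A q -> coef_in A (p - q).
Proof. by move=> hp hq i; rewrite coefB; apply: sringB. Qed.
Lemma coef_inM p q : coef_in A p -> coef_in A q -> coef_in A (p * q).
Proof. by move=> hp hq i; rewrite coefM; apply: sring_sum => // j _; apply: sringM. Qed.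
Lemma coef_inZ c p : A c -> coef_in A p -> coef_in A (c *: p).
Proof. by move=> hc hp i; rewrite coefZ; apply: sringM. Qed.
Lemma coef_inXn n : coef_in A 'X^n.
Proof. by move=> i; rewrite coefXn; case: (_ == _); [apply: sring1|apply: sring0]. Qed.
Lemma coef_in_deriv p : coef_in A p -> coef_in A p^`().
Proof.
by move=> hp i; rewrite coef_deriv; apply: sringMn.
Qed.

Lemma coef_in_div h a : h \is monic -> coef_in A h -> coef_in A a ->
  exists q r : {poly L}, [/\ a = q * h + r, coef_in A q, coef_in A r & (size r < size h)%N].
Proof.
move=> hm hA; have h0 : (0 < size h)%N by rewrite size_poly_gt0 monic_neq0.
have [n] := ubnP (size a); elim: n a => // n IH a; rewrite ltnS => sa aA.
have [lt|le] := ltnP (size a) (size h).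
  by exists 0, a; rewrite mul0r add0r; split=> //; apply: coef_in0.
pose m : {poly L} := lead_coef a *: 'X^(size a - size h).
have mA : coef_in A m by apply: coef_inZ; [apply: aA|apply: coef_inXn].
have a0 : a != 0 by rewrite -size_poly_gt0 (leq_trans h0).
have lc0 : lead_coef a != 0 by rewrite lead_coef_eq0.
have sm : size (m * h) = size a.
  rewrite -scalerAl size_scale // mulrC size_mulXn ?monic_neq0 // subnK //.
have lm : lead_coef (m * h) = lead_coef a.
  by rewrite lead_coefM (monicP hm) mulr1 lead_coefZ lead_coefXn mulr1.
have lt : (size (a - m * h)%R < size a)%N.
  rewrite -(prednK (leq_trans h0 le)) ltnS; apply/leq_sizeP => j.
  rewrite leq_eqVlt => /predU1P[<-|lt].
    by rewrite coefB -lead_coefE -{1}lm lead_coefE sm subrr.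
  by rewrite coefB !nth_default ?subrr // ?sm -(prednK (leq_trans h0 le)).
have [q [r [e qA rA sr]]] : exists q r : {poly L}, [/\ a - m * h = q * h + r, coef_in A q, coef_in A r & (size r < size h)%N].
  by apply: IH; [apply: leq_trans lt sa | apply: coef_inB => //; apply: coef_inM].
exists (q + m), r; split=> //; last exact: coef_inD.
by rewrite mulrDl addrAC -e subrK.
Qed.
End CoefIn.

Section Small.
Variables (K : fieldType) (v : valuation K).
(** Membership in the maximal ideal of the valuation ring. *)
Definition small x := (x == 0) || (0 < v x).
Lemma small0 : small 0. Proof. by rewrite /small eqxx. Qed.
Lemma vge_small a x : 0 < a -> vge v a x -> small x.
Proof. by rewrite /small /vge => a0 /orP[->//|/(lt_le_trans a0)->]; rewrite orbT. Qed.
Lemma smallE x : small x -> exists2 a, 0 < a & vge v a x.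
Proof.
rewrite /small /vge => /orP[->|h]; first by exists 1.
by exists (v x); rewrite // lexx orbT.
Qed.
Lemma smallD x y : small x -> small y -> small (x + y).
Proof.
move=> /smallE[a a0 hx] /smallE[b b0 hy].
apply: (@vge_small (Num.min a b)); first by rewrite lt_min a0.
by apply: vgeD; [apply: vgeW hx|apply: vgeW hy]; rewrite ge_min lexx ?orbT.
Qed.
Lemma smallN x : small x -> small (- x).
Proof. by rewrite /small oppr_eq0 valuationN. Qed.
Lemma smallB x y : small x -> small y -> small (x - y).
Proof. by move=> hx hy; apply/smallD/smallN. Qed.
Lemma smallM x y : vge v 0 x -> small y -> small (x * y).
Proof.
by move=> hx /smallE[a a0 hy]; apply: (vge_small a0); apply: vgeMl0.
Qed.
Lemma nsmallP x : vge v 0 x -> ~~ small x -> x != 0 /\ v x = 0.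
Proof.
rewrite /vge /small negb_or => + /andP[x0]; rewrite (negbTE x0) /= => h1 h2.
by split=> //; lra.
Qed.
End Small.

Section Unramified.
Variables (F L : fieldType) (iota : {rmorphism F -> L}) (w : valuation L).

(** The residue fields are perfect in the application, so that equality of the
    value groups is all that being unramified requires. *)
Definition unramified (T : set L) :=
  [/\ divring_closed (mem T), range iota `<=` T &
   forall x, T x -> x != 0 -> exists2 c, c != 0 & w x = w (iota c)].

Lemma unramified_range : unramified (range iota).
Proof.
split=> //.
  apply/divring_closedE; split.
  - by exists 1; rewrite ?rmorph1.
  - by move=> _ _ [x _ <-] [y _ <-]; exists (x - y); rewrite ?rmorphB.
  - by move=> _ _ [x _ <-] [y _ <-]; exists (x / y); rewrite ?fmorph_div.
by move=> _ [c _ <-]; rewrite fmorph_eq0 => c0; exists c.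
Qed.

(** The union of a chain of unramified extensions is unramified, so Zorn's
    lemma applies. *)
Lemma max_unramified : exists T, unramified T /\
  forall T', unramified T' -> T `<=` T' -> T' = T.
Proof.
pose P B := B = set0 \/ unramified B.
have chainP : forall C : set (set L), C `<=` P -> total_on C subset ->
    P (\bigcup_(X in C) X).
  move=> C CP Ctot.
  have [[X CX gX]|hno] := pselect (exists2 X, C X & unramified X); last first.
    left; rewrite -subset0 => x [X CX Xx]; have [X0|gX] := CP X CX.
      by rewrite X0 in Xx.
    by case: hno; exists X.
  have g X' z : C X' -> X' z -> unramified X'.
    by move=> C' z'; case: (CP _ C') => // X0; rewrite X0 in z'.
  have common x y : (\bigcup_(X in C) X) x -> (\bigcup_(X in C) X) y ->
      exists X, [/\ C X, unramified X, X x & X y].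
    move=> [X1 C1 x1] [X2 C2 x2].
    have [s|s] := Ctot _ _ C1 C2.
      by exists X2; split=> //; [apply: g C2 x2 | apply: s].
    by exists X1; split=> //; [apply: g C1 x1 | apply: s].
  right; split.
  - apply/divring_closedE; split.
    + by exists X => //; case: gX => /divring_closedE[].
    + move=> x y hx hy; have [Y [CY [/divring_closedE[_ h _] _ _] Yx Yy]] := common x y hx hy.
      by exists Y => //; apply: h.
    + move=> x y hx hy; have [Y [CY [/divring_closedE[_ _ h] _ _] Yx Yy]] := common x y hx hy.
      by exists Y => //; apply: h.
  - by move=> x Ax; exists X => //; case: gX => _ + _; apply.
  - by move=> x [Y CY Yx]; have [_ _ h] := g _ _ CY Yx; apply: h.
have [T [PT maxT]] := Zorn_bigcup chainP.
have gT : unramified T.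
  case: PT => // T0; exfalso; apply: (maxT (range iota)); last by right; apply: unramified_range.
  rewrite T0 properEneq; split; last exact: sub0set.
  apply/eqP => A0; have : range iota 1 by exists 1; rewrite ?rmorph1.
  by rewrite -A0.
exists T; split=> // T' gT' TT'; apply: contrapT => neq; apply: (maxT T'); last by right.
by rewrite properEneq; split=> //; apply/eqP => h; apply: neq.
Qed.

Variables (p : F) (p0 : p != 0) (wp : 0 < w (iota p)).
Hypothesis pmin : forall c, c != 0 -> 0 < w (iota c) -> w (iota p) <= w (iota c).
Variables (T : set L) (Tu : unramified T).
Variables (y : L) (wy : vge w 0 y).

Let Tdiv : divring_closed (mem T). Proof. by case: Tu. Qed.
Let Tr : subring_closed (mem T). Proof. exact: divring_subring. Qed.
Let Tp : T (iota p). Proof. by case: Tu => _ + _; apply; exists p. Qed.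
Let ip0 : iota p != 0. Proof. by rewrite fmorph_eq0. Qed.
Let pi := w (iota p).

Let TV x z : T x -> T z -> T (x / z).
Proof. by case/divring_closedE: Tdiv => _ _; apply. Qed.

Let A := [set x | T x /\ vge w 0 x].

Let Ar : subring_closed (mem A).
Proof.
apply/subring_closedE; split.
- by split; [apply: sring1|rewrite vgeE ?oner_neq0 // valuation1].
- by move=> a b [Ta wa] [Tb wb]; split; [apply: sringB|apply: vgeB].
- by move=> a b [Ta wa] [Tb wb]; split; [apply: sringM|apply: vgeM0].
Qed.

Let small_pi x : T x -> small w x -> vge w pi x.
Proof.
case: Tu => _ _ h Tx; rewrite /small /vge; have [//|x0 /=] := eqVneq x 0.
by have [c c0 ->] := h x Tx x0; apply: pmin.
Qed.

Let coef_in_vge a : coef_in A a -> vge w 0 a.[y].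
Proof. by move=> ha; apply: vge_horner => // i; case: (ha i). Qed.

(** If a polynomial r with integral coefficients is small at y although no
    monic polynomial of size less than N is, then the top coefficient of r is
    not a unit, since dividing by it would make r monic; removing that term,
    one sees in turn that no coefficient is a unit. *)
Let small_coefs N r :
  (forall h, h \is monic -> coef_in A h -> small w h.[y] -> (N <= size h)%N) ->
  coef_in A r -> (size r < N)%N -> small w r.[y] -> forall i, vge w pi r`_i.
Proof.
move=> hN; have [n] := ubnP (size r); elim: n r => // n IH r; rewrite ltnS => sr rA rN ry.
have [r00|r0] := eqVneq r 0; first by move=> i; rewrite r00 coef0; apply: vge0.
have [Tc wc] := rA (size r).-1; rewrite -lead_coefE in Tc wc.
have [sc|/(nsmallP wc)[c0 c1]] := boolP (small w (lead_coef r)).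
  pose r' : {poly L} := r - lead_coef r *: 'X^((size r).-1).
  have sr0 : (0 < size r)%N by rewrite size_poly_gt0.
  have lt : (size r' < size r)%N.
    rewrite -(prednK sr0) ltnS; apply/leq_sizeP => j.
    rewrite leq_eqVlt => /predU1P[<-|lt].
      by rewrite coefB coefZ coefXn eqxx mulr1 -lead_coefE subrr.
    rewrite coefB coefZ coefXn gtn_eqF // mulr0 subr0 nth_default //.
    by rewrite -(prednK sr0).
  have h i : vge w pi r'`_i.
    apply: IH (leq_trans lt sr) _ (ltn_trans lt rN) _ i.
      by apply: coef_inB => //; apply: coef_inZ => //; apply: coef_inXn.
    rewrite hornerD hornerN hornerZ hornerXn; apply: smallB => //.
    by rewrite mulrC; apply: smallM => //; apply: vgeX.
  move=> i; have -> : r = r' + lead_coef r *: 'X^((size r).-1) by rewrite subrK.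
  rewrite coefD; apply: vgeD => //; rewrite coefZ coefXn.
  case: (_ == _); last by rewrite mulr0 vge0.
  by rewrite mulr1; apply: small_pi.
have AV : A (lead_coef r)^-1.
  split; last by rewrite vgeE ?invr_eq0 // valuationV // c1 oppr0.
  by rewrite -[_^-1]mul1r; apply: TV => //; apply: sring1.
have : (N <= size ((lead_coef r)^-1 *: r))%N.
  apply: hN; first by rewrite monicE lead_coefZ mulVf.
  - exact: coef_inZ.
  - by rewrite hornerZ; apply: smallM => //; case: AV.
by rewrite size_scale ?invr_eq0 // leqNgt rN.
Qed.

Section ResidualRoot.
Variables (d : nat) (g : {poly L}).
Hypotheses (gA : coef_in A g) (gy : g.[y] = 0) (gd : (size g <= d.+1)%N).
Hypothesis gprim : exists i, ~~ small w g`_i.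

(** The polynomial h lifts the minimal polynomial of the residue class of y,
    without mentioning the residue field. *)
Lemma exists_minimal_small : exists h, [/\ h \is monic, coef_in A h, small w h.[y] &
  forall h', h' \is monic -> coef_in A h' -> small w h'.[y] -> (size h <= size h')%N].
Proof.
pose S n := `[< exists h, [/\ h \is monic, coef_in A h, small w h.[y] & size h = n] >].
have [n Sn] : exists n, S n.
  apply: contrapT => hno; case: gprim => i /negP; apply.
  apply: (@vge_small _ _ pi) => //.
  apply: (@small_coefs (size g).+1) => //; last by rewrite gy small0.
  move=> h h1 h2 h3; exfalso; apply: hno; exists (size h); apply/asboolP.
  by exists h.
have ex : exists n, S n by exists n.
have [m /asboolP[h [h1 h2 h3 sh]] mmin] := ex_minnP ex.
exists h; split=> // h' h1' h2' h3'; rewrite sh; apply: mmin.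
by apply/asboolP; exists h'.
Qed.

Lemma coefs_below_minimal (h r : {poly L}) : (forall h', h' \is monic -> coef_in A h' -> small w h'.[y] -> (size h <= size h')%N) ->
  coef_in A r -> (size r < size h)%N -> small w r.[y] -> forall i, vge w pi r`_i.
Proof. by move=> hm; apply: small_coefs. Qed.

(** Expand g in powers of h.  If the value rho of h(y) were less than pi / d,
    then the terms of the expansion whose digit is not small would have the
    distinct values i * rho < pi, while the others have value at least pi, and
    g(y) could not vanish.  So rho >= pi / d, and a small value b(y) is h(y)
    times an integral element plus a term of value at least pi. *)
Lemma value_gap (b : {poly L}) :
  coef_in A b -> small w b.[y] -> vge w (pi / d%:R) b.[y].
Proof.
have [h [h1 h2 h3 hmin]] := exists_minimal_small.
have rlow r : coef_in A r -> (size r < size h)%N -> small w r.[y] -> vge w pi r.[y].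
  by move=> rA sr ry; apply: vge_horner => //; apply: (coefs_below_minimal hmin).
have d0 : (0 < d)%N.
  rewrite lt0n; apply/eqP => d0; have [i] := gprim.
  move: gd gy; rewrite d0 => /size1_polyC ->; rewrite hornerC => ->.
  by rewrite coef0 small0.
have dq : (0 : rat) < d%:R by rewrite ltr0n.
have pid : pi / d%:R <= pi.
  by rewrite ler_pdivrMr // ler_peMr // ?ler1n //; apply: ltW.
have hy : vge w (pi / d%:R) h.[y].
  have [hy0|hy0] := eqVneq h.[y] 0; first by rewrite hy0 vge0.
  rewrite vgeE // leNgt; apply/negP => hlt.
  have rho0 : 0 < w h.[y] by move: h3; rewrite /small (negbTE hy0).
  (* the lowest nonsmall digit of a in base h determines the value of a(y) *)
  have NP n (a : {poly L}) : (size a <= n.+1)%N -> (n <= d)%N -> coef_in A a -> (exists i, ~~ small w a`_i) ->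
      a.[y] != 0 /\ w a.[y] <= n%:R * w h.[y].
    elim: n a => [|n IH] a sa nd aA [i ai].
      move: ai; rewrite (size1_polyC sa) hornerC coefC.
      case: eqP => _; last by rewrite small0.
      by case: (aA 0%N) => _ wa /(nsmallP wa)[-> ->]; rewrite mul0r.
    have [k [r [e kA rA sr]]] := coef_in_div Ar h1 h2 aA.
    have hn (m : nat) (x : rat) : 0 < x -> 0 <= m%:R * x by move=> x0; rewrite mulr_ge0 // ltW.
    have [ry|nry] := boolP (small w r.[y]); last first.
      have [r0 wr] := nsmallP (coef_in_vge rA) nry.
      rewrite e hornerD hornerM addrC.
      have := @valuationD_lt _ w r.[y] (k.[y] * h.[y]) r0.
      by rewrite wr => -[|-> ->]; [exact: smallM (coef_in_vge kA) h3 | rewrite hn].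
    have wr := rlow _ rA sr ry; have rc := coefs_below_minimal hmin rA sr ry.
    have [k0 wk] : k.[y] != 0 /\ w k.[y] <= n%:R * w h.[y].
      apply: IH => //; last 1 first.
      - apply: contrapT => hno; move/negP: ai; apply.
        have kp j : vge w pi k`_j.
          have [Tk _] := kA j; apply: small_pi => //.
          by apply: contrapT => /negP nk; apply: hno; exists j.
        apply: (@vge_small _ _ pi) => //; rewrite e coefD; apply: vgeD => //.
        rewrite coefM; apply: vge_sum => j _; apply: vgeM0 => //.
        by case: (h2 (i - j)%N).
      - have sh : (1 < size h)%N.
          rewrite ltnNge; apply/negP => sh; move: h3.
          have -> : h = 1.
            rewrite (size1_polyC sh); congr (_%:P).
            by move/monicP: h1; rewrite {1}(size1_polyC sh) lead_coefC.
          by rewrite hornerC /small oner_eq0 valuation1 ltxx.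
        have [->|kn0] := eqVneq k 0; first by rewrite size_poly0.
        have skh : size (k * h) = (size k + size h).-1.
          by rewrite size_mul // monic_neq0.
        have h5 : ((size k + size h).-1 <= n.+2)%N.
          rewrite -skh -(@size_polyDl _ _ r) -?e // skh; apply: leq_trans sr _.
          rewrite -subn1 leq_subRL ?addn_gt0 ?size_poly_gt0 ?kn0 //.
          by rewrite leq_add2r size_poly_gt0.
        have : ((size k).+1 <= n.+2)%N.
          apply: leq_trans h5; rewrite -subn1 leq_subRL ?addn_gt0 ?size_poly_gt0 ?kn0 //.
          by rewrite add1n -addn2 leq_add2l.
        by rewrite ltnS.
      - exact: ltnW.
    rewrite e hornerD hornerM.
    have kh0 : k.[y] * h.[y] != 0 by rewrite mulf_neq0.
    have wkh : w (k.[y] * h.[y]) <= n.+1%:R * w h.[y].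
      by rewrite valuationM // -addn1 natrD mulrDl mul1r lerD2r.
    have wlt : w (k.[y] * h.[y]) < pi.
      apply: le_lt_trans wkh _; apply: (@le_lt_trans _ _ (d%:R * w h.[y])).
        by rewrite ler_pM2r // ler_nat.
      by rewrite mulrC -ltr_pdivlMr.
    have [|r1 r2] := @valuationD_lt _ w _ r.[y] kh0; last by rewrite r2.
    by move: wr; rewrite /vge => /orP[->//|h6]; rewrite (lt_le_trans wlt h6) orbT.
  have [] := NP d g gd (leqnn d) gA gprim.
  by rewrite gy eqxx.
move=> bA b_y; have [q [r [e qA rA sr]]] := coef_in_div Ar h1 h2 bA.
have ry : small w r.[y].
  have -> : r.[y] = b.[y] - q.[y] * h.[y] by rewrite e hornerD hornerM addrC addKr.
  by apply: smallB => //; apply: smallM => //; apply: coef_in_vge.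
rewrite e hornerD hornerM; apply: vgeD.
  by apply: vgeMl0 => //; apply: coef_in_vge.
exact: vgeW pid (rlow _ rA sr ry).
Qed.
End ResidualRoot.

Section SimpleRoot.
Variables (d : nat) (g : {poly L}).
Hypotheses (gA : coef_in A g) (gy : g.[y] = 0).
Hypothesis gder : ~~ small w g^`().[y].

Let gprim : exists i, ~~ small w g`_i.
Proof.
apply: contrapT => hno; move/negP: gder; apply.
apply: (@vge_small _ _ pi) => //; apply: vge_horner => // i.
rewrite coef_deriv -mulr_natr; apply: vgeM0; last exact: vge_nat.
have [Tg _] := gA i.+1; apply: small_pi => //.
by apply: contrapT => /negP nk; apply: hno; exists i.+1.
Qed.

(** Write g = k h + r with r divisible by pi.  As y is a simple root modulo w,
    k(y) is a unit, hence h(y) is divisible by pi in the local ring of y.  So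
    the maximal ideal of that ring is generated by pi: a small a(y) is pi
    times the value of another integral polynomial, up to a unit. *)
Lemma etale_values (a : {poly L}) : coef_in A a -> a.[y] != 0 ->
  exists i : nat, w a.[y] = i%:R * pi.
Proof.
have [h [h1 h2 h3 hmin]] := exists_minimal_small gA gy gprim.
have hdiv (r : {poly L}) : coef_in A r -> (size r < size h)%N -> small w r.[y] ->
    exists2 r1, coef_in A r1 & r = iota p *: r1.
  move=> rA sr ry; exists ((iota p)^-1 *: r); last by rewrite scalerA divff // scale1r.
  move=> i; rewrite coefZ; split.
    by apply: sringM => //; [rewrite -[_^-1]mul1r; apply: TV => //; apply: sring1 | case: (rA i)].
  have := coefs_below_minimal hmin rA sr ry i; rewrite /vge mulf_eq0.
  have [->|r0 /= hr] := eqVneq r`_i 0; first by rewrite orbT.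
  by rewrite valuationM ?invr_eq0 // valuationV //; apply/orP; right; move: hr; rewrite /pi; lra.
have [k [r [e kA rA sr]]] := coef_in_div Ar h1 h2 gA.
have ry : small w r.[y].
  have -> : r.[y] = g.[y] - k.[y] * h.[y] by rewrite e hornerD hornerM addrC addKr.
  by rewrite gy; apply: smallB; [apply: small0 | apply: smallM => //; apply: coef_in_vge].
have nk : ~~ small w k.[y].
  apply/negP => sk; move/negP: gder; apply.
  rewrite e derivD derivM !hornerD !hornerM; apply: smallD; first apply: smallD.
  - by apply: smallM => //; apply: coef_in_vge; apply: coef_in_deriv.
  - by rewrite mulrC; apply: smallM => //; apply: coef_in_vge; apply: coef_in_deriv.
  - apply: (@vge_small _ _ pi) => //; apply: vge_horner => // i.
    rewrite coef_deriv -mulr_natr; apply: vgeM0; last exact: vge_nat.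
    exact: (coefs_below_minimal hmin).
have [k0 wk] := nsmallP (coef_in_vge kA) nk.
have [r1 r1A er] := hdiv _ rA sr ry.
have ekh : k.[y] * h.[y] = - (iota p * r1.[y]).
  by have := gy; rewrite e hornerD hornerM er hornerZ => /eqP; rewrite addr_eq0 => /eqP.
move=> aA a0; have [N hN] := archi_rat (w a.[y]) wp.
elim: N a aA a0 hN => [|N IH] a aA a0 hN.
  exists 0%N; have := coef_in_vge aA; rewrite vgeE // => h4; lra.
have [sa|nsa] := boolP (small w a.[y]); last first.
  by have [_ ->] := nsmallP (coef_in_vge aA) nsa; exists 0%N; rewrite mul0r.
have [q [s [ea qA sA ss]]] := coef_in_div Ar h1 h2 aA.
have sy : small w s.[y].
  have -> : s.[y] = a.[y] - q.[y] * h.[y] by rewrite ea hornerD hornerM addrC addKr.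
  by apply: smallB => //; apply: smallM => //; apply: coef_in_vge.
have [s1 s1A es] := hdiv _ sA ss sy.
pose a1 := s1 * k - r1 * q.
have a1A : coef_in A a1 by apply: coef_inB => //; apply: coef_inM.
have ea1 : a.[y] * k.[y] = iota p * a1.[y].
  have -> : a.[y] * k.[y] = q.[y] * (k.[y] * h.[y]) + s.[y] * k.[y].
    by rewrite ea hornerD hornerM; ring.
  by rewrite ekh es hornerZ /a1 hornerD hornerN !hornerM; ring.
have a10 : a1.[y] != 0.
  have : a.[y] * k.[y] != 0 by rewrite mulf_neq0.
  by rewrite ea1 mulf_eq0 negb_or => /andP[].
have wa : w a.[y] = pi + w a1.[y].
  by have := valuationM w a0 k0; rewrite ea1 valuationM // wk /pi; lra.
have [|i hi] := IH a1 a1A a10; first by move: hN; rewrite wa -addn1 natrD /pi; lra.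
by exists i.+1; rewrite wa hi -[i.+1]add1n natrD; ring.
Qed.

(** By [etale_values] the field T(y) is again unramified. *)
Lemma etale_mem : (forall T', unramified T' -> T `<=` T' -> T' = T) -> T y.
Proof.
pose T' := [set x | exists a b : {poly L}, [/\ coef_in T a, coef_in T b, b.[y] != 0 & x = a.[y] / b.[y]]].
have T1 := sring1 Tr; have T0 := sring0 Tr.
have TT' : T `<=` T'.
  move=> x Tx; exists x%:P, 1; rewrite !hornerC oner_eq0 divr1; split=> //.
    by apply: coef_inC.
  exact: (coef_inC Tr).
have T'y : T' y.
  exists 'X, 1; rewrite !hornerC hornerX oner_eq0 divr1; split=> //.
    exact: (coef_inXn Tr 1).
  exact: (coef_inC Tr).
move=> maxT; rewrite -(maxT T') //; split.
- apply/divring_closedE; split.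
  + exact: TT'.
  + move=> _ _ [a [b [aT bT b0 ->]]] [c [e [cT eT e0 ->]]].
    exists (a * e - c * b), (b * e); split.
    * by apply: (coef_inB Tr); apply: (coef_inM Tr).
    * exact: (coef_inM Tr).
    * by rewrite hornerM mulf_neq0.
    * by rewrite !(hornerD, hornerN, hornerM); field; rewrite b0 e0.
  + move=> _ _ [a [b [aT bT b0 ->]]] [c [e [cT eT e0 ->]]].
    have [c0|c0] := eqVneq c.[y] 0.
      by exists 0, 1; rewrite c0 !hornerC mul0r invr0 mulr0 mul0r oner_eq0; split=> //; apply: (coef_inC Tr).
    exists (a * e), (b * c); split; try exact: (coef_inM Tr).
    * by rewrite hornerM mulf_neq0.
    * by rewrite !hornerM; field; rewrite b0 e0 c0.
- by case: Tu => _ h _; apply: subset_trans TT'.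
- have key (a : {poly L}) : coef_in T a -> a.[y] != 0 -> exists i j : nat, w a.[y] = i%:R * pi - j%:R * pi.
    move=> aT a0.
    have [N hN] : exists N : nat, forall i, (i < size a)%N -> vge w (- (N%:R * pi)) a`_i.
      elim: (size a) => [|n [N hN]]; first by exists 0%N.
      have [M hM] : exists M : nat, vge w (- (M%:R * pi)) a`_n.
        have [M hM] := archi_rat (- w a`_n) wp; exists M.
        by apply: vgeW (vge_val _ _); rewrite /pi; lra.
      have mon m m' x : (m <= m')%N -> vge w (- (m%:R * pi)) x -> vge w (- (m'%:R * pi)) x.
        by move=> mm; apply: vgeW; rewrite lerN2 ler_pM2r // ler_nat.
      exists (maxn N M) => i; rewrite ltnS leq_eqVlt => /predU1P[->|/hN h].
        by apply: mon hM; rewrite leq_maxr.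
      by apply: mon h; rewrite leq_maxl.
    pose c := iota p ^+ N.
    have c0 : c != 0 by rewrite expf_neq0.
    have wc : w c = N%:R * pi by rewrite valuationX.
    have caA : coef_in A (c *: a).
      move=> i; rewrite coefZ; split; first by apply: (sringM Tr) => //; apply: (sringX Tr).
      have [lt|ge] := ltnP i (size a); last by rewrite nth_default // mulr0 vge0.
      have -> : (0 : rat) = w c + - (N%:R * pi) by rewrite wc subrr.
      by apply: vgeM => //; [exact: vge_val | exact: hN].
    have [|i hi] := etale_values caA; first by rewrite hornerZ mulf_neq0.
    by exists i, N; rewrite -hi hornerZ valuationM // wc; ring.
  move=> _ [a [b [aT bT b0 ->]]] ab0.
  have a0 : a.[y] != 0 by apply: contraNneq ab0 => ->; rewrite mul0r.
  have [i [j h1]] := key a aT a0; have [i' [j' h2]] := key b bT b0.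
  exists (p ^+ (i + j') / p ^+ (j + i')); first by rewrite mulf_neq0 ?invr_eq0 ?expf_neq0.
  rewrite fmorph_div !rmorphXn !valuation_div ?expf_neq0 // !valuationX // h1 h2 !natrD /pi.
  by ring.
Qed.

End SimpleRoot.

End Unramified.

(** * Reversed polynomials and the Wronskian *)

Section Reverse.
Variable K : fieldType.
Implicit Types p q : {poly K}.

(** The polynomial p, of degree at most n, in the coordinate 1/x at infinity;
    n may exceed the degree of p. *)
Definition rev_poly n p : {poly K} := \poly_(i < n.+1) p`_(n - i).

Lemma coef_rev_poly n p i : (rev_poly n p)`_i = if (i <= n)%N then p`_(n - i) else 0.
Proof. by rewrite coef_poly. Qed.

Lemma size_rev_poly n p : (size (rev_poly n p) <= n.+1)%N.
Proof. exact: size_poly. Qed.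

Lemma rev_polyD n : {morph rev_poly n : p q / p + q}.
Proof.
by move=> p q; apply/polyP => i; rewrite coefD !coef_rev_poly coefD; case: ifP; rewrite ?addr0.
Qed.

Lemma rev_poly0 n : rev_poly n 0 = 0.
Proof. by apply/polyP => i; rewrite coef_rev_poly !coef0 if_same. Qed.

Lemma rev_polyZXn n (c : K) k : (k <= n)%N -> rev_poly n (c *: 'X^k) = c *: 'X^(n - k).
Proof.
move=> kn; apply/polyP => i; rewrite coef_rev_poly !coefZ !coefXn.
have [le|lt] := leqP i n.
  by congr (_ * (_ : bool)%:R); apply/eqP/eqP => [<-|->]; rewrite subKn.
by rewrite gtn_eqF ?mulr0 // (leq_ltn_trans (leq_subr _ _)).
Qed.

Lemma rev_polyE n p : rev_poly n p = \sum_(i < n.+1) p`_i *: 'X^(n - i).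
Proof.
rewrite /rev_poly poly_def (reindex_inj rev_ord_inj) /=.
by apply: eq_bigr => i _; rewrite subSS subKn // -ltnS.
Qed.

Lemma polyE_wide n p : (size p <= n)%N -> p = \sum_(i < n) p`_i *: 'X^i.
Proof.
move=> sp; rewrite -poly_def; apply/polyP => i; rewrite coef_poly.
by case: ltnP => // ge; rewrite nth_default // (leq_trans sp).
Qed.

Lemma rev_polyM m n p q : (size p <= m.+1)%N -> (size q <= n.+1)%N ->
  rev_poly (m + n) (p * q) = rev_poly m p * rev_poly n q.
Proof.
move=> sp sq; rewrite {1}(polyE_wide sp) {1}(polyE_wide sq) !rev_polyE.
rewrite -rev_polyE !big_distrlr /= (big_morph _ (rev_polyD _) (rev_poly0 _)).
apply: eq_bigr => i _; rewrite (big_morph _ (rev_polyD _) (rev_poly0 _)).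
have hi : (i <= m)%N by rewrite -ltnS.
apply: eq_bigr => j _; have hj : (j <= n)%N by rewrite -ltnS.
rewrite -!scalerAl -!scalerAr !scalerA -!exprD rev_polyZXn ?leq_add //.
by congr (_ *: 'X^_); lia.
Qed.

Lemma horner_rev_poly n p y : (size p <= n.+1)%N -> y != 0 ->
  (rev_poly n p).[y^-1] = p.[y] / y ^+ n.
Proof.
move=> sp y0; rewrite rev_polyE (horner_coef_wide _ sp) horner_sum mulr_suml.
apply: eq_bigr => i _; rewrite hornerZ hornerXn -mulrA; congr (_ * _).
have hi : (i <= n)%N by rewrite -ltnS.
have yi : y ^+ i != 0 by rewrite expf_neq0.
have yi' : y ^+ (n - i) != 0 by rewrite expf_neq0.
have -> : y ^+ n = y ^+ i * y ^+ (n - i) by rewrite -exprD subnKC.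
by rewrite exprVn; field; rewrite yi yi'.
Qed.

Lemma horner_derivM n p x : (size p <= n)%N ->
  p^`().[x] * x = \sum_(i < n) p`_i * i%:R * x ^+ i.
Proof.
move=> sp; rewrite -hornerMX (@horner_coef_wide _ n); last first.
  have [->|p0] := eqVneq p^`() 0; first by rewrite mul0r size_poly0.
  by rewrite size_mulX // (leq_trans _ sp) // lt_size_deriv // -size_poly_gt0;
     case: (size p) (size_poly_gt0 p) => // /esym/negbFE/eqP e; rewrite e linear0 eqxx in p0.
apply: eq_bigr => -[[|i] hi] _ /=; rewrite coefMX /=; first by rewrite mulr0 !mul0r.
by rewrite coef_deriv mulr_natr.
Qed.

(** The numerator of the derivative of p / q: its zeros are the critical points
    of this map. *)
Definition wronskian p q : {poly K} := p^`() * q - p * q^`().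

Lemma wronskianC p q : wronskian q p = - wronskian p q.
Proof. by rewrite /wronskian; ring. Qed.

Lemma horner_deriv_rev n p y : (size p <= n.+1)%N -> y != 0 ->
  (rev_poly n p)^`().[y^-1] / y = (n%:R * p.[y] - p^`().[y] * y) / y ^+ n.
Proof.
move=> sp y0; rewrite (horner_derivM _ (size_rev_poly n p)) (horner_derivM _ sp).
rewrite (horner_coef_wide _ sp) mulr_sumr -sumrB mulr_suml (reindex_inj rev_ord_inj) /=.
apply: eq_bigr => i _; have hi : (i <= n)%N by rewrite -ltnS.
rewrite subSS coef_rev_poly leq_subr subKn //.
have yi : y ^+ i != 0 by rewrite expf_neq0.
have yi' : y ^+ (n - i) != 0 by rewrite expf_neq0.
have -> : y ^+ n = y ^+ i * y ^+ (n - i) by rewrite -exprD subnKC.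
by rewrite exprVn natrB //; field; rewrite yi yi'.
Qed.

(** The Wronskian of two binary forms of degree n is a form of degree 2n - 2,
    which explains the power of y. *)
Lemma horner_wronskian_rev n p q y : (size p <= n.+1)%N -> (size q <= n.+1)%N ->
  (0 < n)%N -> y != 0 ->
  (wronskian p q).[y] = - y ^+ (n.-1).*2 * (wronskian (rev_poly n p) (rev_poly n q)).[y^-1].
Proof.
move=> sp sq n0 y0.
have e1 := horner_deriv_rev sp y0; have e2 := horner_deriv_rev sq y0.
have e3 := horner_rev_poly sp y0; have e4 := horner_rev_poly sq y0.
rewrite /wronskian !(hornerD, hornerN, hornerM) e3 e4.
have -> : (rev_poly n p)^`().[y^-1] = (n%:R * p.[y] - p^`().[y] * y) / y ^+ n * y.
  by rewrite -e1 divfK.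
have -> : (rev_poly n q)^`().[y^-1] = (n%:R * q.[y] - q^`().[y] * y) / y ^+ n * y.
  by rewrite -e2 divfK.
rewrite -addnn exprD -(prednK n0) /= exprS.
have yi : y ^+ n.-1 != 0 by rewrite expf_neq0.
by field; rewrite yi y0.
Qed.

(** Reversing a Bezout identity shows that a common factor divides a power of
    'X; it does not vanish at 0, since one of p and q has degree n. *)
Lemma coprimep_rev_poly n p q : coprimep p q -> (size p <= n.+1)%N -> (size q <= n.+1)%N ->
  (p`_n != 0) || (q`_n != 0) -> coprimep (rev_poly n p) (rev_poly n q).
Proof.
move=> /Bezout_eq1_coprimepP[[s t] /= e] sp sq lc.
pose N := maxn (size s) (size t).
have ss : (size s <= N.+1)%N by rewrite ltnW // ltnS leq_maxl.
have st : (size t <= N.+1)%N by rewrite ltnW // ltnS leq_maxr.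
have e2 : rev_poly N s * rev_poly n p + rev_poly N t * rev_poly n q = 'X^(N + n).
  rewrite -!rev_polyM // -rev_polyD e.
  have -> : 1 = 1 *: 'X^0 :> {poly K} by rewrite scale1r expr0.
  by rewrite rev_polyZXn // subn0 scale1r.
have r0 r : (rev_poly n r).[0] = r`_n by rewrite horner_coef0 coef_rev_poly leq0n subn0.
have copX (r : {poly K}) : r`_n != 0 -> coprimep (rev_poly n r) 'X^(N + n).
  by move=> h; apply: coprimep_expr; rewrite coprimepX /root r0.
apply/coprimepP => E Ep Eq.
have EX : E %| 'X^(N + n).
  by rewrite -e2 dvdp_add // dvdp_mull.
suff : coprimep E 'X^(N + n) by move/coprimepP => h; apply: h; rewrite ?dvdpp.
by case/orP: lc => /copX; apply: coprimep_dvdr.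
Qed.

(** If p'q = pq', then coprimality makes p divide p' and q divide q', so that
    both derivatives vanish by degree, while the coefficient of degree n - 1 of
    one of them is n times a nonzero one. *)
Lemma wronskian_neq0 (l : nat) n p q : l \in [pchar K] -> ~~ (l %| n)%N ->
  coprimep p q -> (size p <= n.+1)%N -> (size q <= n.+1)%N ->
  (p`_n != 0) || (q`_n != 0) -> wronskian p q != 0.
Proof.
move=> hl ln cop sp sq lc; apply: contraNneq ln => /eqP; rewrite subr_eq0 => /eqP e.
have n0 (r s : {poly K}) : coprimep r s -> r^`() * s = r * s^`() -> r^`() = 0.
  move=> crs ers; have [->|r0] := eqVneq r 0; first by rewrite linear0.
  have : r %| r^`() by rewrite -(Gauss_dvdpl _ crs) ers dvdp_mulr.
  apply: contraTeq => r'0; apply/negP => /(dvdp_leq r'0).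
  by rewrite leqNgt lt_size_deriv.
have key (r : {poly K}) : r^`() = 0 -> r`_n != 0 -> (l %| n)%N.
  move=> r0 rn; case: n rn {sp sq lc} => [|m] rn; first exact: dvdn0.
  have := coef_deriv r m; rewrite r0 coef0 -mulr_natr => /esym/eqP.
  by rewrite mulf_eq0 (negbTE rn) /= (dvdn_pcharf hl).
case/orP: lc; apply: key; first exact: n0 e.
by apply: (n0 q p); rewrite 1?coprimep_sym // mulrC -e mulrC.
Qed.
End Reverse.

(** * Local heights and the action of a rational map *)

Section LocalHeight.
Variables (K : fieldType) (w : valuation K).

Definition local_height (x : K) : rat := if x == 0 then 0 else Num.max 0 (- w x).

Lemma local_height_ge0 x : 0 <= local_height x.
Proof. by rewrite /local_height; case: ifP => // _; rewrite le_max lexx. Qed.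

Lemma vge_local_height x : vge w (- local_height x) x.
Proof.
rewrite /vge /local_height; case: eqP => //= _.
by rewrite lerNl le_max lexx orbT.
Qed.

Lemma local_height_int x : vge w 0 x -> local_height x = 0.
Proof.
rewrite /vge /local_height; case: eqP => //= _ h.
by apply/max_idPl; lra.
Qed.

Lemma local_height_neg x : x != 0 -> w x < 0 -> local_height x = - w x.
Proof. by rewrite /local_height => /negbTE-> h; apply/max_idPr; lra. Qed.

Lemma local_height_le x a : 0 <= a -> vge w (- a) x -> local_height x <= a.
Proof.
rewrite /vge /local_height; case: eqP => //= _ a0 h.
by rewrite ge_max a0 lerNl.
Qed.
End LocalHeight.

Section CoefBound.
Variables (F L : fieldType) (iota : {rmorphism F -> L}) (w : valuation L).
Definition height_sum (s : seq F) := \sum_(a <- s) local_height w (iota a).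
Lemma height_sum_ge0 s : 0 <= height_sum s.
Proof. by apply: sumr_ge0 => a _; apply: local_height_ge0. Qed.
Lemma height_sum_cat s t : height_sum (s ++ t) = height_sum s + height_sum t.
Proof. by rewrite /height_sum big_cat. Qed.
Lemma height_sum_ge s a : a \in s -> local_height w (iota a) <= height_sum s.
Proof.
move=> /path.splitPr[s1 s2]; rewrite /height_sum big_cat big_cons /=.
have := height_sum_ge0 s1; have := height_sum_ge0 s2; rewrite /height_sum; lra.
Qed.
Lemma vge_coef (s : {poly F}) i : vge w (- height_sum s) (map_poly iota s)`_i.
Proof.
rewrite coef_map /=; have [lt|ge] := ltnP i (size s); last first.
  by rewrite nth_default // rmorph0 vge0.
apply: vgeW (vge_local_height _ _); rewrite lerN2; apply: height_sum_ge.
exact: mem_nth.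
Qed.
Lemma vge_horner_map (s : {poly F}) z : vge w 0 z -> vge w (- height_sum s) (map_poly iota s).[z].
Proof. by move=> hz; apply: vge_horner => // i; apply: vge_coef. Qed.

(** Two coprime polynomials cannot both be small at an integral point, with a
    bound that depends only on the coefficients of a Bezout identity. *)
Lemma bezout_bound (s t p q : {poly F}) z mu : s * p + t * q = 1 -> vge w 0 z ->
  vge w mu (map_poly iota p).[z] -> vge w mu (map_poly iota q).[z] ->
  mu <= height_sum s + height_sum t.
Proof.
move=> e hz hp hq; set C := height_sum s + height_sum t.
have sC : vge w (- C) (map_poly iota s).[z].
  by apply: vgeW (vge_horner_map _ hz); rewrite lerN2 lerDl height_sum_ge0.
have tC : vge w (- C) (map_poly iota t).[z].
  by apply: vgeW (vge_horner_map _ hz); rewrite lerN2 lerDr height_sum_ge0.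
have := vgeD (vgeM sC hp) (vgeM tC hq).
rewrite -!hornerM -hornerD -!rmorphM -rmorphD e rmorph1 hornerC.
by rewrite vgeE ?oner_neq0 // valuation1; lra.
Qed.
End CoefBound.

Lemma map_rev_poly (F L : fieldType) (iota : {rmorphism F -> L}) n p :
  map_poly iota (rev_poly n p) = rev_poly n (map_poly iota p).
Proof.
by apply/polyP => i; rewrite coef_map /= !coef_rev_poly; case: ifP; rewrite ?coef_map ?rmorph0.
Qed.

Lemma map_wronskian (F L : fieldType) (iota : {rmorphism F -> L}) p q :
  map_poly iota (wronskian p q) = wronskian (map_poly iota p) (map_poly iota q).
Proof. by rewrite /wronskian rmorphB !rmorphM /= !deriv_map. Qed.

Section Dynamics.
Variables (F : fieldType) (f : {fraction {poly F}}).
Let P := ratnum f.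
Let Q := ratden f.
Let d := ratdeg f.
Hypothesis d0 : (0 < d)%N.

Lemma ratden_frac_neq0 : \d_(generic_quotient.repr f) != 0.
Proof. exact: denom_ratioP. Qed.

Lemma coprimep_rat : coprimep P Q.
Proof. by apply: coprimep_div_gcd; rewrite ratden_frac_neq0 orbT. Qed.

Lemma ratden_neq0 : Q != 0.
Proof.
have h := ratden_frac_neq0; apply: contraNneq h => e.
set r := generic_quotient.repr f in e *.
have := divpK (dvdp_gcdr (\n_r) (\d_r)).
by have -> : \d_r %/ gcdp (\n_r) (\d_r) = 0 := e; rewrite mul0r => <-.
Qed.

Lemma size_ratnum : (size P <= d.+1)%N.
Proof. by rewrite /d /ratdeg (leq_trans _ (leqSpred _)) // leq_maxl. Qed.

Lemma size_ratden : (size Q <= d.+1)%N.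
Proof. by rewrite /d /ratdeg (leq_trans _ (leqSpred _)) // leq_maxr. Qed.

Lemma rat_lead : (P`_d != 0) || (Q`_d != 0).
Proof.
have h (R : {poly F}) : size R = d.+1 -> R`_d != 0.
  by move=> sR; rewrite -[d]/(d.+1.-1) -sR -lead_coefE lead_coef_eq0 -size_poly_gt0 sR.
have : maxn (size P) (size Q) = d.+1.
  by move: d0; rewrite /d /ratdeg -/P -/Q; case: (maxn _ _).
by rewrite /maxn; case: ifP => _ /h ->; rewrite ?orbT.
Qed.

Section Map.
Variables (L : fieldType) (iota : {rmorphism F -> L}).
Let PL := map_poly iota P.
Let QL := map_poly iota Q.

(** The image of the point (c : 1), or (1 : 0), has the coordinates
    (P(c) : Q(c)); point_scale is the coordinate by which ratmap divides them.
    Its values at all places sum to 0, which is how the height becomes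
    independent of the choice of coordinates. *)
Definition point_scale (b : option L) : L :=
  let quot (x y : L) := if y == 0 then x else y in
  if b is Some c then quot PL.[c] QL.[c] else quot PL`_d QL`_d.

Definition point_height (w : valuation L) (b : option L) : rat :=
  if b is Some c then local_height w c else 0.

Lemma PQ_neq0 c : (PL.[c] != 0) || (QL.[c] != 0).
Proof.
have /Bezout_eq1_coprimepP[[s t] /= e] := coprimep_rat.
apply: contraT; rewrite negb_or !negbK => /andP[/eqP e1 /eqP e2].
have : (map_poly iota (s * P + t * Q)).[c] = 1 by rewrite e rmorph1 hornerC.
rewrite rmorphD !rmorphM /= hornerD !hornerM e1 e2 !mulr0 addr0 => /esym/eqP.
by rewrite oner_eq0.
Qed.

Lemma point_scale_neq0 b : point_scale b != 0.
Proof.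
have hd : (PL`_d != 0) || (QL`_d != 0) by rewrite !coef_map !fmorph_eq0 rat_lead.
case: b => [c|] /=; case: ifP => [/eqP e|->] //.
  by have := PQ_neq0 c; rewrite e eqxx orbF.
by move: hd; rewrite e eqxx orbF.
Qed.

(** The local height of (x : y) before normalization is the opposite of the
    smaller of w x and w y. *)
Lemma quot_height (w : valuation L) x y : (x != 0) || (y != 0) ->
  vge w (- (point_height w (if y == 0 then None else Some (x / y))
            - w (if y == 0 then x else y))) x /\
  vge w (- (point_height w (if y == 0 then None else Some (x / y))
            - w (if y == 0 then x else y))) y.
Proof.
move=> xy; case: (eqVneq y 0) xy => [->|y0] xy /=.
  by rewrite sub0r opprK vge0 vge_val.
split; last by rewrite vgeE //; have := local_height_ge0 w (x / y); lra.
have -> : x = (x / y) * y by rewrite divfK.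
have := vgeM (vge_local_height w (x / y)) (vge_val w y).
by rewrite divfK // opprB addrC.
Qed.
End Map.

(** The map f multiplies local heights by d up to a bounded error, and up to the
    term point_scale.  The upper bound used here for the height of b comes from
    [bezout_bound], applied to P and Q where b is integral and to their reversals
    elsewhere.  The error is the height of finitely many elements cs of F, hence
    it vanishes at almost all places, and cs does not depend on L or w. *)
Lemma height_step : exists cs : seq F, forall (L : fieldType) (iota : {rmorphism F -> L})
    (w : valuation L) (b : option L),
  d%:R * point_height w b <=
  point_height w (ratmap iota f b) - w (point_scale iota b) + height_sum iota w cs.
Proof.
have /Bezout_eq1_coprimepP[[s t] /= e] := coprimep_rat.
have cr := coprimep_rev_poly coprimep_rat size_ratnum size_ratden rat_lead.
have /Bezout_eq1_coprimepP[[s' t'] /= e'] := cr.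
exists ((s ++ t) ++ (s' ++ t')) => L iota w b.
rewrite !height_sum_cat; set C1 := height_sum iota w s + _; set C2 := height_sum iota w s' + _.
have C10 : 0 <= C1 by rewrite addr_ge0 ?height_sum_ge0.
have C20 : 0 <= C2 by rewrite addr_ge0 ?height_sum_ge0.
set PL := map_poly iota P; set QL := map_poly iota Q.
case: b => [c|].
  have [] := quot_height w (PQ_neq0 iota c).
  have -> : ratmap iota f (Some c) = if QL.[c] == 0 then None else Some (PL.[c] / QL.[c]) by [].
  have -> : point_scale iota (Some c) = if QL.[c] == 0 then PL.[c] else QL.[c] by [].
  set nu := (_ - _) => h1 h2.
  have [hc|] := boolP (vge w 0 c).
    by rewrite /= (local_height_int hc) mulr0; have := bezout_bound e hc h1 h2; rewrite -/C1; lra.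
  rewrite /vge negb_or -ltNge => /andP[c0 wc].
  rewrite [point_height _ (Some c)]/= local_height_neg //.
  have hz : vge w 0 c^-1 by rewrite vgeE ?invr_eq0 // valuationV //; lra.
  have hrev (R : {poly F}) : (size R <= d.+1)%N -> vge w (- nu) (map_poly iota R).[c] ->
      vge w (- nu - d%:R * w c) (map_poly iota (rev_poly d R)).[c^-1].
    move=> sR hR; rewrite map_rev_poly horner_rev_poly ?size_map_poly //.
    by apply: vgeM => //; rewrite vgeE ?invr_eq0 ?expf_neq0 // valuationV ?expf_neq0 // valuationX.
  have := bezout_bound e' hz (hrev _ size_ratnum h1) (hrev _ size_ratden h2).
  by rewrite -/C2; lra.
have h0 : (PL`_d != 0) || (QL`_d != 0) by rewrite !coef_map !fmorph_eq0 rat_lead.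
have [] := quot_height w h0.
have -> : ratmap iota f None = if QL`_d == 0 then None else Some (PL`_d / QL`_d) by [].
have -> : point_scale iota None = if QL`_d == 0 then PL`_d else QL`_d by [].
set nu := (_ - _) => h1 h2.
have r0 (R : {poly F}) : (map_poly iota (rev_poly d R)).[0] = (map_poly iota R)`_d.
  by rewrite horner_coef0 !coef_map coef_rev_poly subn0.
have := @bezout_bound _ _ iota w _ _ _ _ 0 (- nu) e' (vge0 _ _).
by rewrite !r0 => /(_ h1 h2); rewrite -/C2 /= mulr0; lra.
Qed.

(** Where y is not integral the Wronskian is read at 1/y, through
    [horner_wronskian_rev]. *)
Lemma wronskian_lower : exists cs : seq F, forall (L : fieldType) (iota : {rmorphism F -> L})
    (w : valuation L) (y : L), (map_poly iota (wronskian P Q)).[y] != 0 ->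
  - (d.-1).*2%:R * local_height w y - height_sum iota w cs <=
    w (map_poly iota (wronskian P Q)).[y].
Proof.
exists (wronskian P Q ++ wronskian (rev_poly d P) (rev_poly d Q)) => L iota w y W0.
rewrite height_sum_cat; set C1 := height_sum _ _ _; set C2 := height_sum _ _ _.
have C10 : 0 <= C1 by rewrite height_sum_ge0.
have C20 : 0 <= C2 by rewrite height_sum_ge0.
have [hy|] := boolP (vge w 0 y).
  have := vge_horner_map iota (wronskian P Q) hy; rewrite vgeE // -/C1.
  by rewrite (local_height_int hy); lra.
rewrite /vge negb_or -ltNge => /andP[y0 wy]; rewrite local_height_neg //.
have hz : vge w 0 y^-1 by rewrite vgeE ?invr_eq0 // valuationV //; lra.
have := vge_horner_map iota (wronskian (rev_poly d P) (rev_poly d Q)) hz.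
move: W0; rewrite !map_wronskian !map_rev_poly.
rewrite (horner_wronskian_rev _ _ d0 y0) ?size_map_poly ?size_ratnum ?size_ratden //.
rewrite mulf_eq0 negb_or oppr_eq0 => /andP[yn W0]; rewrite vgeE // -/C2.
by rewrite valuationM ?oppr_eq0 // valuationN valuationX //; lra.
Qed.

End Dynamics.

(** * Orbit points outside the maximal unramified extension *)

Section Gain.
Variables (F L : fieldType) (iota : {rmorphism F -> L}) (w : valuation L).
Variables (p : F) (p0 : p != 0) (wp : 0 < w (iota p)).
Hypothesis pmin : forall c, c != 0 -> 0 < w (iota c) -> w (iota p) <= w (iota c).
Variables (T : set L) (Tu : unramified iota w T).
Hypothesis maxT : forall T', unramified iota w T' -> T `<=` T' -> T' = T.

Let Tdiv : divring_closed (mem T). Proof. by case: Tu. Qed.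
Let Tr : subring_closed (mem T). Proof. exact: divring_subring. Qed.
Let TV x : T x -> T x^-1.
Proof.
by move=> Tx; case/divring_closedE: Tdiv => T1 _ h; rewrite -[x^-1]mul1r; apply: h.
Qed.
Let A := [set x | T x /\ vge w 0 x].
Let Ar : subring_closed (mem A).
Proof.
apply/subring_closedE; split.
- by split; [apply: sring1|rewrite vgeE ?oner_neq0 // valuation1].
- by move=> a b [Ta wa] [Tb wb]; split; [apply: sringB|apply: vgeB].
- by move=> a b [Ta wa] [Tb wb]; split; [apply: sringM|apply: vgeM0].
Qed.

Lemma small_coefM (a b : {poly L}) :
  (forall i, small w a`_i) -> (forall i, vge w 0 b`_i) -> forall i, small w (a * b)`_i.
Proof.
move=> ha hb i; rewrite coefM; elim/big_ind: _ => [|x z|j _]; first exact: small0.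
  exact: smallD.
by rewrite mulrC; apply: smallM.
Qed.

Lemma small_coef_deriv (a : {poly L}) :
  (forall i, small w a`_i) -> forall i, small w a^`()`_i.
Proof.
move=> ha i; rewrite coef_deriv -mulr_natl; apply: smallM => //; exact: vge_nat.
Qed.

(** The polynomial g = P - bQ has y as a root, and g'Q - gQ' is the Wronskian of
    P and Q; in particular g is not small since the Wronskian is not.  As T does
    not contain y, [etale_mem] makes g'(y) small, and [value_gap] applies. *)
Lemma wronskian_gap_int n (P Q : {poly L}) b y :
  coef_in A P -> coef_in A Q -> (size P <= n.+1)%N -> (size Q <= n.+1)%N ->
  A b -> vge w 0 y -> ~ T y -> P.[y] = b * Q.[y] ->
  (exists i, ~~ small w (wronskian P Q)`_i) ->
  vge w (w (iota p) / n%:R) (wronskian P Q).[y].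
Proof.
move=> PA QA sP sQ Ab wy nTy e hprim.
pose g := P - b *: Q.
have gA : coef_in A g by apply: (coef_inB Ar) => //; apply: (coef_inZ Ar).
have gy : g.[y] = 0 by rewrite hornerD hornerN hornerZ e subrr.
have sg : (size g <= n.+1)%N.
  apply: leq_trans (size_polyD _ _) _; rewrite size_polyN geq_max sP /=.
  exact: leq_trans (size_scale_leq _ _) sQ.
have wrE : wronskian P Q = g^`() * Q - g * Q^`().
  rewrite /wronskian /g derivB derivZ -!mul_polyC; ring.
have Qv : coef_in (vge w 0) Q by move=> i; case: (QA i).
have Q'v i : vge w 0 Q^`()`_i by case: (coef_in_deriv Ar QA i).
have gprim : exists i, ~~ small w g`_i.
  apply: contrapT => hno; case: hprim => i /negP; apply.
  have gs j : small w g`_j by apply: contrapT => /negP nk; apply: hno; exists j.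
  rewrite wrE coefB; apply: smallB; apply: small_coefM => //.
  exact: small_coef_deriv.
have wQy : vge w 0 Q.[y] by apply: vge_horner.
have wg : vge w (w (iota p) / n%:R) g^`().[y].
  apply: (value_gap wp pmin Tu wy gA gy sg gprim); first exact: (coef_in_deriv Ar).
  apply: contrapT => /negP ns; apply: nTy.
  exact: (etale_mem p0 wp pmin Tu wy gA gy ns maxT).
rewrite wrE hornerD hornerN !hornerM gy mul0r subr0; exact: vgeM0.
Qed.

(** If b is not integral, exchange P and Q, which replaces b by 1/b. *)
Lemma wronskian_gap n (P Q : {poly L}) b y :
  coef_in A P -> coef_in A Q -> (size P <= n.+1)%N -> (size Q <= n.+1)%N ->
  T b -> vge w 0 y -> ~ T y -> P.[y] = b * Q.[y] ->
  (exists i, ~~ small w (wronskian P Q)`_i) ->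
  vge w (w (iota p) / n%:R) (wronskian P Q).[y].
Proof.
move=> PA QA sP sQ Tb wy nTy e hprim.
have [wb|] := boolP (vge w 0 b); first by apply: (wronskian_gap_int _ _ _ _ _ _ _ e).
rewrite /vge negb_or -ltNge => /andP[b0 wb].
have eV : Q.[y] = b^-1 * P.[y] by rewrite e mulKf.
have wr : wronskian P Q = - wronskian Q P by apply: wronskianC.
rewrite wr hornerN; apply: vgeN; apply: (wronskian_gap_int _ _ _ _ _ _ _ eV) => //.
  split; first exact: TV.
  by rewrite vgeE ?invr_eq0 // valuationV //; lra.
by case: hprim => i; rewrite wr coefN => hi; exists i; apply: contra hi => /smallN.
Qed.

Variable f : {fraction {poly F}}.
Let d := ratdeg f.
Let P := map_poly iota (ratnum f).
Let Q := map_poly iota (ratden f).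
Hypothesis d0 : (0 < d)%N.

(** A point outside T with image in T is close to the critical points of f for
    w.  If y is not integral, [wronskian_gap] applies to 1/y. *)
Lemma wronskian_gain b y :
  (forall i, vge w 0 P`_i) -> (forall i, vge w 0 Q`_i) ->
  (exists i, ~~ small w (wronskian P Q)`_i) ->
  (exists i, ~~ small w (wronskian (rev_poly d P) (rev_poly d Q))`_i) ->
  (wronskian P Q).[y] != 0 ->
  T b -> ~ T y -> P.[y] = b * Q.[y] ->
  w (iota p) / d%:R - (d.-1).*2%:R * local_height w y <= w (wronskian P Q).[y].
Proof.
move=> hP hQ prim1 prim2 W0 Tb nTy e.
have TF c : T (iota c) by case: Tu => _ h _; apply: h; exists c.
have PA : coef_in A P by move=> i; split=> //; rewrite coef_map; apply: TF.
have QA : coef_in A Q by move=> i; split=> //; rewrite coef_map; apply: TF.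
have sP : (size P <= d.+1)%N by rewrite size_map_poly size_ratnum.
have sQ : (size Q <= d.+1)%N by rewrite size_map_poly size_ratden.
have [wy|] := boolP (vge w 0 y).
  have := wronskian_gap PA QA sP sQ Tb wy nTy e prim1.
  by rewrite vgeE // (local_height_int wy); lra.
rewrite /vge negb_or -ltNge => /andP[y0 wy]; rewrite local_height_neg //.
have hz : vge w 0 y^-1 by rewrite vgeE ?invr_eq0 // valuationV //; lra.
have nTz : ~ T y^-1 by move=> /TV; rewrite invrK.
have ez : (rev_poly d P).[y^-1] = b * (rev_poly d Q).[y^-1].
  by rewrite !horner_rev_poly // e mulrA.
have revA R : coef_in A R -> coef_in A (rev_poly d R).
  by move=> hR i; rewrite coef_rev_poly; case: ifP => // _; apply: sring0.
have := wronskian_gap (revA _ PA) (revA _ QA) (size_rev_poly _ _) (size_rev_poly _ _) Tb hz nTz ez prim2.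
move: W0; rewrite (horner_wronskian_rev sP sQ d0 y0) mulf_eq0 negb_or oppr_eq0 => /andP[yn W0].
rewrite vgeE // => h.
by rewrite valuationM ?oppr_eq0 // valuationN valuationX //; lra.
Qed.
End Gain.

(** * The places of k(t) *)

Section Fractions.
Variable R : idomainType.
Local Notation "x %:F" := (@FracField.tofrac R x).

Lemma frac_numden (z : {fraction R}) :
  z = (\n_(generic_quotient.repr z))%:F / (\d_(generic_quotient.repr z))%:F.
Proof.
set r := generic_quotient.repr z.
have d0 : (\d_r)%:F != 0 by rewrite tofrac_eq0 denom_ratioP.
apply: (mulIf d0); rewrite divfK //.
rewrite -[z]generic_quotient.reprK -/r.
unlock FracField.tofrac; rewrite -[LHS]FracField.pi_mul.
apply/eqP; rewrite FracField.equivf_def /FracField.mulf.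
by rewrite !numden_Ratio ?mulf_neq0 ?oner_neq0 ?denom_ratioP //; apply/eqP; ring.
Qed.

Lemma frac_exists (z : {fraction R}) : z != 0 ->
  exists a b, [/\ a != 0, b != 0 & z = a%:F / b%:F].
Proof.
move=> z0; exists (\n_(generic_quotient.repr z)), (\d_(generic_quotient.repr z)).
split; rewrite ?denom_ratioP //; last exact: frac_numden.
by apply: contraNneq z0 => e; rewrite (frac_numden z) e rmorph0 mul0r.
Qed.

Variable phi : R -> rat.
Hypothesis phiM : forall a b, a != 0 -> b != 0 -> phi (a * b) = phi a + phi b.
Hypothesis phiD : forall a b, a != 0 -> b != 0 -> a + b != 0 ->
  Num.min (phi a) (phi b) <= phi (a + b).

Lemma frac_valuation : exists v : valuation {fraction R},
  forall a, a != 0 -> v a%:F = phi a.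
Proof.
pose v (z : {fraction R}) :=
  phi (\n_(generic_quotient.repr z)) - phi (\d_(generic_quotient.repr z)).
have vE a b : a != 0 -> b != 0 -> v (a%:F / b%:F) = phi a - phi b.
  move=> a0 b0; rewrite /v; set r := generic_quotient.repr _.
  have d0 : \d_r != 0 by rewrite denom_ratioP.
  have e : a%:F / b%:F = (\n_r)%:F / (\d_r)%:F by rewrite {1}[LHS]frac_numden.
  have n0 : \n_r != 0.
    apply: contraTneq isT => n0; have := e; rewrite n0 rmorph0 mul0r => /eqP.
    by rewrite mulf_eq0 invr_eq0 !tofrac_eq0 (negbTE a0) (negbTE b0).
  have /eqP : a%:F * (\d_r)%:F = (\n_r)%:F * b%:F.
    have := congr1 (fun x => x * (b%:F * (\d_r)%:F)) e => /=.
    have b0' : b%:F != 0 by rewrite tofrac_eq0.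
    have d0' : (\d_r)%:F != 0 by rewrite tofrac_eq0.
    by rewrite mulrA divfK // => ->; rewrite [b%:F * _]mulrC mulrA divfK.
  rewrite -!rmorphM tofrac_eq => /eqP /(congr1 phi); rewrite !phiM //; lra.
have vM x y : x != 0 -> y != 0 -> v (x * y) = v x + v y.
  move=> /frac_exists[a [b [a0 b0 ->]]] /frac_exists[c [d [c0 d0 ->]]].
  rewrite mulf_div -!rmorphM !vE ?mulf_neq0 // !phiM //; lra.
have vD x y : x != 0 -> y != 0 -> x + y != 0 -> Num.min (v x) (v y) <= v (x + y).
  move=> /frac_exists[a [b [a0 b0 ->]]] /frac_exists[c [d [c0 d0 ->]]].
  rewrite addf_div ?tofrac_eq0 // -!rmorphM -rmorphD => h.
  have s0 : a * d + c * b != 0.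
    by apply: contraNneq h => ->; rewrite rmorph0 mul0r.
  rewrite !vE ?mulf_neq0 // [phi (b * d)]phiM //.
  have := phiD (mulf_neq0 a0 d0) (mulf_neq0 c0 b0) s0.
  by rewrite !ge_min !phiM // => /orP[h1|h1]; apply/orP; [left|right]; lra.
have phi1 : phi 1 = 0.
  by have := phiM (oner_neq0 R) (oner_neq0 R); rewrite mulr1; lra.
exists (Valuation vM vD) => a a0 /=.
by rewrite -[a%:F]divr1 -(rmorph1 (@FracField.tofrac R)) vE ?oner_neq0 // phi1 subr0.
Qed.
End Fractions.

Section PolyFactor.
Variable k : fieldType.
Implicit Types a b q : {poly k}.

Lemma monic_irreducible_factor a : (1 < size a)%N ->
  exists q, [/\ q \is monic, irreducible_poly q & q %| a].
Proof.
have [n] := ubnP (size a); elim: n a => // n IH a; rewrite ltnS => sa a1.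
have [irr|nirr] := pselect (irreducible_poly a).
  have a0 : a != 0 by rewrite -size_poly_gt0 ltnW.
  have l0 : (lead_coef a)^-1 != 0 by rewrite invr_eq0 lead_coef_eq0.
  have eq : (lead_coef a)^-1 *: a %= a by rewrite eqp_scale.
  exists ((lead_coef a)^-1 *: a); split.
  - by rewrite monicE lead_coefZ mulVf // lead_coef_eq0.
  - split; first by rewrite size_scale.
    by case: irr => _ h r sr; rewrite (eqp_dvdr _ eq) => /(h r sr) h1; apply: eqp_trans h1 _; rewrite eqp_sym.
  - by rewrite (eqp_dvdl _ eq).
have [q [sq qa nq]] : exists q, [/\ size q != 1, q %| a & ~~ (q %= a)].
  apply: contrapT => hno; apply: nirr; split=> // q sq qa.
  by apply: contrapT => /negP nq; apply: hno; exists q.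
have a0 : a != 0 by rewrite -size_poly_gt0 ltnW.
have q0 : q != 0 by apply: contraTneq qa => ->; rewrite dvd0p.
have lt : (size q < size a)%N.
  by rewrite ltn_neqAle dvdp_leq // andbT dvdp_size_eqp.
have q1 : (1 < size q)%N by rewrite ltn_neqAle eq_sym sq size_poly_gt0.
have [r [h1 h2 h3]] := IH q (leq_trans lt sa) q1.
by exists r; split=> //; apply: dvdp_trans qa.
Qed.

Lemma size_irreducible q : irreducible_poly q -> (1 < size q)%N.
Proof. by case. Qed.

Lemma irreducible_ndvdM q a b : irreducible_poly q ->
  ~~ (q %| a) -> ~~ (q %| b) -> ~~ (q %| a * b).
Proof.
by move=> iq qa qb; rewrite Gauss_dvdpr // irreducible_poly_coprime.
Qed.

Lemma irreducible_mult q a : irreducible_poly q -> a != 0 ->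
  exists m b, a = q ^+ m * b /\ ~~ (q %| b).
Proof.
move=> iq; have [n] := ubnP (size a); elim: n a => // n IH a; rewrite ltnS => sa a0.
have [/dvdpP[b e]|nq] := boolP (q %| a); last by exists 0%N, a; rewrite mul1r.
have b0 : b != 0 by apply: contraNneq a0 => b0; rewrite e b0 mul0r.
have q0 : q != 0 by rewrite -size_poly_gt0 ltnW // size_irreducible.
have lt : (size b < size a)%N.
  have := size_irreducible iq; have := b0; rewrite e size_mul // -size_poly_gt0.
  by move: (size b) (size q) => x y; lia.
have [m [c [ec nc]]] := IH b (leq_trans lt sa) b0.
by exists m.+1, c; split=> //; rewrite e ec exprS; ring.
Qed.

Lemma irreducible_mult_uniq q m n b c : irreducible_poly q ->
  ~~ (q %| b) -> ~~ (q %| c) -> q ^+ m * b = q ^+ n * c -> m = n.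
Proof.
move=> iq; wlog mn : m n b c / (m <= n)%N => [H qb qc e|].
  by have [h|/ltnW h] := leqP m n; [apply: H e | apply/esym/(H n m c b)].
move=> qb qc; have q0 : q != 0 by rewrite -size_poly_gt0 ltnW // size_irreducible.
rewrite -{1}(subnKC mn) exprD -mulrA => /mulfI h.
have {}h : b = q ^+ (n - m) * c by apply: h; rewrite expf_neq0.
case E: (n - m)%N h => [|l] h; first by apply/eqP; rewrite eqn_leq mn -subn_eq0 E.
by move: qb; rewrite h exprS -mulrA dvdp_mulr.
Qed.

Local Notation "x %:F" := (@FracField.tofrac {poly k} x).

Lemma finite_place q : irreducible_poly q -> exists v : valuation {fraction {poly k}},
  forall m b, ~~ (q %| b) -> v (q ^+ m * b)%:F = m%:R.
Proof.
move=> iq.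
have /boolp.choice[phi hphi] : forall a, exists x : rat, forall m b,
    ~~ (q %| b) -> a = q ^+ m * b -> x = m%:R.
  move=> a; have [->|a0] := eqVneq a 0.
    exists 0 => m b qb e; exfalso; move/eqP: e; rewrite eq_sym mulf_eq0 expf_eq0.
    have /negbTE-> : q != 0 by rewrite -size_poly_gt0 ltnW // size_irreducible.
    by rewrite andbF /= => /eqP b0; rewrite b0 dvdp0 in qb.
  have [m [b [e qb]]] := irreducible_mult iq a0.
  by exists m%:R => n c qc e'; congr (_%:R); apply: (irreducible_mult_uniq iq qb qc); rewrite -e.
have phiM a b : a != 0 -> b != 0 -> phi (a * b) = phi a + phi b.
  move=> a0 b0; have [m [c [ea qc]]] := irreducible_mult iq a0.
  have [n [d [eb qd]]] := irreducible_mult iq b0.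
  rewrite (hphi a _ _ qc ea) (hphi b _ _ qd eb) -natrD.
  apply: (hphi _ _ (c * d)); first exact: irreducible_ndvdM.
  by rewrite ea eb exprD; ring.
have phiD a b : a != 0 -> b != 0 -> a + b != 0 ->
    Num.min (phi a) (phi b) <= phi (a + b).
  move=> a0 b0 s0; have [m [c [ea qc]]] := irreducible_mult iq a0.
  have [n [d [eb qd]]] := irreducible_mult iq b0.
  have [l [e [es qe]]] := irreducible_mult iq s0.
  rewrite (hphi a _ _ qc ea) (hphi b _ _ qd eb) (hphi _ _ _ qe es).
  rewrite ge_min !ler_nat; apply: contraT; rewrite negb_or -!ltnNge => /andP[h1 h2].
  have : q ^+ l.+1 %| q ^+ l * e.
    rewrite -es; apply: dvdp_add.
      by rewrite ea -(subnKC h1) exprD -mulrA dvdp_mulr.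
    by rewrite eb -(subnKC h2) exprD -mulrA dvdp_mulr.
  have q0 : q != 0 by rewrite -size_poly_gt0 ltnW // size_irreducible.
  by rewrite exprSr dvdp_mul2l ?expf_neq0 // (negbTE qe).
have [v hv] := frac_valuation phiM phiD.
exists v => m b qb.
have q0 : q != 0 by rewrite -size_poly_gt0 ltnW // size_irreducible.
have b0 : b != 0 by apply: contraNneq qb => ->; rewrite dvdp0.
by rewrite hv ?mulf_neq0 ?expf_neq0 //; apply: hphi qb _.
Qed.

Lemma infinite_place : exists v : valuation {fraction {poly k}},
  forall a, a != 0 -> v a%:F = - (size a).-1%:R.
Proof.
apply: frac_valuation => a b a0 b0.
  have := a0; have := b0; rewrite size_mul // -!size_poly_gt0.
  move: (size a) (size b) => [//|m] [//|n] _ _.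
  by rewrite addnS /= natrD opprD.
move=> s0; rewrite ge_min !lerN2 !ler_nat -leq_max.
have := size_polyD a b; have := s0; rewrite -size_poly_gt0.
by move: (size a) (size b) (size _) => x y z; lia.
Qed.
End PolyFactor.

Section RationalPlaces.
Variable k : finFieldType.
Local Notation A := {poly k}.

(** A place of k(t) is a monic irreducible polynomial, or None for the place at
    infinity. *)
Definition is_rplace (u : option A) : Prop :=
  if u is Some q then q \is monic /\ irreducible_poly q else True.

Definition rplace_deg (u : option A) : nat := if u is Some q then (size q).-1 else 1.

(** The field K is any field of fractions of k[t], with tf : k[t] -> K. *)
Definition rplace_spec (K : fieldType) (tf : A -> K) (v : option A -> valuation K) : Prop :=
  (forall q, is_rplace (Some q) ->
     forall m b, ~~ (q %| b) -> v (Some q) (tf (q ^+ m * b)) = m%:R) /\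
  (forall a, a != 0 -> v None (tf a) = - (size a).-1%:R).

Lemma rplaces_exist : exists v, rplace_spec (@FracField.tofrac {poly k}) v.
Proof.
have [vi hvi] := infinite_place k.
have /boolp.choice[v hv] : forall u : option A, exists v : valuation {fraction A},
    if u is Some q then is_rplace (Some q) ->
       forall m b, ~~ (q %| b) -> v (@FracField.tofrac {poly k} (q ^+ m * b)) = m%:R
    else forall a, a != 0 -> v (@FracField.tofrac {poly k} a) = - (size a).-1%:R.
  case=> [q|]; last by exists vi.
  have [[_ iq]|nq] := pselect (is_rplace (Some q)); last by exists vi.
  by have [v h] := finite_place iq; exists v.
by exists v; split; [move=> q; apply: (hv (Some q)) | apply: (hv None)].
Qed.

Variables (K : fieldType) (tf : {rmorphism A -> K}).
Hypothesis tf_inj : injective tf.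
Hypothesis frac_exists : forall z : K, z != 0 ->
  exists a b, [/\ a != 0, b != 0 & z = tf a / tf b].
Local Notation "x %:F" := (tf x).

Let tofrac_eq0 a : (tf a == 0) = (a == 0).
Proof. by rewrite -(inj_eq tf_inj) rmorph0. Qed.

Variables (v : option A -> valuation K) (hv : rplace_spec tf v).

Let vfin q : is_rplace (Some q) -> forall m b, ~~ (q %| b) ->
  v (Some q) (q ^+ m * b)%:F = m%:R.
Proof. by case: hv => h _; apply: h. Qed.
Let vinf a : a != 0 -> v None a%:F = - (size a).-1%:R.
Proof. by case: hv => _; apply. Qed.

Lemma rplace_nat q a : is_rplace (Some q) -> a != 0 -> exists m : nat, v (Some q) a%:F = m%:R.
Proof.
move=> hq a0; have [m [b [e qb]]] := irreducible_mult (proj2 hq) a0.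
by exists m; rewrite e vfin.
Qed.

Lemma rplace_int u z : is_rplace u -> z != 0 -> exists m : int, v u z = m%:~R.
Proof.
move=> hu /frac_exists[a [b [a0 b0 ->]]].
rewrite valuation_div ?tofrac_eq0 //; case: u hu => [q|] hq.
  have [m ->] := rplace_nat hq a0; have [n ->] := rplace_nat hq b0.
  by exists (m%:Z - n%:Z); rewrite rmorphB.
rewrite !vinf //; exists ((size b).-1%:Z - (size a).-1%:Z); rewrite rmorphB /=; lra.
Qed.

Lemma irr_nontriv q : is_rplace (Some q) -> ~~ (q %| 1).
Proof. by case=> _ [h _]; rewrite dvdp1 gtn_eqF. Qed.

Lemma rplace_pi q : is_rplace (Some q) -> v (Some q) q%:F = 1.
Proof. by move=> hq; have := vfin hq 1 (irr_nontriv hq); rewrite expr1 mulr1. Qed.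

Lemma rplace_ndvd q a : is_rplace (Some q) -> ~~ (q %| a) -> v (Some q) a%:F = 0.
Proof. by move=> hq qa; have := vfin hq 0 qa; rewrite expr0 mul1r. Qed.

Lemma rplace_nontrivial u : is_rplace u -> nontrivial (v u).
Proof.
case: u => [q|] hu.
  exists q%:F; last by rewrite rplace_pi.
  by rewrite tofrac_eq0 -size_poly_gt0 ltnW // size_irreducible //; case: hu.
exists ('X%:F)^-1; first by rewrite invr_eq0 tofrac_eq0 polyX_eq0.
by rewrite valuationV ?tofrac_eq0 ?polyX_eq0 // vinf ?polyX_eq0 // size_polyX opprK.
Qed.

Definition irr_list B : seq A :=
  [seq q <- [seq rVpoly x | x : 'rV[k]_B] | `[< is_rplace (Some q) >]].
Definition rplace_list B : seq (option A) := None :: map Some (irr_list B).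

Lemma irr_listP B (q : A) : reflect ((size q <= B)%N /\ is_rplace (Some q)) (q \in irr_list B).
Proof.
rewrite mem_filter; apply: (iffP andP) => [[/asboolP hq /mapP[x _ e]]|[sq hq]].
  by split=> //; rewrite e; apply: size_poly.
split; first exact/asboolP.
by apply/mapP; exists (poly_rV q); rewrite ?mem_enum // poly_rV_K.
Qed.

Lemma irr_list_uniq B : uniq (irr_list B).
Proof. by rewrite filter_uniq // map_inj_uniq ?enum_uniq //; apply: can_inj rVpolyK. Qed.

Lemma rplace_listP B u : u \in rplace_list B -> is_rplace u.
Proof. by rewrite inE => /predU1P[->//|/mapP[q /irr_listP[_ h] ->]]. Qed.

Lemma mem_rplace_list B u : is_rplace u -> (rplace_deg u < B)%N -> u \in rplace_list B.
Proof.
case: u => [q|] hu sq; last by rewrite inE eqxx.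
rewrite inE /=; apply/mapP; exists q => //; apply/irr_listP; split=> //.
by move: sq; rewrite /=; case: (size q).
Qed.

Let deg_sum B (a : A) : rat := \sum_(q <- irr_list B) (size q).-1%:R * v (Some q) a%:F.

(** Unique factorization, by induction on the degree: splitting off a monic
    irreducible factor q of a changes only the term of q, by the degree of q. *)
Let deg_sumP B (a : A) : a != 0 -> deg_sum B a <= (size a).-1%:R /\
  ((size a <= B)%N -> deg_sum B a = (size a).-1%:R).
Proof.
have [n] := ubnP (size a); elim: n a => // n IH a; rewrite ltnS => sa a0.
have [a1|a1] := leqP (size a) 1.
  have -> : deg_sum B a = 0.
    rewrite /deg_sum big_seq big1 // => q /irr_listP[_ hq].
    rewrite rplace_ndvd ?mulr0 //; apply/negP => /(dvdp_leq a0).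
    by rewrite leqNgt (leq_ltn_trans a1) // size_irreducible //; case: hq.
  have -> : (size a).-1 = 0%N by apply/eqP; rewrite -leqn0 -subn1 leq_subLR addn0.
  by [].
have [q [mq iq /dvdpP[b e]]] := monic_irreducible_factor a1.
have b0 : b != 0 by apply: contraNneq a0 => b0; rewrite e b0 mul0r.
have q0 : q != 0 by rewrite -size_poly_gt0 ltnW // size_irreducible.
have sq := size_irreducible iq.
have sab : (size a).-1 = ((size q).-1 + (size b).-1)%N.
  have := b0; rewrite e size_mul // -size_poly_gt0; move: sq.
  by move: (size b) (size q) => x y; lia.
have lt : (size b < size a)%N.
  by move: sab a1 sq; have := b0; rewrite -size_poly_gt0; move: (size a) (size b) (size q) => x y z; lia.
have [h1 h2] := IH b (leq_trans lt sa) b0.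
have eB : deg_sum B a = (if q \in irr_list B then (size q).-1%:R else 0) + deg_sum B b.
  rewrite /deg_sum.
  have -> : \sum_(r <- irr_list B) (size r).-1%:R * v (Some r) a%:F =
     \sum_(r <- irr_list B) ((if r == q then (size q).-1%:R else 0) + (size r).-1%:R * v (Some r) b%:F).
    rewrite big_seq [RHS]big_seq; apply: eq_bigr => r /irr_listP[_ hr].
    rewrite e rmorphM valuationM ?tofrac_eq0 // addrC mulrDr; congr (_ + _).
    case: eqP => [->|/eqP rq]; first by rewrite rplace_pi ?mulr1.
    rewrite rplace_ndvd ?mulr0 //; apply/negP => rdq.
    have [_ /(_ r)h] := iq.
    have : r %= q by apply: h => //; rewrite gtn_eqF // size_irreducible //; case: hr.
    by rewrite eqp_monic ?(negbTE rq) //; case: hr.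
  rewrite big_split /= -big_mkcond /=; congr (_ + _).
  have := irr_list_uniq B; case: ifP => qB uB; last first.
    by rewrite big_seq_cond big1 // => r /andP[hr /eqP rq]; rewrite -rq hr in qB.
  by rewrite -big_filter filter_pred1_uniq // big_seq1.
have sq0 : (0 : rat) <= (size q).-1%:R by rewrite ler0n.
rewrite eB sab natrD; split; first by case: ifP => _; lra.
move=> aB; rewrite h2 ?(leq_trans (ltnW lt)) //.
have -> // : q \in irr_list B.
apply/irr_listP; split; last by split.
by apply: leq_trans aB; apply: dvdp_leq a0 _; rewrite e dvdp_mull.
Qed.

Lemma rplace_product z : z != 0 -> exists B0, forall B, (B0 <= B)%N ->
  \sum_(u <- rplace_list B) (rplace_deg u)%:R * v u z = 0.
Proof.
move=> /frac_exists[a [b [a0 b0 ->]]]; exists (maxn (size a) (size b)) => B.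
rewrite geq_max => /andP[sa sb]; rewrite big_cons big_map /= mul1r.
rewrite valuation_div ?tofrac_eq0 // !vinf //.
have [_ /(_ sa) ea] := deg_sumP B a0; have [_ /(_ sb) eb] := deg_sumP B b0.
under eq_bigr do rewrite valuation_div ?tofrac_eq0 // mulrBr.
rewrite sumrB; move: ea eb; rewrite /deg_sum => -> ->; lra.
Qed.

(** The poles of a / b, with multiplicities, are zeros of b, or lie at
    infinity. *)
Lemma rplace_height z : z != 0 -> exists H : rat, forall B,
  \sum_(u <- rplace_list B) (rplace_deg u)%:R * local_height (v u) z <= H.
Proof.
move=> /frac_exists[a [b [a0 b0 ->]]]; exists ((size a).-1%:R + (size b).-1%:R) => B.
have na : (0 : rat) <= (size a).-1%:R by rewrite ler0n.
have nb : (0 : rat) <= (size b).-1%:R by rewrite ler0n.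
rewrite big_cons big_map /= mul1r; apply: lerD.
  apply: local_height_le => //; rewrite vgeE ?mulf_neq0 ?invr_eq0 ?tofrac_eq0 //.
  by rewrite valuation_div ?tofrac_eq0 // !vinf //; lra.
have [h _] := deg_sumP B b0; apply: le_trans h.
rewrite /deg_sum big_seq [leRHS]big_seq; apply: ler_sum => q /irr_listP[_ hq].
apply: ler_wpM2l; first by rewrite ler0n.
have [m hm] := rplace_nat hq a0; have [n hn] := rplace_nat hq b0.
apply: local_height_le; first by rewrite hn ler0n.
rewrite vgeE ?mulf_neq0 ?invr_eq0 ?tofrac_eq0 // valuation_div ?tofrac_eq0 //.
by rewrite hm lerDr ler0n.
Qed.

(** The constants are roots of unity or 0, hence belong to R.  If t is in R, then
    so is k[t], and the polynomials that are not units of R are the multiples of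
    some irreducible q; otherwise 1/t is a nonunit and every polynomial of
    degree n is a unit times t^n.  In both cases K is generated by units of R
    and by one nonunit c, whose powers decide membership in R. *)
Lemma rplace_classification (R : set K) :
  valuation_ring setT R -> R <> setT ->
  exists2 u, is_rplace u & forall z, z != 0 -> R z <-> 0 <= v u z.
Proof.
move=> [Rr _ Rtot] RT.
have Rtot' x : R x \/ R x^-1 by apply: Rtot.
have R1 := sring1 Rr.
have cV (c : k) : (c^-1%:P)%:F = ((c%:P)%:F)^-1.
  exact: (fmorphV (tf \o polyC)).
have Rc (c : k) : R (c%:P)%:F.
  have [|h] := Rtot' (c%:P)%:F; first by [].
  have [->|c0] := eqVneq c 0; first by rewrite !rmorph0; apply: sring0.
  have e : c ^+ #|k| = c by exact: expf_card.
  have gt : (1 < #|k|)%N by apply: finNzRing_gt1.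
  have e2 : c = (c^-1) ^+ (#|k| - 2) * 1.
    rewrite mulr1; apply: (mulfI (expf_neq0 (#|k| - 1) c0)).
    rewrite -exprSr exprVn -(subnKC gt) /= addnC addnK.
    rewrite addn2 subn1 /= [in RHS]exprSr -mulrA mulrCA mulfV ?expf_neq0 // mulr1.
    by rewrite -addn2 addnC subnKC.
  rewrite e2 mulr1 !rmorphXn; apply: sringX => //=.
  by rewrite cV.
have Rchar (u : option A) : is_rplace u ->
  (forall z, z != 0 -> exists (e c : K) (m n : nat),
    [/\ e != 0, R e, R e^-1, v u z = m%:R - n%:R & z = e * c ^+ m / c ^+ n /\ [/\ c != 0, R c & ~ R c^-1]]) ->
  forall z, z != 0 -> R z <-> 0 <= v u z.
  move=> hu h z z0; have [e [c [m [n [e0 Re Re' -> [-> [c0 R_c nRc]]]]]]] := h z z0.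
  rewrite subr_ge0 ler_nat; have [nm|mn] := leqP n m; split=> //.
    by move=> _; rewrite -mulrA -expfB_cond ?(negbTE c0) ?add0n //;
       apply: sringM => //; apply: sringX.
  move=> Rz; exfalso; apply: nRc.
  have -> : c^-1 = e^-1 * (e * c ^+ m / c ^+ n) * c ^+ (n - m.+1).
    rewrite mulrA mulrA mulVf // mul1r -{1}(subnKC mn) exprD exprS.
    have cm : c ^+ m != 0 by rewrite expf_neq0.
    have cn : c ^+ (n - m.+1) != 0 by rewrite expf_neq0.
    by field; rewrite cm cn c0.
  by apply: sringM => //; [apply: sringM|apply: sringX].
have X0 : 'X%:F != 0 :> K by rewrite tofrac_eq0 polyX_eq0.
have [RX|nRX] := pselect (R 'X%:F).
  have Rp (a : A) : R a%:F.
    rewrite -[a]coefK poly_def rmorph_sum; apply: sring_sum => // i _.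
    by rewrite -mul_polyC rmorphM rmorphXn; apply: sringM => //; apply: sringX.
  have [a a0 nRa] : exists2 a : A, a != 0 & ~ R (a%:F)^-1.
    apply: contrapT => hno; apply: RT; apply/seteqP; split=> // z _.
    have [->|/frac_exists[a [b [a0 b0 ->]]]] := eqVneq z 0; first exact: sring0.
    apply: sringM => //; apply: contrapT => nb; apply: hno; by exists b.
  have [q hq nRq] : exists2 q, is_rplace (Some q) & ~ R (q%:F)^-1.
    move: a0 nRa; have [n] := ubnP (size a); elim: n a => // n IH a; rewrite ltnS => sa a0 nRa.
    have [a1|a1] := leqP (size a) 1.
      case: nRa; rewrite (size1_polyC a1); set c := a`_0.
      have c0 : c != 0 by apply: contraNneq a0 => c0; rewrite (size1_polyC a1) -/c c0.
      by rewrite -cV; apply: Rc.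
    have [q [mq iq /dvdpP[b e]]] := monic_irreducible_factor a1.
    have [Rq|nRq] := pselect (R (q%:F)^-1); last by exists q.
    have b0 : b != 0 by apply: contraNneq a0 => b0; rewrite e b0 mul0r.
    have q0 : q != 0 by rewrite -size_poly_gt0 ltnW // size_irreducible.
    apply: (IH b) => //.
      apply: leq_trans sa; have := size_irreducible iq; have := b0.
      by rewrite e size_mul // -size_poly_gt0; move: (size b) (size q) => x y; lia.
    by move=> Rb; apply: nRa; rewrite e rmorphM invfM; apply: sringM.
  have q0 : q != 0 by rewrite -size_poly_gt0 ltnW // size_irreducible //; case: hq.
  have qF0 : q%:F != 0 by rewrite tofrac_eq0.
  have Runit b : ~~ (q %| b) -> R (b%:F)^-1.
    move=> qb; have b0 : b != 0 by apply: contraNneq qb => ->; rewrite dvdp0.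
    have bF0 : b%:F != 0 by rewrite tofrac_eq0.
    have : coprimep q b by rewrite irreducible_poly_coprime //; case: hq.
    move=> /Bezout_eq1_coprimepP[[s t] /= /(congr1 tf)].
    rewrite rmorphD !rmorphM rmorph1 => e.
    have [h|h] := Rtot' (q%:F / b%:F).
      have -> : (b%:F)^-1 = s%:F * (q%:F / b%:F) + t%:F.
        by rewrite mulrA -[X in _ + X](mulfK bF0) -mulrDl e mul1r.
      by apply: sringD => //; apply: sringM.
    case: nRq; have -> : (q%:F)^-1 = s%:F + t%:F * (b%:F / q%:F).
      by rewrite mulrA -[X in X + _](mulfK qF0) -mulrDl e mul1r.
    by apply: sringD => //; apply: sringM => //; rewrite -invf_div.
  exists (Some q) => //; apply: Rchar => // z /frac_exists[a' [b' [a0' b0' ->]]].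
  have [m [a1 [ea qa1]]] := irreducible_mult (proj2 hq) a0'.
  have [n [b1 [eb qb1]]] := irreducible_mult (proj2 hq) b0'.
  have a1F : a1%:F != 0 by rewrite tofrac_eq0; apply: contraNneq qa1 => ->; rewrite dvdp0.
  have b1F : b1%:F != 0 by rewrite tofrac_eq0; apply: contraNneq qb1 => ->; rewrite dvdp0.
  exists (a1%:F / b1%:F), q%:F, m, n; split.
  - by rewrite mulf_neq0 ?invr_eq0.
  - by apply: sringM => //; apply: Runit.
  - by rewrite invf_div; apply: sringM => //; apply: Runit.
  - by rewrite valuation_div ?tofrac_eq0 // ea eb !vfin.
  - split=> //; rewrite ea eb !rmorphM !rmorphXn; field.
    by rewrite b1F expf_neq0.
have RY : R ('X%:F)^-1 by have [] := Rtot' 'X%:F.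
set Y := ('X%:F)^-1 in RY.
have Y0 : Y != 0 by rewrite invr_eq0.
have nRY : ~ R Y^-1 by rewrite invrK.
exists None => //; apply: Rchar => // z /frac_exists[a [b [a0 b0 ->]]].
have unit (c : A) : c != 0 -> exists e, [/\ e != 0, R e, R e^-1 & c%:F = e / Y ^+ (size c).-1].
  move=> c0; exists (c%:F * Y ^+ (size c).-1).
  have Yn : Y ^+ (size c).-1 != 0 by rewrite expf_neq0.
  set e := _ * _.
  have e0 : e != 0 by rewrite mulf_neq0 // tofrac_eq0.
  have sc : (0 < size c)%N by rewrite size_poly_gt0.
  pose s := \sum_(i < (size c).-1) ((c`_i)%:P)%:F * Y ^+ ((size c).-1 - i.+1).
  have Rs : R s by apply: sring_sum => // i _; apply: sringM => //; apply: sringX.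
  have ee : e = ((lead_coef c)%:P)%:F + Y * s.
    have cE : c = \sum_(i < (size c).-1.+1) c`_i *: 'X^i by apply: polyE_wide; rewrite prednK.
    rewrite /e {1}cE big_ord_recr /= rmorphD mulrDl addrC; congr (_ + _).
      rewrite -mul_polyC rmorphM rmorphXn -mulrA -exprMn divff // expr1n mulr1.
      by rewrite lead_coefE.
    rewrite rmorph_sum mulr_suml mulr_sumr; apply: eq_bigr => i _.
    rewrite -mul_polyC rmorphM rmorphXn -mulrA [RHS]mulrCA; congr (_ * _).
    have -> : Y ^+ (size c).-1 = Y ^+ i * Y ^+ ((size c).-1 - i).
      by rewrite -exprD subnKC // ltnW.
    rewrite -exprS subnSK // mulrA -exprMn divff //.
    by rewrite expr1n mul1r.
  have Re : R e by rewrite ee; apply: sringD => //; apply: sringM.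
  have lc0 : ((lead_coef c)%:P)%:F != 0 by rewrite tofrac_eq0 polyC_eq0 lead_coef_eq0.
  have Rlc : R (((lead_coef c)%:P)%:F)^-1 by rewrite -cV; apply: Rc.
  split=> //; last by rewrite mulfK.
  have [h|h] := Rtot' (Y / e).
    have -> : e^-1 = (((lead_coef c)%:P)%:F)^-1 * (1 - s * (Y / e)).
      apply: (mulfI lc0); rewrite mulrA divff // mul1r.
      apply: (mulIf e0); rewrite divfK // mulrBl mul1r -mulrA divfK //.
      by rewrite ee; ring.
    by apply: sringM => //; apply: sringB => //; apply: sringM.
  case: nRY; have -> : Y^-1 = (((lead_coef c)%:P)%:F)^-1 * (e / Y - s).
    apply: (mulfI lc0); rewrite mulrA divff // mul1r.
    by apply: (mulIf Y0); rewrite mulrBl divfK // divfK // ee; ring.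
  by apply: sringM => //; apply: sringB => //; rewrite -invf_div.
have [e [e0 Re Re' ea]] := unit a a0; have [e' [e0' Re1 Re1' eb]] := unit b b0.
exists (e / e'), Y, (size b).-1, (size a).-1; split.
- by rewrite mulf_neq0 ?invr_eq0.
- exact: sringM.
- by rewrite invf_div; apply: sringM.
- by rewrite valuation_div ?tofrac_eq0 // !vinf //; lra.
- split=> //; rewrite ea eb; field.
  by rewrite e0' !expf_neq0.
Qed.

End RationalPlaces.

(** * Finite extensions: normal closures and primes above a place *)

Lemma splits_in_ext (F : fieldType) (p : {poly F}) : p != 0 ->
  exists (E : fieldExtType F) (zs : seq E),
    map_poly (in_alg E) p %= \prod_(z <- zs) ('X - z%:P).
Proof.
have [n] := ubnP (size p); elim: n F p => // n IH F p; rewrite ltnS => sp p0.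
have [p1|p1] := leqP (size p) 1.
  exists F^o, [::]; rewrite big_nil -size_poly_eq1 size_map_poly.
  by rewrite eqn_leq p1 size_poly_gt0.
have [q [_ iq qp]] := monic_irreducible_factor p1.
have [K _ [x qx _]] := irredp_FAdjoin iq.
have px : root (map_poly (in_alg K) p) x.
  by apply: root_dvdp qx; rewrite dvdp_map.
have [r er] := factor_theorem _ _ px.
have r0 : r != 0.
  by apply: contraNneq p0 => r0; rewrite -(map_poly_eq0 (in_alg K)) er r0 mul0r.
have sr : (size r < n)%N.
  have := congr1 (fun P : {poly K} => size P) er.
  rewrite size_map_poly size_mul ?polyXsubC_eq0 // size_XsubC addn2 /= => e.
  by rewrite -e.
have [E [zs hzs]] := IH K r sr r0.
exists (baseFieldType E), ((in_alg E x : baseFieldType E) :: zs).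
rewrite big_cons.
have -> : map_poly (in_alg (baseFieldType E)) p = map_poly (in_alg E) (map_poly (in_alg K) p).
  rewrite -map_poly_comp; apply: eq_map_poly => a /=.
  exact: (baseField_scaleE a (1 : E)).
rewrite er rmorphM /= rmorphB /= map_polyX map_polyC mulrC.
exact: eqp_mull.
Qed.

(** Over F, split the product p of the minimal polynomials over k of a basis of
    F, and keep the field generated over k by the roots of p: it contains the
    basis, hence F. *)
Lemma normal_envelope (k : fieldType) (F : fieldExtType k) :
  exists (E : splittingFieldType k) (phi : {rmorphism F -> E}),
    forall c : k, phi c%:A = c%:A.
Proof.
pose bs := vbasis {:F}.
pose p := \prod_(b <- bs) minPoly 1%AS b.
have pOver : p \is a polyOver 1%VS.
  by apply: rpred_prod => b _; apply: minPolyOver.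
have p0 : p != 0.
  by rewrite prodf_seq_neq0; apply/allP => b _; rewrite monic_neq0 // monic_minPoly.
have /polyOver1P[pk epk] := pOver.
have [E1 [zs hzs]] := splits_in_ext p0.
pose E2 : fieldExtType k := baseFieldType E1.
pose V : {subfield E2} := <<1 & (zs : seq E2)>>%AS.
have algE (a : F) : in_alg E1 a = a%:A by [].
pose al (x : F) : E2 := in_alg E1 x.
have hpk : map_poly (in_alg E2) pk %= \prod_(z <- (zs : seq E2)) ('X - z%:P).
  have -> : map_poly (in_alg E2) pk = map_poly (in_alg E1) p; last exact: hzs.
  rewrite epk -map_poly_comp; apply: eq_map_poly => a /=.
  exact: (baseField_scaleE a (1 : E1)).
have alZ (c : k) (x : F) : al (c *: x) = c *: al x.
  rewrite /al (baseField_scaleE c (in_alg E1 x)) /=.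
  by rewrite -[c *: x]mulr_algl -scalerA.

have alV (x : F) : al x \in V.
  rewrite (coord_vbasis (memvf x)).
  have -> : al (\sum_(i < \dim {:F}) coord (vbasis {:F}) i x *: (vbasis {:F})`_i) =
      \sum_(i < \dim {:F}) al (coord (vbasis {:F}) i x *: (vbasis {:F})`_i).
    by rewrite /al rmorph_sum.
  apply: rpred_sum => i _; rewrite alZ.
  apply: rpredZ; apply: seqv_sub_adjoin.
  rewrite -(root_prod_XsubC (zs : seq E2)) -(eqp_root hzs) /al mapf_root.
  have bi : bs`_i \in (bs : seq F) by apply: mem_nth; rewrite size_tuple.
  rewrite /p (big_rem _ bi) /= rootM root_minPoly //.
pose E0 : fieldExtType k := subvs_of V.
have split0 : SplittingField.axiom E0.
  pose zs0 : seq E0 := map (vsproj V) (zs : seq E2).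
  have ezs : map (vsval : E0 -> E2) zs0 = zs.
    rewrite -map_comp map_id_in // => z hz /=; rewrite vsprojK //.
    exact: seqv_sub_adjoin.
  exists (map_poly (in_alg E0) pk); first by apply/polyOver1P; exists pk.
  exists zs0.
    have : map_poly (vsval : E0 -> E2) (map_poly (in_alg E0) pk) %=
      map_poly (vsval : E0 -> E2) (\prod_(z <- zs0) ('X - z%:P)).
      have -> : map_poly (vsval : E0 -> E2) (map_poly (in_alg E0) pk) = map_poly (in_alg E2) pk.
        rewrite -map_poly_comp; apply: eq_map_poly => a /=.
        by rewrite (algid1 V).
      have -> // : map_poly (vsval : E0 -> E2) (\prod_(z <- zs0) ('X - z%:P)) = \prod_(z <- (zs : seq E2)) ('X - z%:P).
      rewrite rmorph_prod -[in RHS]ezs big_map; apply: eq_bigr => z _.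
      by rewrite rmorphB /= map_polyX map_polyC.
    by rewrite eqp_map.
  pose toE2 := linfun (vsval : E0 -> E2).
  have ezs2 : map toE2 zs0 = zs by rewrite -[RHS]ezs; apply: eq_map => u; rewrite lfunE.
  apply/vspaceP => u; rewrite memvf.
  have : val u \in (toE2 @: <<1 & zs0>>)%VS.
    by rewrite aimg_adjoin_seq aimg1 ezs2 (valP u).
  by case/memv_imgP => u' hu' /=; rewrite lfunE => /val_inj ->.
pose E : splittingFieldType k := HB.pack E0 (FieldExt_isSplittingField.Build k E0 split0).
pose phi (x : F) : E := vsproj V (al x).
have phiK x : vsval (phi x) = al x by rewrite vsprojK.
have phiA : zmod_morphism phi.
  by move=> x y; apply: val_inj; rewrite /= !phiK /al rmorphB.
have phiM : monoid_morphism phi.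
  split; first by apply: val_inj; rewrite /= phiK (algid1 V) /al rmorph1.
  by move=> x y; apply: val_inj; rewrite /= !phiK /al rmorphM.
pose phiR : {rmorphism F -> E} := HB.pack phi
  (GRing.isZmodMorphism.Build F E phi phiA) (GRing.isMonoidMorphism.Build F E phi phiM).
exists E, phiR => c; apply: val_inj => /=.
by rewrite phiK alZ (algid1 V) /al rmorph1.
Qed.

Lemma prod_XsubC_const (K : fieldType) (c : K) (rs : seq K) :
  (forall b, b \in rs -> b = c) ->
  \prod_(b <- rs) ('X - b%:P) = ('X - c%:P) ^+ size rs.
Proof.
elim: rs => [|b rs IH] allc; first by rewrite big_nil.
rewrite big_cons exprS (allc b) ?inE ?eqxx // IH // => b' hb'.
by apply: allc; rewrite inE hb' orbT.
Qed.

Lemma XsubC_pow_coef0 (K : fieldType) (c : K) n :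
  c ^+ n = (-1) ^+ n * (('X - c%:P) ^+ n)`_0.
Proof.
rewrite -horner_coef0 horner_exp hornerXsubC sub0r (exprNn c).
by rewrite mulrA -exprMn mulrNN mulr1 expr1n mul1r.
Qed.

Lemma monic_size1 (K : fieldType) (P : {poly K}) :
  P \is monic -> size P = 1 -> P = 1.
Proof.
move=> /monicP; rewrite lead_coefE => + sP; rewrite sP /= => P0.
by rewrite (@size1_polyC _ P) ?sP // P0.
Qed.

(** All the conjugates of c are equal to c, so its minimal polynomial over k is
    a power of 'X - c; look at its constant term.  The power m accounts for
    inseparability. *)
Lemma fixed_power (k : fieldType) (E : splittingFieldType k) (c : E) :
  (forall x, x \in ('Gal({:E} / 1))%g -> x c = c) ->
  exists m c0, (0 < m)%N /\ c ^+ m = c0%:A.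
Proof.
move=> fixc; have [rs /eqP ers] := splitting_field_normal 1%AS c.
have allc b : b \in rs -> b = c.
  move=> hb; have rb : root (minPoly 1%AS c) b by rewrite ers root_prod_XsubC.
  have [x hx <-] := normalField_root_minPoly (sub1v _) (normalFieldf 1%AS) (memvf c) rb.
  exact: fixc.
have e : minPoly 1%AS c = ('X - c%:P) ^+ size rs.
  by rewrite ers; apply: prod_XsubC_const.
have m0 : (0 < size rs)%N.
  by have := size_minPoly 1%AS c; rewrite e; case: (rs) => //=; rewrite expr0 size_poly1.
have /polyOverP/(_ 0%N) := minPolyOver 1%AS c.
rewrite e => h; have : c ^+ size rs \in 1%VS.
  rewrite XsubC_pow_coef0.
  by rewrite -[1%VS]/(asval 1%AS) rpredM // rpredX // rpredN rpred1.
by case/vlineP => c0 hc0; exists (size rs), c0.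
Qed.

Lemma fieldExt_root (k : fieldType) (F : fieldExtType k) (x : F) :
  exists P : {poly k}, [/\ P \is monic, (size P <= (\dim {:F}).+1)%N &
    root (map_poly (in_alg F) P) x].
Proof.
have /polyOver1P[P eP] := minPolyOver 1%AS x; exists P; split.
- by rewrite -(map_monic (in_alg F)) -eP monic_minPoly.
- rewrite -(size_map_poly (in_alg F)) -eP size_minPoly ltnS adjoin_degreeE dimv1 divn1.
  exact: dimvS (subvf _).
- by rewrite -eP root_minPoly.
Qed.

Lemma fieldExt_algebraic (k : fieldType) (F : fieldExtType k) :
  algebraic_over (in_alg F).
Proof.
by move=> x; have [P [mP _ rP]] := fieldExt_root x; exists P; rewrite ?monic_neq0.
Qed.

(** If x has negative value, then so large a power of x can be cancelled only by
    a term whose coefficient has value at most that of x. *)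
Lemma root_height_le (F L : fieldType) (iota : {rmorphism F -> L}) (w : valuation L)
    (P : {poly F}) (x : L) : P \is monic -> root (map_poly iota P) x ->
  local_height w x <= height_sum iota w P.
Proof.
move=> mP /eqP Px; set C := height_sum _ _ _.
have C0 : 0 <= C := height_sum_ge0 _ _ _.
have [hx|] := boolP (vge w 0 x); first by rewrite local_height_int.
rewrite /vge negb_or -ltNge => /andP[x0 wx]; rewrite local_height_neg //.
have s0 : (0 < size P)%N by rewrite size_poly_gt0 monic_neq0.
have n0 : (0 < (size P).-1)%N.
  rewrite lt0n; apply/eqP => n0; move: Px.
  rewrite (monic_size1 mP); last by rewrite -(prednK s0) n0.
  by rewrite rmorph1 hornerC => /eqP; rewrite oner_eq0.
have e : x ^+ (size P).-1 = - \sum_(i < (size P).-1) (map_poly iota P)`_i * x ^+ i.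
  move/eqP: Px; rewrite (@horner_coef_wide _ (size P).-1.+1); last by rewrite size_map_poly prednK.
  rewrite big_ord_recr /= addrC addr_eq0 coef_map /= -lead_coefE (monicP mP) rmorph1 mul1r.
  by move/eqP.
have : vge w (- C + ((size P).-1.-1)%:R * w x) (x ^+ (size P).-1).
  rewrite e; apply: vgeN; apply: vge_sum => i _; apply: vgeM; first exact: vge_coef.
  rewrite vgeE ?expf_neq0 // valuationX // ler_nM2r // ler_nat.
  by rewrite -ltnS prednK.
rewrite vgeE ?expf_neq0 // valuationX // -{2}(prednK n0) -addn1 natrD; lra.
Qed.

(** A group is not a finite union of kernels of nonzero maps to the rationals:
    if z works for all i but one, for which x works, then so does z^N x for N
    large. *)
Lemma separating_element (K : fieldType) (I : finType) (phi : I -> K -> rat) :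
  (forall i x y, x != 0 -> y != 0 -> phi i (x * y) = phi i x + phi i y) ->
  (forall i, exists2 x, x != 0 & phi i x != 0) ->
  exists2 z, z != 0 & forall i, phi i z != 0.
Proof.
move=> phiM phi0.
have phiX i x n : x != 0 -> phi i (x ^+ n) = n%:R * phi i x.
  move=> x0; elim: n => [|n IH].
    have := phiM i 1 1 (oner_neq0 _) (oner_neq0 _); rewrite expr0 mulr1 mul0r; lra.
  by rewrite exprS phiM ?expf_neq0 // IH -addn1 natrD; ring.
suff [z z0 hz] : exists2 z, z != 0 & forall i, i \in enum I -> phi i z != 0.
  by exists z => // i; apply: hz; rewrite mem_enum.
elim: (enum I) => [|a s [z z0 hz]]; first by exists 1; rewrite ?oner_neq0.
have [az|az] := eqVneq (phi a z) 0; last first.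
  by exists z => // i; rewrite inE => /predU1P[->|/hz].
have [x x0 ax] := phi0 a.
have [N hN] : exists N : nat, forall i, i \in s -> `|phi i x| < N%:R * `|phi i z|.
  elim: s hz => [|b s IH] hz; first by exists 0%N.
  have [|N hN] := IH; first by move=> i hi; apply: hz; rewrite inE hi orbT.
  have b0 : 0 < `|phi b z| by rewrite normr_gt0 hz // inE eqxx.
  have [M hM] := archi_rat (`|phi b x| + `|phi b z|) b0.
  exists (maxn M N) => i; rewrite inE => /predU1P[->|hi].
    apply: (@lt_le_trans _ _ (M%:R * `|phi b z|)); first by lra.
    by rewrite ler_wpM2r // ler_nat leq_maxl.
  apply: lt_le_trans (hN i hi) _.
  by rewrite ler_wpM2r // ler_nat leq_maxr.
exists (z ^+ N * x); first by rewrite mulf_neq0 ?expf_neq0.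
move=> i; rewrite phiM ?expf_neq0 // phiX // inE => /predU1P[->|hi].
  by rewrite az mulr0 add0r.
apply/eqP => e; have := hN i hi.
have -> : phi i x = - (N%:R * phi i z) by lra.
by rewrite normrN normrM normr_nat ltxx.
Qed.

Lemma vring_integral (L : fieldType) (W : set L) (P : {poly L}) x :
  valuation_ring setT W -> P \is monic -> (forall i, W P`_i) -> root P x -> W x.
Proof.
move=> [Wr _ Wtot] mP WP /eqP Px; have [//|WV] := Wtot x I.
have [->|x0] := eqVneq x 0; first exact: sring0.
have s0 : (0 < size P)%N by rewrite size_poly_gt0 monic_neq0.
have n0 : (0 < (size P).-1)%N.
  rewrite lt0n; apply/eqP => n0; move: Px.
  rewrite (monic_size1 mP); last by rewrite -(prednK s0) n0.
  by rewrite hornerC => /eqP; rewrite oner_eq0.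
have e : x ^+ (size P).-1 = - \sum_(i < (size P).-1) P`_i * x ^+ i.
  move/eqP: Px; rewrite (@horner_coef_wide _ (size P).-1.+1); last by rewrite prednK.
  rewrite big_ord_recr /= addrC addr_eq0 -lead_coefE (monicP mP) mul1r.
  by move/eqP.
have -> : x = x ^+ (size P).-1 * x^-1 ^+ (size P).-1.-1.
  by rewrite exprVn -{1}(prednK n0) exprS mulfK // expf_neq0.
rewrite e mulNr mulr_suml; apply: sringN => //; apply: sring_sum => // i _.
rewrite -mulrA; apply: sringM => //.
have le : (i <= (size P).-1.-1)%N by rewrite -ltnS prednK.
have -> : (size P).-1.-1 = (i + ((size P).-1.-1 - i))%N by rewrite subnKC.
rewrite exprD mulrA -exprMn divff // expr1n mul1r; exact: sringX.
Qed.

Section OverPlace.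
Variables (k : fieldType) (F : fieldExtType k) (v : valuation k).

Definition prime_over (O : set F) :=
  valuation_ring setT O /\ forall z, z != 0 -> O z%:A <-> 0 <= v z.

Lemma prime_over_valuation O : prime_over O ->
  exists w : valuation F, (forall c, c != 0 -> w c%:A = v c) /\
    (forall x, x != 0 -> O x <-> 0 <= w x).
Proof.
by move=> [hO Ov]; apply: (extend_valuation_ring (@fieldExt_algebraic k F) hO).
Qed.

Lemma valuation_power (w : valuation F) : (forall c, c != 0 -> w c%:A = v c) ->
  forall x, x != 0 -> exists s c, [/\ (0 < s <= \dim {:F})%N, c != 0 & s%:R * w x = v c].
Proof.
move=> wv x x0; have [P [mP sP rP]] := fieldExt_root x.
have MT : divring_closed (mem (setT : set F)) by apply/divring_closedE.
have [s [c [/andP[s0 sP'] c0 [h1 h2]]]] := algebraic_tie MT (val_ringP w) (@subsetT _ _) I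
  (monic_neq0 mP) rP x0.
exists s, c; split=> //; first by rewrite s0 -ltnS (leq_trans sP').
have c0' : c%:A != 0 :> F by rewrite scaler_eq0 oner_eq0 orbF.
move: h1 h2; rewrite /val_ring /= !vgeE ?mulf_neq0 ?invr_eq0 ?expf_neq0 //.
by rewrite !valuation_div ?expf_neq0 // valuationX // wv //; lra.
Qed.

(** Distinct primes O_i above v have distinct valuations w_i extending v, so some
    z takes distinct values at all of them ([separating_element]).  But z has
    at most n = [F : k] + 1 terms in a fixed equation over k, and w_i(z) is
    determined by the pair of terms that have the same value: there are at most
    n^2 possibilities. *)
Lemma finite_prime_over : finite_set [set O | prime_over O].
Proof.
apply: contrapT => hinf.
pose N := ((\dim {:F}).+1 * (\dim {:F}).+1).+1.
have [B sB cB] := infinite_set_fset N hinf.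
pose O (i : 'I_N) := nth set0 (finmap.enum_fset B) i.
have OB i : O i \in finmap.enum_fset B.
  by apply: mem_nth; exact: leq_trans (ltn_ord i) cB.
have hO i : prime_over (O i) by apply: sB; exact: OB.
have /boolp.choice[w hw] : forall i, exists w : valuation F, (forall c, c != 0 -> w c%:A = v c) /\
    (forall x, x != 0 -> O i x <-> 0 <= w x).
  by move=> i; apply: prime_over_valuation.
have Oneq i j : i != j -> O i <> O j.
  move=> ij e; move/negP: ij; apply; apply/eqP/val_inj/eqP.
  have sz (l : 'I_N) : (l < size (finmap.enum_fset B))%N.
    by exact: leq_trans (ltn_ord l) cB.
  by rewrite -(nth_uniq set0 (sz i) (sz j) (finmap.fset_uniq B)); apply/eqP.
have [||z z0 hz] := @separating_element F {ij : 'I_N * 'I_N | ij.1 != ij.2}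
  (fun ij x => w (val ij).1 x - w (val ij).2 x).
- by move=> ij x y x0 y0; rewrite !valuationM //; ring.
- move=> [[i j] /= ij]; apply: contrapT => hno; apply: (Oneq i j ij).
  have [_ hi] := hw i; have [_ hj] := hw j.
  have [[Ri _ _] _] := hO i; have [[Rj _ _] _] := hO j.
  have e x : x != 0 -> w i x = w j x.
    move=> x0; apply: contrapT => ne; apply: hno; exists x => //.
    by rewrite subr_eq0; apply/eqP.
  apply/seteqP; split=> x; have [->|x0] := eqVneq x 0; try by move=> _; apply: sring0.
    by move/(hi x x0); rewrite e // => h; apply/(hj x x0).
  by move/(hj x x0); rewrite -e // => h; apply/(hi x x0).
have [P [mP sP /eqP rP]] := fieldExt_root z.
pose D := (\dim {:F}).+1.
have /boolp.choice[g hg] : forall i : 'I_N, exists ab : 'I_D * 'I_D,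
    ab.1 != ab.2 /\ v P`_ab.1 + ab.1%:R * w i z = v P`_ab.2 + ab.2%:R * w i z.
  move=> i; have [wv _] := hw i.
  pose t (a : 'I_D) := (P`_a)%:A * z ^+ a : F.
  have t0 : \sum_a t a = 0.
    rewrite -[RHS]rP (@horner_coef_wide _ D) ?size_map_poly //.
    by apply: eq_bigr => a _; rewrite coef_map.
  have tn a : t a != 0 -> P`_a != 0 /\ w i (t a) = v P`_a + a%:R * w i z.
    rewrite mulf_eq0 scaler_eq0 oner_eq0 orbF negb_or => /andP[Pa za]; split=> //.
    by rewrite valuationM // ?scaler_eq0 ?oner_eq0 ?orbF // wv // valuationX.
  have [|a [b [ab /tn[_ ea] /tn[_ eb] e]]] := valuation_tie (w i) t0.
    have lt : ((size P).-1 < D)%N.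
      by rewrite (leq_trans _ sP) // prednK // size_poly_gt0 monic_neq0.
    exists (Ordinal lt); rewrite /t /= -lead_coefE (monicP mP) scale1r mul1r.
    by rewrite expf_neq0.
  by exists (a, b); split=> //=; rewrite -ea -eb.
have ginj : injective g.
  move=> i j e; apply: contrapT => /eqP ij.
  have := hz (exist _ (i, j) ij) => /=; rewrite subr_eq0 => /eqP; apply.
  have [ne h1] := hg i; have [_ h2] := hg j; rewrite -e in h2.
  have ne' : ((g i).1%:R - (g i).2%:R : rat) != 0.
    by rewrite subr_eq0 eqr_nat.
  apply: (mulfI ne'); lra.
have := leq_card g ginj.
by rewrite card_prod !card_ord ltnn.
Qed.
End OverPlace.

(** * The places of a global function field *)

Section PlaceSystem.
Variable F : fieldType.

(** A weighted list of valuations of F, containing v0 with weight D, that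
    satisfies the product formula on the elements zs, and in which the height
    of an element a of F is at most H a.  The list may depend on v0 and zs, but
    H may not. *)
Definition product_formula (H : F -> rat) (D : nat) (v0 : valuation F) (zs : seq F) :=
  exists (n : nat) (m : 'I_n -> nat) (vs : 'I_n -> valuation F),
    [/\ forall i, nontrivial (vs i),
        forall z, z \in zs -> D%:R * v0 z + \sum_i (m i)%:R * vs i z = 0 &
        forall a, D%:R * local_height v0 a + \sum_i (m i)%:R * local_height (vs i) a <= H a].

Definition discrete (M : nat) (v : valuation F) :=
  forall x, x != 0 -> exists m : int, M%:R * v x = m%:~R.


Definition place_system (H : F -> rat) (M : nat) (deg : set F -> nat) :=
  [/\ (0 < M)%N, forall C, finite_set [set O | is_prime O /\ (deg O <= C)%N] &
   forall O, is_prime O -> exists v0 : valuation F,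
     [/\ (0 < deg O)%N, forall x, x != 0 -> O x <-> 0 <= v0 x, discrete M v0,
      nontrivial v0 &
      forall zs : seq F, (forall z, z \in zs -> z != 0) -> product_formula H (deg O) v0 zs]].
End PlaceSystem.

Section GlobalPlaces.
Variables (k0 : finFieldType) (k : fieldType) (tf : {rmorphism {poly k0} -> k}).
Hypothesis tfi : injective tf.
Hypothesis tff : forall z : k, z != 0 ->
  exists a b, [/\ a != 0, b != 0 & z = tf a / tf b].
Variables (rv : option {poly k0} -> valuation k) (hrv : rplace_spec tf rv).
Variable F : fieldExtType k.

(** If O contained k, then it would contain F, by integral closure. *)
Lemma over_place (O : set F) : is_prime O ->
  exists2 u, is_rplace u & prime_over (rv u) O.
Proof.
move=> [hO OT]; have [Or _ Otot] := hO.
pose R : set k := [set z | O z%:A].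
have Rring : valuation_ring setT R.
  split=> //; last by move=> x _; have := Otot x%:A I; rewrite /R /= -(fmorphV (in_alg F)).
  apply/subring_closedE; split; rewrite /R /=.
  - by rewrite scale1r; apply: sring1.
  - by move=> x y hx hy; rewrite scalerBl; apply: sringB.
  - move=> x y hx hy; have -> : (x * y)%:A = x%:A * y%:A :> F by exact: (rmorphM (in_alg F)).
    exact: sringM.
have RT : R <> setT.
  move=> RT; apply: OT; apply/seteqP; split=> // x _.
  have [P [mP _ rP]] := fieldExt_root x.
  apply: (vring_integral hO _ _ rP); first by rewrite map_monic.
  by move=> i; rewrite coef_map; have : R P`_i by rewrite RT.
have [u hu hR] := rplace_classification tfi tff hrv Rring RT.
by exists u.
Qed.

(** For z in F the sum of w_u(x(z)) over the automorphisms x of E over k is the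
    value of a norm, some power of which lies in k ([fixed_power]); so the
    product formula for k gives one for the valuations w_u o x of F.  The
    valuation w_u is arbitrary, except that above the place of O it is chosen to
    extend v0, which thus becomes one of the places (for x = 1).  The integer M
    clears the denominators of the values of v0, by [valuation_power]. *)
Lemma global_places : exists H M deg, @place_system F H M deg.
Proof.
have [E [phi hphi]] := normal_envelope F.
have /boolp.choice[U hU] : forall O : set F, exists u, is_prime O -> is_rplace u /\ prime_over (rv u) O.
  move=> O; have [hO|nO] := pselect (is_prime O); last by exists None.
  by have [u h1 h2] := over_place hO; exists u.
have /boolp.choice[P hP] : forall a : F, exists P : {poly k}, P \is monic /\ root (map_poly (in_alg F) P) a.
  by move=> a; have [P [mP _ rP]] := fieldExt_root a; exists P.
have /boolp.choice[Hk hHk] : forall c : k, exists h : rat, forall B,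
    \sum_(u <- rplace_list k0 B) (rplace_deg u)%:R * local_height (rv u) c <= h.
  move=> c; have [->|c0] := eqVneq c 0; last by have := rplace_height tfi tff hrv c0; exact.
  by exists 0 => B; rewrite big1 // => u _; rewrite /local_height eqxx mulr0.
pose G := ('Gal({:E} / 1%VS))%g.
pose H (a : F) := #|G|%:R * \sum_(c <- P a) Hk c.
exists H, (\dim {:F})`!, (fun O => rplace_deg (U O)); split; first exact: fact_gt0.
  move=> C; apply: (@sub_finite_set _ _ (\bigcup_(u in [set` rplace_list k0 C.+1]) [set O | prime_over (rv u) O])).
    move=> O [pO dO]; have [hu hov] := hU O pO; exists (U O) => //=.
    exact: mem_rplace_list.
  apply: bigcup_finite; first exact: finite_seq.
  by move=> u _; apply: finite_prime_over.
move=> O pO; have [hu hov] := hU O pO; set u0 := U O in hu hov *.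
have [v0 [v0k v0O]] := prime_over_valuation hov.
exists v0.
have u00 : (0 < rplace_deg u0)%N.
  by case: (u0) hu => //= q [_ /size_irreducible]; case: (size q) => // [[]].
have ntk u (v : valuation F) : is_rplace u -> (forall c, c != 0 -> v c%:A = rv u c) -> nontrivial v.
  move=> hu' hv; have [x x0 hx] := rplace_nontrivial tfi hrv hu'.
  by exists x%:A; rewrite ?scaler_eq0 ?oner_eq0 ?orbF ?hv.
split=> //.
- move=> x x0; have [s [c [/andP[s0 sd] c0 e]]] := valuation_power v0k x0.
  have [m hm] := rplace_int tfi tff hrv hu c0.
  have /dvdnP[l ->] : (s %| (\dim {:F})`!)%N by apply: dvdn_fact; rewrite s0.
  by exists (l%:Z * m); rewrite natrM -mulrA e hm rmorphM.
- exact: (ntk u0 v0 hu v0k).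
move=> zs hzs.
have algphi : algebraic_over phi.
  move=> x; have [Q [mQ _ rQ]] := fieldExt_root x.
  exists (map_poly (in_alg F) Q); first by rewrite map_poly_eq0 monic_neq0.
  rewrite -map_poly_comp; congr (root _ _): rQ; apply: eq_map_poly => c /=.
  by rewrite hphi.
have nt0 : nontrivial v0 by exact: (ntk u0 v0 hu v0k).
have /boolp.choice[w hw] : forall u, exists w : valuation E, is_rplace u ->
    (forall c, c != 0 -> w c%:A = rv u c) /\
    (u = u0 -> forall x, x != 0 -> w (phi x) = v0 x).
  move=> u; have [->|nu] := eqVneq u u0.
    have [w wF] := extend_valuation_field algphi nt0.
    exists w => _; split=> // c c0; rewrite -hphi wF ?v0k //.
    by rewrite scaler_eq0 oner_eq0 orbF.
  have [hu'|nhu] := pselect (is_rplace u); last first.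
    by exists (trivial_valuation E).
  have [w wk] := extend_valuation_field (@fieldExt_algebraic k E) (rplace_nontrivial tfi hrv hu').
  by exists w => _; split=> // e; rewrite e eqxx in nu.
have Mx (z : F) : z != 0 -> exists B0, forall B, (B0 <= B)%N ->
    \sum_(u <- rplace_list k0 B) \sum_(x in G) (rplace_deg u)%:R * w u (x (phi z)) = 0.
  move=> z0; pose N := galNorm 1%VS {:E} (phi z).
  have pz0 : phi z != 0 by rewrite fmorph_eq0.
  have N0 : N != 0 by rewrite galNorm_eq0.
  have [x hx|m [c [m0 hc]]] := @fixed_power k E N.
    by have /mem_fixedFieldP[_] := galNorm_fixedField 1%AS (memvf (phi z)); apply.
  have c0 : c != 0.
    have := expf_neq0 m N0; rewrite hc; apply: contraNneq => ->.
    by rewrite scale0r.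
  have [B0 hB0] := rplace_product tfi tff hrv c0.
  exists B0 => B hB; apply: (mulfI (_ : (m%:R : rat) != 0)); first by rewrite pnatr_eq0 -lt0n.
  rewrite mulr0 -[RHS](hB0 B hB) mulr_sumr big_seq [RHS]big_seq; apply: eq_bigr => u hu'.
  have [wk _] := hw u (rplace_listP hu').
  rewrite -mulr_sumr -valuation_prod; last by move=> x _; rewrite fmorph_eq0.
  have -> : \prod_(x in G) x (phi z) = N by [].
  by rewrite mulrCA; congr (_ * _); rewrite -valuationX // hc wk.
have [B [hBu hB]] : exists B, (rplace_deg u0 < B)%N /\ forall z, z \in zs ->
    \sum_(u <- rplace_list k0 B) \sum_(x in G) (rplace_deg u)%:R * w u (x (phi z)) = 0.
  have [B0 hB0] : exists B0, forall B, (B0 <= B)%N -> forall z, z \in zs ->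
    \sum_(u <- rplace_list k0 B) \sum_(x in G) (rplace_deg u)%:R * w u (x (phi z)) = 0.
    elim: zs hzs => [|z zs IH] hzs; first by exists 0%N.
    have [B1 h1] := Mx z (hzs z (mem_head _ _)).
    have [|B2 h2] := IH; first by move=> y hy; apply: hzs; rewrite inE hy orbT.
    exists (maxn B1 B2) => B; rewrite geq_max => /andP[b1 b2] y.
    by rewrite inE => /predU1P[->|]; [apply: h1 | apply: h2].
  exists (maxn B0 (rplace_deg u0).+1); rewrite leq_maxr; split=> //.
  by apply: hB0; rewrite leq_maxl.
pose idx := [seq (u, x) | u <- rplace_list k0 B, x <- enum G].
have sumE (T : option {poly k0} -> gal_of {:E} -> rat) :
    \sum_(u <- rplace_list k0 B) \sum_(x in G) T u x = \sum_(ux <- idx) T ux.1 ux.2.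
  rewrite big_allpairs_dep /=; apply: eq_bigr => u _.
  by rewrite big_enum.
have idx0 : (u0, 1%g) \in idx.
  by apply: allpairs_f; [apply: mem_rplace_list | rewrite mem_enum group1].
pose idx' := rem (u0, 1%g) idx.
have sumE' (T : option {poly k0} -> gal_of {:E} -> rat) :
    \sum_(u <- rplace_list k0 B) \sum_(x in G) T u x = T u0 1%g + \sum_(i < size idx')
      T (nth (u0, 1%g) idx' i).1 (nth (u0, 1%g) idx' i).2.
  rewrite sumE (perm_big _ (perm_to_rem idx0)) big_cons /=; congr (_ + _).
  by rewrite (big_nth (u0, 1%g)) big_mkord.
pose us i := (nth (u0, 1%g) idx' i).1; pose xs i := (nth (u0, 1%g) idx' i).2.
pose pl (u : option {poly k0}) (x : gal_of {:E}) : valuation F := pull phi (pull x (w u)).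
have plk u x : is_rplace u -> forall c, c != 0 -> pl u x c%:A = rv u c.
  move=> hu' c c0; rewrite /pl /= hphi; have [wk _] := hw u hu'.
  by rewrite -(wk c c0) linearZ rmorph1.
have usP (i : 'I_(size idx')) : is_rplace (us i).
  have : nth (u0, 1%g) idx' i \in idx by apply: mem_rem; apply: mem_nth.
  by rewrite /us => /allpairsP[[u x] [/= hu' _ ->]]; apply: rplace_listP hu'.
have pl0 x : x != 0 -> pl u0 1%g x = v0 x.
  by move=> x0; rewrite /pl /= gal_id; have [_ /(_ erefl x x0)] := hw u0 hu.
exists (size idx'), (fun i => rplace_deg (us i)), (fun i => pl (us i) (xs i)); split.
- by move=> i; apply: (ntk (us i)) => //; apply: plk.
- by move=> z hz; rewrite -(pl0 z (hzs z hz)); have := hB z hz; rewrite sumE'.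
move=> a; have lh0 : local_height v0 a = local_height (pl u0 1%g) a.
  by rewrite /local_height; case: eqP => // /eqP a0; rewrite pl0.
rewrite lh0 -(sumE' (fun u x => (rplace_deg u)%:R * local_height (pl u x) a)).
have [mP rP] := hP a.
apply: (@le_trans _ _ (\sum_(u <- rplace_list k0 B) \sum_(x in G)
    (rplace_deg u)%:R * \sum_(c <- P a) local_height (rv u) c)).
  rewrite big_seq [leRHS]big_seq; apply: ler_sum => u hu'; apply: ler_sum => x _.
  rewrite ler_wpM2l ?ler0n //.
  apply: le_trans (root_height_le (pl u x) mP rP) _.
  rewrite /height_sum le_eqVlt; apply/orP; left; apply/eqP; apply: eq_bigr => c _.
  rewrite /local_height /= scaler_eq0 oner_eq0 orbF; case: eqP => // /eqP c0.
  by congr (Num.max _ (- _)); apply: plk c0; apply: rplace_listP hu'.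
rewrite exchange_big /= sumr_const -mulr_natl /H ler_wpM2l ?ler0n //.
rewrite (eq_bigr _ (fun u _ => mulr_sumr _ _ _ _)) exchange_big /=.
by apply: ler_sum => c _.
Qed.
End GlobalPlaces.

(** * Abelian points and their conjugates *)

Lemma local_height0_vge (K : fieldType) (w : valuation K) x : local_height w x <= 0 -> vge w 0 x.
Proof.
rewrite /local_height /vge; case: eqP => //= _; rewrite ge_max => /andP[_ h]; lra.
Qed.

Lemma finite_roots (K : fieldType) (P : {poly K}) : P != 0 ->
  exists s : seq K, forall x, root P x -> x \in s.
Proof.
have [n] := ubnP (size P); elim: n P => // n IH P; rewrite ltnS => sP P0.
have [[x rx]|hno] := pselect (exists x, root P x); last first.
  by exists [::] => x rx; case: hno; exists x.
have [q eq_] := factor_theorem P x rx.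
have q0 : q != 0 by apply: contraNneq P0 => q0; rewrite eq_ q0 mul0r.
have sq : (size q < n)%N.
  by apply: leq_trans sP; rewrite eq_ size_mul ?polyXsubC_eq0 // size_XsubC addn2.
have [s hs] := IH q sq q0.
exists (x :: s) => y; rewrite eq_ rootM root_XsubC inE => /orP[/hs->|/eqP->].
  by rewrite orbT.
by rewrite eqxx.
Qed.

Section Points.
Variables (F E L : fieldType) (iE : {rmorphism F -> E}) (psi : {rmorphism E -> L})
  (iota : {rmorphism F -> L}).
Hypothesis psiE : forall a, psi (iE a) = iota a.
Variable f : {fraction {poly F}}.

Lemma map_poly_tower (P : {poly F}) : map_poly psi (map_poly iE P) = map_poly iota P.
Proof. by rewrite -map_poly_comp; apply: eq_map_poly => a /=. Qed.

Lemma horner_tower (P : {poly F}) c : psi (map_poly iE P).[c] = (map_poly iota P).[psi c].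
Proof. by rewrite -horner_map map_poly_tower. Qed.

Lemma coef_tower (P : {poly F}) i : psi (map_poly iE P)`_i = (map_poly iota P)`_i.
Proof. by rewrite -coef_map map_poly_tower. Qed.

Lemma ratmap_tower b : omap psi (ratmap iE f b) = ratmap iota f (omap psi b).
Proof.
have quot (x y : E) (x' y' : L) : psi x = x' -> psi y = y' ->
    omap psi (if y == 0 then None else Some (x / y)) = if y' == 0 then None else Some (x' / y').
  by move=> <- <-; rewrite fmorph_eq0; case: ifP => //= _; rewrite fmorph_div.
case: b => [c|] /=; apply: quot; rewrite ?horner_tower ?coef_tower //.
Qed.

Lemma iter_ratmap_tower n b :
  omap psi (iter n (ratmap iE f) b) = iter n (ratmap iota f) (omap psi b).
Proof. by elim: n => //= n <-; apply: ratmap_tower. Qed.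

Lemma point_scale_tower b :
  psi (point_scale f iE b) = point_scale f iota (omap psi b).
Proof.
have quot (x y : E) (x' y' : L) : psi x = x' -> psi y = y' ->
    psi (if y == 0 then x else y) = if y' == 0 then x' else y'.
  by move=> <- <-; rewrite fmorph_eq0; case: ifP.
case: b => [c|] /=; apply: quot; rewrite ?horner_tower ?coef_tower //.
Qed.
End Points.

Section Conjugates.
Variables (F : fieldType) (E : splittingFieldType F).
Hypotheses (galE : galois 1 {:E}) (abE : abelian 'Gal({:E} / 1)).

(** An automorphism that fixes a also fixes x a, since it commutes with x; now
    use the Galois correspondence. *)
Lemma abelian_conj x (a : E) : x \in ('Gal({:E} / 1%VS))%g -> x a \in <<1%VS; a>>%VS.
Proof.
move=> hx; have gal1 : galois <<1%VS; a>> {:E}.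
  by apply: galoisS galE; rewrite subv_adjoin subvf.
rewrite -(galois_fixedField gal1); apply/fixedFieldP; rewrite ?memvf // => y hy.
have hy1 : y \in ('Gal({:E} / 1%VS))%g by exact: (fintype.subsetP (galS {:E} (subv_adjoin 1%AS a)) _ hy).
have -> : y (x a) = (x * y)%g a by rewrite galM ?memvf.
have -> : (x * y = y * x)%g by apply: (centsP abE).
by rewrite galM ?memvf // (fixed_gal _ hy) ?subvf // memv_adjoin.
Qed.

Lemma abelian_conj_inv x (a : E) : x \in ('Gal({:E} / 1%VS))%g -> a \in <<1%VS; x a>>%VS.
Proof.
move=> hx; have {1}-> : a = (x^-1)%g (x a) by rewrite -galM ?memvf // mulgV gal_id.
by apply: abelian_conj; rewrite groupV.
Qed.

Variables (L : fieldType) (iota : {rmorphism F -> L}) (k : {rmorphism E -> L}).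
Hypothesis kE : forall a : F, k a%:A = iota a.

Lemma adjoin_mem (T : set L) (a b : E) : subring_closed (mem T) -> range iota `<=` T ->
  T (k a) -> b \in <<1%VS; a>>%VS -> T (k b).
Proof.
move=> Tr FT Ta /Fadjoin_polyP[q /polyOver1P[r ->] ->].
rewrite -horner_map; apply: sring_horner => // i.
by rewrite !coef_map /= kE; apply: FT; exists r`_i.
Qed.
End Conjugates.

Section AdjoinTheory.
Variables (F L : fieldType) (iota : {rmorphism F -> L}) (S : set L).
Lemma adjoin_divring : divring_closed (mem (adjoin iota S)).
Proof.
apply/divring_closedE; split.
- by move=> M hM _ _; case/divring_closedE: hM.
- move=> x y hx hy M hM FM SM; have /divring_closedE[_ h _] := hM.
  by apply: h; [apply: hx | apply: hy].
- move=> x y hx hy M hM FM SM; have /divring_closedE[_ _ h] := hM.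
  by apply: h; [apply: hx | apply: hy].
Qed.
Lemma adjoin_range : range iota `<=` adjoin iota S.
Proof. by move=> x hx M _ h _; apply: h. Qed.
End AdjoinTheory.

Section OverValuation.
Variables (F L : fieldType) (iota : {rmorphism F -> L}).
Hypothesis alg : algebraic_over iota.

(** No element of M is gained when W is extended to L: if the value of x is 0,
    then some power of x is a unit of W times an element of F of value 0. *)
Lemma extend_lies_over (M W : set L) (O : set F) (v : valuation F) :
  divring_closed (mem M) -> range iota `<=` M -> lies_over iota M O W ->
  (forall x, x != 0 -> O x <-> 0 <= v x) -> nontrivial v ->
  exists w : valuation L, (forall c, c != 0 -> w (iota c) = v c) /\
    forall x, M x -> vge w 0 x -> W x.
Proof.
move=> hM FM [hW WO] Ov nt; have [Wr WM Wtot] := hW.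
have WF c : c != 0 -> W (iota c) <-> 0 <= v c.
  by move=> c0; rewrite -Ov // -WO.
have [w [wF Ww]] := extend_valuation alg nt Wr WF.
exists w; split=> // x Mx hx.
have [->|x0] := eqVneq x 0; first exact: sring0.
have [//|WV] := Wtot x Mx.
have := Ww _ WV; rewrite /val_ring /= vgeE ?invr_eq0 // valuationV // => wx1.
rewrite vgeE // in hx; have wx : w x = 0 by lra.
have [P P0 Px] := alg x.
have [s [c [/andP[s0 _] c0 [h1 h2]]]] := algebraic_tie hM hW FM Mx P0 Px x0.
have c0' : iota c != 0 by rewrite fmorph_eq0.
have xs0 : x ^+ s != 0 by rewrite expf_neq0.
have := Ww _ h1; have := Ww _ h2; rewrite /val_ring /= !vgeE ?mulf_neq0 ?invr_eq0 //.
rewrite !valuation_div // valuationX // wx mulr0 wF // => g1 g2.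
have Wc : W (iota c) by apply/WF => //; lra.
have Wxs : W (x ^+ s) by rewrite -(divfK c0' (x ^+ s)); apply: sringM.
have -> : x = x ^+ s * x^-1 ^+ s.-1.
  by rewrite -{1}(prednK s0) exprS exprVn mulfK // expf_neq0.
by apply: sringM => //; apply: sringX.
Qed.
End OverValuation.

Section Uniformizer.
Variables (F : fieldType) (M : nat) (v : valuation F).
Hypotheses (M0 : (0 < M)%N) (vM : discrete M v) (nt : nontrivial v).

Lemma uniformizer : exists p, [/\ p != 0, 0 < v p, M%:R^-1 <= v p &
  forall c, c != 0 -> 0 < v c -> v p <= v c].
Proof.
have Mq : (0 : rat) < M%:R by rewrite ltr0n.
have pos x : x != 0 -> 0 < v x -> exists n : nat, (0 < n)%N /\ M%:R * v x = n%:R.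
  move=> x0 vx; have [m hm] := vM x0.
  have : 0 < (m%:~R : rat) by rewrite -hm mulr_gt0.
  rewrite ltr0z; case: m hm => // n hn n0; exists n; split=> //.
pose S (n : nat) := `[< exists x, [/\ x != 0, 0 < v x & M%:R * v x = n%:R] >].
have ex : exists n, S n.
  have [x x0 vx] := nt; have [n [_ hn]] := pos x x0 vx.
  by exists n; apply/asboolP; exists x.
have [n /asboolP[p [p0 vp hn]] nmin] := ex_minnP ex.
exists p; split=> //.
  have [m [m0 hm]] := pos p p0 vp.
  rewrite -[X in X <= _]mul1r ler_pdivrMr // mulrC hm.
  by rewrite -[1]/(1%:R) ler_nat.
move=> c c0 vc; have [m [_ hm]] := pos c c0 vc.
have le : (n <= m)%N by apply: nmin; apply/asboolP; exists c.
by rewrite -(ler_pM2l Mq) hn hm ler_nat.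
Qed.
End Uniformizer.

Section Exceptional.
Variables (F L : fieldType) (iota : {rmorphism F -> L}).

Lemma monic_scale (P : {poly F}) (y : L) : P != 0 -> root (map_poly iota P) y ->
  exists R, [/\ R \is monic, root (map_poly iota R) y & R = (lead_coef P)^-1 *: P].
Proof.
move=> P0 ry; exists ((lead_coef P)^-1 *: P); split=> //.
  by rewrite monicE lead_coefZ mulVf // lead_coef_eq0.
by rewrite map_polyZ /= rootZ // fmorph_eq0 invr_eq0 lead_coef_eq0.
Qed.

Lemma integral_vge (w : valuation L) (P : {poly F}) (x : L) :
  P \is monic -> root (map_poly iota P) x ->
  (forall a, a \in (P : seq F) -> vge w 0 (iota a)) -> vge w 0 x.
Proof.
move=> mP rP hP; apply: local_height0_vge; apply: le_trans (root_height_le w mP rP) _.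
rewrite /height_sum big_seq big1 // => a ha; apply: local_height_int; exact: hP.
Qed.

(** Let R be a monic separable equation of y over F.  If the coefficients of R
    are integral, and so is 1 / R'(y), then [etale_mem] applies to R.  The second
    condition holds as soon as the coefficients of a monic equation of 1 / R'(y)
    are integral. *)
Lemma separable_unramified (y : L) :
  (exists2 P, separable_poly P & root (map_poly iota P) y) ->
  algebraic_over iota ->
  exists s : seq F, forall (w : valuation L) (p : F) (T : set L),
    p != 0 -> 0 < w (iota p) ->
    (forall c, c != 0 -> 0 < w (iota c) -> w (iota p) <= w (iota c)) ->
    unramified iota w T ->
    (forall T', unramified iota w T' -> T `<=` T' -> T' = T) ->
    (forall a, a \in s -> vge w 0 (iota a)) -> T y.
Proof.
move=> [P sepP ry] alg.
have P0 : P != 0 by apply: separable_poly_neq0.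
have [R [mR rR eR]] := monic_scale P0 ry.
have d0 : (map_poly iota R)^`().[y] != 0.
  have sepR : separable_poly R.
    by rewrite eR (eqp_separable (eqp_scale _ _)) // invr_eq0 lead_coef_eq0.
  apply/eqP => e; have := sepR; rewrite -(separable_map iota) unlock => cop.
  have := coprimep_root cop rR; rewrite e eqxx //.
have [Q0 Q00 rQ0] := alg ((map_poly iota R)^`().[y])^-1.
have [Q [mQ rQ _]] := monic_scale Q00 rQ0.
exists ((R : seq F) ++ (Q : seq F)) => w p T p0 wp pmin Tu maxT hs.
have hR a : a \in (R : seq F) -> vge w 0 (iota a) by move=> ha; apply: hs; rewrite mem_cat ha.
have hQ a : a \in (Q : seq F) -> vge w 0 (iota a) by move=> ha; apply: hs; rewrite mem_cat ha orbT.
have wy : vge w 0 y := integral_vge mR rR hR.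
have wd : vge w 0 ((map_poly iota R)^`().[y])^-1 := integral_vge mQ rQ hQ.
apply: (@etale_mem F L iota w p p0 wp pmin T Tu y wy (map_poly iota R)) => //.
- move=> i; rewrite coef_map /=; split; first by case: Tu => _ h _; apply: h; exists R`_i.
  have [lt|ge] := ltnP i (size R); first by apply: hR; apply: mem_nth.
  by rewrite nth_default // rmorph0 vge0.
- exact/eqP.
- rewrite /small negb_or d0 -leNgt /=.
  by move: wd; rewrite vgeE ?invr_eq0 // valuationV //; lra.
Qed.
End Exceptional.

(** * Heights of orbit points, and the bound on the degree of a ramified prime *)

Section PlacesOnL.
Variables (F L : fieldType) (iota : {rmorphism F -> L}).
Hypothesis alg : algebraic_over iota.
Variables (H : F -> rat) (M : nat) (deg : set F -> nat).
Hypothesis sys : place_system H M deg.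

Lemma places_on_L (D : nat) (v0 : valuation F) (w : valuation L) (zs : seq F) :
  (forall c, c != 0 -> w (iota c) = v0 c) -> product_formula H D v0 zs ->
  (forall z, z \in zs -> z != 0) ->
  exists (n : nat) (m : 'I_n.+1 -> nat) (ws : 'I_n.+1 -> valuation L),
    [/\ m ord0 = D, ws ord0 = w,
        forall z, z \in zs -> \sum_i (m i)%:R * ws i (iota z) = 0 &
        forall a, \sum_i (m i)%:R * local_height (ws i) (iota a) <= H a].
Proof.
move=> wv [n [m [vs [ntv pf hb]]]] zs0.
have /boolp.choice[ws hws] : forall i : 'I_n, exists w' : valuation L,
    forall c, c != 0 -> w' (iota c) = vs i c.
  by move=> i; apply: extend_valuation_field.
pose m' (i : 'I_n.+1) := if unlift ord0 i is Some j then m j else D.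
pose ws' (i : 'I_n.+1) := if unlift ord0 i is Some j then ws j else w.
have m0 : m' ord0 = D by rewrite /m' unlift_none.
have w0 : ws' ord0 = w by rewrite /ws' unlift_none.
have mS j : m' (lift ord0 j) = m j by rewrite /m' liftK.
have wS j : ws' (lift ord0 j) = ws j by rewrite /ws' liftK.
have lhE (u : valuation L) (v : valuation F) : (forall c, c != 0 -> u (iota c) = v c) ->
    forall a, local_height u (iota a) = local_height v a.
  move=> uv a; rewrite /local_height fmorph_eq0; case: eqP => // /eqP a0.
  by rewrite uv.
exists n, m', ws'; split=> //.
- move=> z hz; rewrite big_ord_recl m0 w0 wv ?zs0 // -[RHS](pf z hz); congr (_ + _).
  by apply: eq_bigr => j _; rewrite mS wS hws // zs0.
- move=> a; apply: le_trans (hb a); rewrite big_ord_recl m0 w0 (lhE w v0) //.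
  rewrite lerD2l le_eqVlt; apply/orP; left; apply/eqP; apply: eq_bigr => j _.
  by rewrite mS wS (lhE _ _ (hws j)).
Qed.

(** A pole of b at O contributes at least deg O / M to the height of b. *)
Lemma integral_large_degree (s : seq F) : exists C : nat, forall O v0,
  is_prime O -> discrete M v0 -> (forall zs : seq F, (forall z, z \in zs -> z != 0) ->
     product_formula H (deg O) v0 zs) -> (C < deg O)%N ->
  forall a, a \in s -> vge v0 0 a.
Proof.
case: sys => M0 _ _; have Mq : (0 : rat) < M%:R by rewrite ltr0n.
elim: s => [|b s [C hC]]; first by exists 0%N.
have [N hN] := archi_rat (M%:R * H b) (@ltr01 rat).
exists (maxn N C) => O v0 pO dv pf; rewrite gtn_max => /andP[hNd hCd] a.
rewrite inE => /predU1P[->|ha]; last exact: (hC O v0 pO dv pf hCd a ha).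
apply: contrapT => /negP; rewrite /vge negb_or -ltNge => /andP[b0 vb].
have [|n [m [vs [_ _ hb]]]] := pf [::]; first by [].
have [l hl] := dv b b0.
have lneg : (l%:~R : rat) <= -1.
  have l0 : l < 0 by rewrite -(ltrz0 rat) -hl pmulr_rlt0.
  have : l <= -1 by lia.
  by rewrite -(ler_int rat).
have h1 : 1 <= M%:R * local_height v0 b.
  by rewrite local_height_neg // mulrN hl; lra.
have h2 : (deg O)%:R * local_height v0 b <= H b.
  apply: le_trans (hb b); rewrite lerDl sumr_ge0 // => i _.
  by rewrite mulr_ge0 ?ler0n ?local_height_ge0.
have h3 : (deg O)%:R <= M%:R * H b.
  apply: le_trans (ler_wpM2l (ltW Mq) h2); rewrite mulrCA ler_peMr // ler0n.
move: hNd; rewrite ltnNge -(ler_nat rat) => /negP; apply; apply: le_trans h3 _.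
by rewrite mulr1 in hN.
Qed.
End PlacesOnL.

Section OrbitHeight.
Variables (F L : fieldType) (iota : {rmorphism F -> L}).
Variables (E : splittingFieldType F) (k : {rmorphism E -> L}).
Hypotheses (galE : galois 1 {:E}) (kE : forall a : F, k a%:A = iota a).
Local Notation G := ('Gal({:E} / 1%VS))%g.

Definition conj_emb (x : gal_of {:E}) : {rmorphism E -> L} := k \o x.

Lemma conj_embE x (a : F) : conj_emb x a%:A = iota a.
Proof. by rewrite /= linearZ rmorph1; exact: kE. Qed.

Lemma norm_exists : exists nF : E -> F, forall z, galNorm 1%VS {:E} z = (nF z)%:A.
Proof.
have /boolp.choice[nF h] : forall z : E, exists c : F, galNorm 1%VS {:E} z = c%:A.
  move=> z; have := mem_galNorm galE (memvf z).
  by case/vlineP => c hc; exists c.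
by exists nF.
Qed.

Variables (nF : E -> F) (hnF : forall z, galNorm 1%VS {:E} z = (nF z)%:A).

Lemma norm_neq0 z : z != 0 -> nF z != 0.
Proof.
move=> z0; have : galNorm 1%VS {:E} z != 0 by rewrite galNorm_eq0.
by rewrite hnF; apply: contraNneq => ->; rewrite scale0r.
Qed.

Lemma norm_value (w : valuation L) z : z != 0 ->
  \sum_(x in G) w (conj_emb x z) = w (iota (nF z)).
Proof.
move=> z0; rewrite -valuation_prod => [|x _]; last by rewrite fmorph_eq0.
by rewrite -kE -hnF /galNorm rmorph_prod.
Qed.

Variable f : {fraction {poly F}}.
Local Notation d := (ratdeg f).
Hypothesis d0 : (0 < d)%N.
Variables (n : nat) (m : 'I_n.+1 -> nat) (ws : 'I_n.+1 -> valuation L).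

(** The height of b times the degree of E over F. *)
Definition orbit_height (b : option E) : rat :=
  \sum_i (m i)%:R * \sum_(x in G) point_height (ws i) (omap (conj_emb x) b).

Variables (cs : seq F) (K1 Ha : rat) (alpha : F).
Hypothesis hcs : forall (w : valuation L) (b : option L),
  d%:R * point_height w b <=
  point_height w (ratmap iota f b) - w (point_scale f iota b) + height_sum iota w cs.
Hypothesis hK1 : \sum_i (m i)%:R * height_sum iota (ws i) cs <= K1.
Hypothesis hHa : \sum_i (m i)%:R * local_height (ws i) (iota alpha) <= Ha.

Let K10 : 0 <= K1.
Proof.
apply: le_trans hK1; apply: sumr_ge0 => i _; rewrite mulr_ge0 ?ler0n //.
exact: height_sum_ge0.
Qed.
Let Ha0 : 0 <= Ha.
Proof.
apply: le_trans hHa; apply: sumr_ge0 => i _; rewrite mulr_ge0 ?ler0n //.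
exact: local_height_ge0.
Qed.

Local Notation fE := (ratmap (in_alg E) f).
Local Notation eE := (point_scale f (in_alg E)).

(** Sum [height_step] over the places and the conjugates; the terms point_scale
    add up to the values of a norm, and the product formula removes them. *)
Lemma orbit_height_step b :
  \sum_i (m i)%:R * ws i (iota (nF (eE b))) = 0 ->
  d%:R * orbit_height b <= orbit_height (fE b) + #|G|%:R * K1.
Proof.
move=> pf; have e0 : eE b != 0 by apply: point_scale_neq0.
have pt x : ratmap iota f (omap (conj_emb x) b) = omap (conj_emb x) (fE b).
  by symmetry; apply: ratmap_tower => a; apply: conj_embE.
have sc x : point_scale f iota (omap (conj_emb x) b) = conj_emb x (eE b).
  by symmetry; apply: point_scale_tower => a; apply: conj_embE.
have -> : orbit_height (fE b) = orbit_height (fE b) - \sum_i (m i)%:R * ws i (iota (nF (eE b))).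
  by rewrite pf subr0.
have : #|G|%:R * \sum_i (m i)%:R * height_sum iota (ws i) cs <= #|G|%:R * K1.
  by rewrite ler_wpM2l ?ler0n.
rewrite -(lerD2l (orbit_height (fE b) - \sum_i (m i)%:R * ws i (iota (nF (eE b))))).
apply: le_trans; rewrite /orbit_height !mulr_sumr -sumrB -big_split /=.
apply: ler_sum => i _; rewrite -norm_value // mulrCA [in leRHS]mulrCA -mulrBr -mulrDr.
rewrite ler_wpM2l ?ler0n // mulr_sumr -sumrB mulr_natl -sumr_const -big_split /=.
by apply: ler_sum => x _; have := hcs (ws i) (omap (conj_emb x) b); rewrite pt sc.
Qed.

(** Iterating h(f(b)) >= d h(b) - K1 backwards from alpha gives a bound for
    (d - 1) h(b) that does not grow with the number l of steps.  For d = 1 it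
    says nothing about h(b), but then the Wronskian is a constant and the height
    enters the final estimate with the factor d - 1 as well. *)
Lemma orbit_height_bound l b :
  (forall j, (j < l)%N -> \sum_i (m i)%:R * ws i (iota (nF (eE (iter j fE b)))) = 0) ->
  iter l fE b = Some alpha%:A ->
  (d.-1)%:R * orbit_height b <= #|G|%:R * ((d.-1)%:R * Ha + K1).
Proof.
have g0 : (0 : rat) <= #|G|%:R by rewrite ler0n.
have dq : (0 : rat) <= (d.-1)%:R by rewrite ler0n.
have dE : (d%:R : rat) = (d.-1)%:R + 1 by rewrite -{1}(prednK d0) -addn1 natrD.
elim: l b => [|l IH] b pf => [/= ->|].
  have : orbit_height (Some alpha%:A) <= #|G|%:R * Ha.
    apply: le_trans (ler_wpM2l g0 hHa); rewrite /orbit_height mulr_sumr.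
    apply: ler_sum => i _; rewrite mulrCA ler_wpM2l ?ler0n //.
    rewrite mulr_natl -sumr_const; apply: ler_sum => x _ /=.
    by have := conj_embE x alpha; rewrite /= => ->.
  move=> h; have := ler_wpM2l dq h; have := mulr_ge0 g0 K10; lra.
rewrite iterSr => hl; have h1 := orbit_height_step (pf 0%N isT).
have h2 := IH (fE b) _ hl.
have {}h2 : d.-1%:R * orbit_height (fE b) <= #|G|%:R * (d.-1%:R * Ha + K1).
  by apply: h2 => j hj; rewrite -iterSr; apply: (pf j.+1).
have h3 := ler_wpM2l dq h1.
have h4 := mulr_ge0 g0 K10; have h5 := mulr_ge0 (mulr_ge0 g0 dq) Ha0.
have h6 := mulr_ge0 dq (mulr_ge0 g0 (mulr_ge0 dq Ha0)).
have d1 : (0 : rat) < d%:R by rewrite ltr0n.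
rewrite -(ler_pM2l d1); rewrite dE in h3 *.
nra.
Qed.
End OrbitHeight.

Fact rat_lower (c h s x : rat) : - c * h - s <= x -> 0 <= x + c * h + s.
Proof. lra. Qed.

Fact rat_gain (g c h s x : rat) : g - c * h <= x -> 0 <= s -> g <= x + c * h + s.
Proof. lra. Qed.

Fact rat_total (a x g K h : rat) :
  a <= g * K -> x <= g * h -> 2%:R * a + x <= g * (2%:R * K + h).
Proof. lra. Qed.

Lemma lead_coef_nsmall (F L : fieldType) (iota : {rmorphism F -> L}) (w : valuation L)
    (R : {poly F}) : R != 0 -> vge w 0 (iota (lead_coef R)^-1) ->
  exists i, ~~ small w (map_poly iota R)`_i.
Proof.
move=> R0; have lR : iota (lead_coef R) != 0 by rewrite fmorph_eq0 lead_coef_eq0.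
rewrite fmorphV vgeE ?invr_eq0 // valuationV // => h; exists (size R).-1.
by rewrite coef_map /= -lead_coefE /small negb_or lR -leNgt /=; lra.
Qed.

(** The constant C is chosen first: C1 makes the coefficients of f, the inverse of
    one coefficient of each Wronskian, and the data of the exceptional points
    integral at O; C2 comes from the comparison of [wronskian_gain] with the
    product formula. *)
Lemma ramified_degree_bound (F : fieldType) (l : nat) (L : fieldType)
    (iota : {rmorphism F -> L}) (f : {fraction {poly F}}) (alpha : F)
    (H : F -> rat) (M : nat) (deg : set F -> nat) :
  l \in [pchar F] -> is_separable_closure iota -> ~~ (l %| ratdeg f)%N ->
  place_system H M deg ->
  exists C, forall O, is_prime O ->
    ramified_at iota (abelian_orbit_field iota f alpha) O -> (deg O <= C)%N.
Proof.
move=> hl [hsep _] hld sys; have [M0 _ sysO] := sys.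
set d := ratdeg f in hld *.
have d0 : (0 < d)%N by rewrite lt0n; apply: contraNneq hld => ->; rewrite dvdn0.
have dq : (0 : rat) < d%:R by rewrite ltr0n.
have Mq : (0 : rat) < M%:R by rewrite ltr0n.
pose P := ratnum f; pose Q := ratden f.
pose Wr := wronskian P Q; pose Wv := wronskian (rev_poly d P) (rev_poly d Q).
have sP : (size P <= d.+1)%N := size_ratnum f.
have sQ : (size Q <= d.+1)%N := size_ratden f.
have cPQ : coprimep P Q := coprimep_rat f.
have ld := rat_lead d0.
have Wr0 : Wr != 0 by apply: (wronskian_neq0 hl hld).
have Wv0 : Wv != 0.
  apply: (wronskian_neq0 hl hld) => //; try exact: size_rev_poly.
    exact: coprimep_rev_poly.
  rewrite !coef_rev_poly leqnn subnn; apply: contraT; rewrite negb_or !negbK => /andP[/eqP p0 /eqP q0].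
  have := PQ_neq0 f (@idfun F : {rmorphism F -> F}) 0.
  by rewrite !horner_coef0 !coef_map /= -/P -/Q p0 q0 eqxx.
have Q0 : Q != 0 := ratden_neq0 f.
have alg : algebraic_over iota.
  by move=> x; have [R sR rR] := hsep x; exists R => //; apply: separable_poly_neq0.
have [cs1 hcs1] := height_step d0; have [cs2 hcs2] := wronskian_lower d0.
have [|ys hys] := @finite_roots L (map_poly iota (Q * Wr)).
  by rewrite map_poly_eq0 mulf_neq0.
have /boolp.choice[sy hsy] := fun y => separable_unramified (hsep y) alg.
pose sI := (P : seq F) ++ (Q : seq F) ++ [:: (lead_coef Wr)^-1; (lead_coef Wv)^-1] ++ flatten (map sy ys).
have [C1 hC1] := integral_large_degree sys sI.
pose HS (s : seq F) := \sum_(a <- s) H a.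
pose K := (d.-1)%:R * H alpha + HS cs1.
pose B := d%:R * M%:R * (2%:R * K + HS cs2).
have [C2 hC2] := archi_rat B (@ltr01 rat).
exists (maxn C1 C2) => O pO [W [hW WO] [x [Mx x0 hx]]].
rewrite leqNgt; apply/negP; rewrite gtn_max => /andP[hd1 hd2].
have [v0 [dO v0O dv ntv pf]] := sysO O pO.
have hint := hC1 O v0 pO dv pf hd1.
set M' := abelian_orbit_field iota f alpha in hW Mx.
have M'div : divring_closed (mem M') by apply: adjoin_divring.
have M'F : range iota `<=` M' by apply: adjoin_range.
have [w [wF wW]] := extend_lies_over alg M'div M'F (conj hW WO) v0O ntv.
have [p [p0 vp vpM pmin]] := uniformizer M0 dv ntv.
have wp : 0 < w (iota p) by rewrite wF.
have wpmin c : c != 0 -> 0 < w (iota c) -> w (iota p) <= w (iota c).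
  by move=> c0; rewrite !wF //; apply: pmin.
have [T [Tu maxT]] := max_unramified iota w.
have [Tdiv TF Tval] := Tu.
have Tr : subring_closed (mem T) by apply: divring_subring.
have hintw a : a \in sI -> vge w 0 (iota a).
  move=> ha; have := hint a ha; rewrite /vge fmorph_eq0; case: eqP => //= /eqP a0.
  by rewrite wF.
suff orbT : forall n y, max_abelian iota y ->
    iter n (ratmap iota f) (Some y) = Some (iota alpha) -> T y.
  have Tx : T x by apply: Mx => // y [[n hy] ay]; apply: orbT hy.
  have [c c0 wc] := Tval x Tx x0.
  have c0' : iota c != 0 by rewrite fmorph_eq0.
  have Mc : M' (iota c) by apply: M'F; exists c.
  have /divring_closedE[_ _ M'V] := M'div.
  apply: (hx c c0); split; apply: wW; try exact: M'V.
    by rewrite vgeE ?mulf_neq0 ?invr_eq0 // valuation_div // wc subrr.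
  by rewrite vgeE ?mulf_neq0 ?invr_eq0 // valuation_div // wc subrr.
elim=> [|n IH] y ay; first by case=> ->; apply: TF; exists alpha.
(* critical points and poles of f *)
have [/hys yys|ny] := boolP (root (map_poly iota (Q * Wr)) y).
  move=> _; apply: (hsy y w p T) => // a ha; apply: hintw.
  by rewrite !mem_cat; apply/orP; right; apply/orP; right; apply/orP; right;
     apply/flatten_mapP; exists y.
have [E [k [kE galE abE [eta _ ey]]]] := ay.
move=> hiter; apply: contrapT => nTy.
have kA (a : F) : k (in_alg E a) = iota a by exact: kE.
pose G := ('Gal({:E} / 1%VS))%g.
move: ny; rewrite rmorphM /root hornerM mulf_eq0 negb_or => /andP[Qy0 Wy0].
have Qeta : (map_poly (in_alg E) Q).[eta] != 0.
  by rewrite -(fmorph_eq0 k) (horner_tower kA) ey.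
pose b := (map_poly (in_alg E) P).[eta] / (map_poly (in_alg E) Q).[eta].
have fEb : ratmap (in_alg E) f (Some eta) = Some b.
  by rewrite /ratmap -/P -/Q (negbTE Qeta).
have Tb : T (k b).
  apply: IH; first by exists E, k; split=> //; exists b.
  move: hiter; rewrite iterSr -ey -[Some (k eta)]/(omap k (Some eta)) -(ratmap_tower kA) fEb.
  by [].
have iterE : iter n.+1 (ratmap (in_alg E) f) (Some eta) = Some alpha%:A.
  have e2 : omap k (Some eta) = Some y by rewrite /= ey.
  have := iter_ratmap_tower kA f n.+1 (Some eta); rewrite e2 hiter.
  case: (iter n.+1 _ _) => //= z [hz]; congr Some; apply: (fmorph_inj k).
  by rewrite hz kE.
have [nF hnF] := norm_exists galE.
pose WE := (map_poly (in_alg E) Wr).[eta].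
have WE0 : WE != 0 by rewrite -(fmorph_eq0 k) (horner_tower kA) ey.
pose fE := ratmap (in_alg E) f.
pose zs := nF WE :: mkseq (fun j => nF (point_scale f (in_alg E) (iter j fE (Some eta)))) n.+1.
have zs0 z : z \in zs -> z != 0.
  rewrite inE => /predU1P[->|/mapP[j _ ->]]; first exact: norm_neq0 hnF _ WE0.
  by apply: (norm_neq0 hnF); apply: point_scale_neq0.
have [N [m [ws [m0 ws0 hpf hht]]]] := places_on_L alg wF (pf zs zs0) zs0.
have hsum cs : \sum_i (m i)%:R * height_sum iota (ws i) cs <= HS cs.
  rewrite /height_sum (eq_bigr _ (fun i _ => mulr_sumr _ _ _ _)) exchange_big /=.
  by apply: ler_sum => a _; apply: hht.
have hO := @orbit_height_bound F L iota E k kE nF hnF f d0 N m ws cs1 (HS cs1) (H alpha)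
  alpha (hcs1 L iota) (hsum cs1) (hht alpha) n.+1 (Some eta) _ iterE.
have {}hO : d.-1%:R * orbit_height k m ws (Some eta) <= #|G|%:R * K.
  apply: hO => j hj; apply: hpf; rewrite inE; apply/orP; right.
  by apply/mapP; exists j; rewrite ?mem_iota.
(* the conjugates of y are all close to the critical locus *)
have gain z : z \in G -> w (iota p) / d%:R - (d.-1).*2%:R * local_height w (conj_emb k z eta)
    <= w (conj_emb k z WE).
  move=> hz.
  have cE (a : F) : conj_emb k z (in_alg E a) = iota a by exact: conj_embE.
  rewrite /WE (horner_tower cE) /Wr map_wronskian.
  apply: (@wronskian_gain F L iota w p p0 wp wpmin T Tu maxT f d0 (conj_emb k z b)).
  - move=> i; rewrite coef_map /=; have [lt|ge] := ltnP i (size P); last first.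
      by rewrite nth_default // rmorph0 vge0.
    by apply: hintw; rewrite mem_cat mem_nth.
  - move=> i; rewrite coef_map /=; have [lt|ge] := ltnP i (size Q); last first.
      by rewrite nth_default // rmorph0 vge0.
    by apply: hintw; rewrite !mem_cat mem_nth ?orbT.
  - rewrite -map_wronskian; apply: lead_coef_nsmall => //; apply: hintw.
    by rewrite !mem_cat !inE eqxx !orbT.
  - rewrite -!map_rev_poly -map_wronskian; apply: lead_coef_nsmall => //; apply: hintw.
    by rewrite !mem_cat !inE eqxx !orbT.
  - by rewrite -map_wronskian -(horner_tower cE) fmorph_eq0.
  - exact: (adjoin_mem kE Tr TF Tb (abelian_conj galE abE b hz)).
  - by move=> Tz; apply: nTy; rewrite -ey; apply: (adjoin_mem kE Tr TF Tz (abelian_conj_inv galE abE eta hz)).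
  - rewrite -!(horner_tower cE) -rmorphM; congr (conj_emb k z _).
    by rewrite /b divfK.
pose c : rat := (d.-1).*2%:R.
have lower i z : 0 <= ws i (conj_emb k z WE) + c * local_height (ws i) (conj_emb k z eta)
    + height_sum iota (ws i) cs2.
  have cE (a : F) : conj_emb k z (in_alg E a) = iota a by exact: conj_embE.
  have := hcs2 L iota (ws i) (conj_emb k z eta); rewrite -(horner_tower cE) -/Wr -/WE.
  by rewrite fmorph_eq0 => /(_ WE0); rewrite -/c; apply: rat_lower.
have Sw : \sum_i (m i)%:R * \sum_(z in G) ws i (conj_emb k z WE) = 0.
  rewrite -[RHS](hpf (nF WE) (mem_head _ _)); apply: eq_bigr => i _.
  by rewrite (norm_value kE hnF).
have Sh : \sum_i (m i)%:R * \sum_(z in G) c * local_height (ws i) (conj_emb k z eta) =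
    2%:R * ((d.-1)%:R * orbit_height k m ws (Some eta)).
  rewrite mulrA -natrM mul2n -/c /orbit_height mulr_sumr; apply: eq_bigr => i _.
  by rewrite -mulr_sumr mulrCA.
have Sc : \sum_i (m i)%:R * \sum_(z in G) height_sum iota (ws i) cs2 <= #|G|%:R * HS cs2.
  apply: le_trans (ler_wpM2l (ler0n _ _) (hsum cs2)); rewrite mulr_sumr.
  by apply: ler_sum => i _; rewrite sumr_const -[_ *+ #|_|]mulr_natl mulrCA.
have main : (deg O)%:R * (#|G|%:R * (w (iota p) / d%:R)) <=
  \sum_i (m i)%:R * \sum_(z in G) (ws i (conj_emb k z WE) +
     c * local_height (ws i) (conj_emb k z eta) + height_sum iota (ws i) cs2).
  rewrite big_ord_recl m0 ws0; apply: ler_wpDr.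
    by apply: sumr_ge0 => i _; rewrite mulr_ge0 ?ler0n // sumr_ge0.
  rewrite ler_wpM2l ?ler0n // mulr_natl -sumr_const; apply: ler_sum => z hz.
  exact: rat_gain (gain z hz) (height_sum_ge0 iota w cs2).
have {}main : (deg O)%:R * (#|G|%:R * (w (iota p) / d%:R)) <= #|G|%:R * (2%:R * K + HS cs2).
  apply: le_trans main _.
  have -> : \sum_i (m i)%:R * \sum_(z in G) (ws i (conj_emb k z WE) +
     c * local_height (ws i) (conj_emb k z eta) + height_sum iota (ws i) cs2) =
     \sum_i (m i)%:R * \sum_(z in G) ws i (conj_emb k z WE) +
     \sum_i (m i)%:R * \sum_(z in G) c * local_height (ws i) (conj_emb k z eta) +
     \sum_i (m i)%:R * \sum_(z in G) height_sum iota (ws i) cs2.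
    by rewrite -!big_split /=; apply: eq_bigr => i _; rewrite -!mulrDr -!big_split.
  by rewrite Sw Sh add0r; apply: rat_total.
have G0 : (0 : rat) < #|G|%:R by rewrite ltr0n cardG_gt0.
move: main; rewrite mulrCA ler_pM2l // => main.
have wpM : M%:R^-1 <= w (iota p) by rewrite wF.
have h1 : (deg O)%:R <= B.
  rewrite /B; apply: le_trans (ler_wpM2l (ltW (mulr_gt0 dq Mq)) main).
  have -> : d%:R * M%:R * ((deg O)%:R * (w (iota p) / d%:R)) = (deg O)%:R * (M%:R * w (iota p)).
    by field; rewrite lt0r_neq0.
  rewrite ler_peMr ?ler0n //.
  by rewrite -(ler_pM2l Mq) mulfV ?lt0r_neq0 // in wpM.
move: hd2; rewrite ltnNge -(ler_nat rat) => /negP; apply.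
by apply: le_trans h1 _; rewrite mulr1 in hC2.
Qed.

Theorem theorem2p1 (p : nat) (hp : prime p)
  (F : fieldExtType {fraction {poly 'F_p}})
  (L : fieldType) (iota : {rmorphism F -> L})
  (hL : is_separable_closure iota)
  (f : {fraction {poly F}}) (d : nat) (hd : ratdeg f = d) (hpd : ~~ (p %| d)%N)
  (alpha : F) :
  finite_set [set v : set F |
    is_prime v /\ ramified_at iota (abelian_orbit_field iota f alpha) v].
Proof.
have [rv hrv] := rplaces_exist 'F_p.
have tfi : injective (@FracField.tofrac {poly 'F_p}).
  by move=> x y /eqP; rewrite tofrac_eq => /eqP.
have [H [M [deg sys]]] := global_places tfi (@frac_exists {poly 'F_p}) hrv F.
have hl : p \in [pchar F].
  by rewrite pchar_lalg (rmorph_pchar (@FracField.tofrac {poly 'F_p})) // pchar_lalg pchar_Fp.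
rewrite -hd in hpd.
have [C hC] := ramified_degree_bound alpha hl hL hpd sys.
have [_ finC _] := sys.
apply: sub_finite_set (finC C) => O [pO rO]; split=> //.
exact: hC.
Qed.
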